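(* Let $(E,\nu,\Gamma)$ be a full Markov triple with infinitesimal generator $L$ and Dirichlet form $\mathcal{E}$, and let $F\in\operatorname{Dom}(\mathcal{E})$. Assume that (1) there exists some $p>1$ such that $\mathbb{E}[1/\Gamma(F)^p]<\infty$ and $\mathbb{E}[\Gamma(F)^{p/(p-1)}]<\infty$; (2) $\tau$ is the function defined by $\tau(x)=\mathbb{E}[\Gamma(F)\mid F=x]$; (3) for a given constant $a$, the function $f_0(x)=\int_a^x\frac{1}{\tau(y)}\,dy$ satisfies $f_0(F)\in\operatorname{Dom}(L)$. Then $F$ admits a density on $\mathbb{R}$, and the density function has the representation $$p_F(x)=-\mathbb{E}\big[\mathbf 1_{\{x\le F\}}\,Lf_0(F)\big].$$
   Context: Full Markov triple $(E,\nu,\Gamma)$ (in the sense of Bakry–Gentil–Ledoux), with $\mathbb{E}$ denoting integration against $\nu$: - $(E,\mathcal{F},\nu)$ is a probability space with $L^2(E,\mathcal{F},\nu)$ separable. $\mathcal{A}$ is a vector space of real random variables on it, stable under products and under the action of smooth functions $\Psi:\mathbb{R}^k\to\mathbb{R}$. $\mathcal{A}_0\subseteq\mathcal{A}$ is a subalgebra of bounded functions, dense in $L^p(E,\nu)$ for all $p\in[1,\infty)$, stable under smooth functions, and an ideal in $\mathcal{A}$. - The carré du champ $\Gamma:\mathcal{A}_0\times\mathcal{A}_0\to\mathcal{A}_0$ is bilinear, symmetric, with $\Gamma(F):=\Gamma(F,F)\ge0$; for every $F\in\mathcal{A}_0$ there is a finite $c_F$ with $|\mathbb{E}[\Gamma(F,G)]|\le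 c_F\|G\|_2$ for all $G\in\mathcal{A}_0$. The Dirichlet form is $\mathcal{E}(F,G)=\mathbb{E}[\Gamma(F,G)]$; $\operatorname{Dom}(\mathcal{E})\subseteq L^2(\nu)$ is the completion of $\mathcal{A}_0$ under $(\|F\|_2^2+\mathcal{E}(F,F))^{1/2}$, and $\mathcal{E},\Gamma$ extend to $\operatorname{Dom}(\mathcal{E})\times\operatorname{Dom}(\mathcal{E})$ by continuity and polarization, with $\Gamma$ valued in $L^1(\nu)$. - $L$ is a self-adjoint linear operator defined on $\mathcal{A}_0$ by $\mathbb{E}[G\,LF]=\mathbb{E}[F\,LG]=-\mathbb{E}[\Gamma(F,G)]$, with $L(\mathcal{A}_0)\subseteq\mathcal{A}_0$ and $\mathbb{E}[LF]=0$. $\operatorname{Dom}(L)$ consists of all $F\in\operatorname{Dom}(\mathcal{E})$ with $|\mathcal{E}(F,G)|\le c_F\|G\|_2$ for all $G\in\operatorname{Dom}(\mathcal{E})$ and some finite $c_F$; $L$ extends to $\operatorname{Dom}(L)$ by integration by parts. $L1=0$, and $L$ is ergodic: $LF=0$ with $F\in\operatorname{Dom}(L)$ implies $F$ constant. - $L:\mathcal{A}\to\mathcal{A}$ extends $L:\mathcal{A}_0\to\mathcal{A}_0$, and on $\mathcal{A}\times\mathcal{A}$, $\Gamma(F,G)=\frac12(L(FG)-F\,LG-G\,LF)$. For $F\in\mathcal{A}$, $\Gamma(F)\ge0$ with equality iff $F$ is constant. - Diffusion property: for $C^\infty$ functions $\Psi:\mathbb{R}^m\to\mathbb{R}$ and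 $F_1,\dots,F_m,G\in\mathcal{A}$, $\Gamma(\Psi(F_1,\dots,F_m),G)=\sum_j\partial_j\Psi(F_1,\dots,F_m)\Gamma(F_j,G)$ and $L\Psi(F_1,\dots,F_m)=\sum_i\partial_i\Psi(F_1,\dots,F_m)LF_i+\sum_{i,j}\partial_{ij}\Psi(F_1,\dots,F_m)\Gamma(F_i,F_j)$. - The integration by parts formula also holds if $F\in\mathcal{A}$, $G\in\mathcal{A}_0$ (or vice versa). $Lf_0(F)$ means $L$ applied to the random variable $f_0(F)$. *)

(* Defs.v *)
From HB Require Import structures.
From mathcomp Require Import all_boot all_order all_algebra.
From mathcomp Require Import all_classical all_reals all_analysis.

Set Implicit Arguments.
Unset Strict Implicit.
Unset Printing Implicit Defensive.
Import Order.TTheory GRing.Theory Num.Theory.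
Import numFieldNormedType.Exports.

Local Open Scope classical_set_scope.
Local Open Scope ring_scope.

Section smooth.
Context {R : realType} {k : nat}.

Definition partial (i : 'I_k) (Psi : 'rV[R]_k -> R) : 'rV[R]_k -> R :=
  fun x => 'D_(delta_mx 0 i) Psi x.

(* C^oo: every iterated partial derivative is everywhere differentiable. *)
Definition smooth (Psi : 'rV[R]_k -> R) : Prop :=
  forall (s : seq 'I_k) (x : 'rV[R]_k), differentiable (foldr partial Psi s) x.

Definition comp_rv {T : Type} (Psi : 'rV[R]_k -> R) (F : 'I_k -> T -> R) : T -> R :=
  fun w => Psi (\row_j F j w).

End smooth.

(* Random variables are represented by functions T -> R; identities between
   them are almost sure identities. *)
Section Dirichlet.
Context d (T : measurableType d) (R : realType) (nu : probability T R).
Variables (A0 : set (T -> R)) (Gam : (T -> R) -> (T -> R) -> (T -> R)).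

Definition L2norm (F : T -> R) : \bar R := 'N[nu]_2%:E[EFin \o F]%E.

Definition dform (F G : T -> R) : \bar R := 'E_nu[Gam F G]%E.

Definition energy_norm (F : T -> R) : \bar R :=
  ((L2norm F `^ 2 + dform F F) `^ 2^-1)%E.

(* u is a sequence in A0, Cauchy for the energy norm, with L^2-limit F: the
   elements of the completion of A0, seen as elements of L^2. *)
Definition energy_approx (u : nat -> T -> R) (F : T -> R) : Prop :=
  [/\ forall n, A0 (u n),
      forall e : R, 0 < e -> exists N : nat, forall m n : nat,
        (N <= m)%N -> (N <= n)%N -> (energy_norm (u m \- u n)%R < e%:E)%E
    & L2norm (u n \- F) @[n --> \oo] --> 0%E].

Definition DomE : set (T -> R) :=
  [set F | F \in Lfun nu 2%:E /\ exists u, energy_approx u F].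

Definition DomL : set (T -> R) :=
  [set F | DomE F /\ exists c : R, forall G, DomE G ->
    (`|dform F G| <= c%:E * L2norm G)%E].

End Dirichlet.

(* As in the literature, the same letters L and Gam denote the operators on
   A0, on A, and on the domains DomL and DomE; Gam and L are irrelevant outside
   these sets. *)
Record full_markov_triple d (T : measurableType d) (R : realType)
    (nu : probability T R) (A A0 : set (T -> R))
    (Gam : (T -> R) -> (T -> R) -> (T -> R)) (L : (T -> R) -> (T -> R)) : Prop := {
  L2_separable : exists g : nat -> T -> R,
    (forall n, g n \in Lfun nu 2%:E) /\
    forall f, f \in Lfun nu 2%:E -> forall e : R, 0 < e ->
      exists n, (L2norm nu (f \- g n)%R < e%:E)%E ;

  A_measurable : forall F, A F -> measurable_fun setT F ;
  A_zero : A (cst 0) ;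
  A_linear : forall (a : R) F G, A F -> A G -> A (fun w => a * F w + G w) ;
  A_mul : forall F G, A F -> A G -> A (F \* G) ;
  A_smooth : forall k (Psi : 'rV[R]_k -> R) (F : 'I_k -> T -> R),
    smooth Psi -> (forall i, A (F i)) -> A (comp_rv Psi F) ;

  A0_sub : A0 `<=` A ;
  A0_zero : A0 (cst 0) ;
  A0_linear : forall (a : R) F G, A0 F -> A0 G -> A0 (fun w => a * F w + G w) ;
  A0_mul : forall F G, A0 F -> A0 G -> A0 (F \* G) ;
  A0_bounded : forall F, A0 F -> exists M : R, {ae nu, forall w, `|F w| <= M} ;
  A0_dense : forall p : R, 1 <= p -> forall f, f \in Lfun nu p%:E ->
    forall e : R, 0 < e ->
      exists g, A0 g /\ ('N[nu]_p%:E[EFin \o (f \- g)%R] < e%:E)%E ;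
  A0_smooth : forall k (Psi : 'rV[R]_k -> R) (F : 'I_k -> T -> R),
    smooth Psi -> (forall i, A0 (F i)) -> A0 (comp_rv Psi F) ;
  A0_ideal : forall F G, A F -> A0 G -> A0 (F \* G) ;

  Gam_A0 : forall F G, A0 F -> A0 G -> A0 (Gam F G) ;
  Gam_sym : forall F G, A0 F -> A0 G -> Gam F G = Gam G F %[ae nu] ;
  Gam_linear : forall (a : R) F G H, A0 F -> A0 G -> A0 H ->
    Gam (fun w => a * F w + G w) H =
      (fun w => a * Gam F H w + Gam G H w) %[ae nu] ;
  Gam_bound : forall F, A0 F -> exists c : R, forall G, A0 G ->
    (`|dform nu Gam F G| <= c%:E * L2norm nu G)%E ;

  Gam_L1 : forall F G, DomE nu A0 Gam F -> DomE nu A0 Gam G ->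
    Gam F G \in Lfun nu 1%E ;
  Gam_ext : forall F G u v, DomE nu A0 Gam F -> DomE nu A0 Gam G ->
    energy_approx nu A0 Gam u F -> energy_approx nu A0 Gam v G ->
    'N[nu]_1[EFin \o (Gam (u n) (v n) \- Gam F G)%R]%E @[n --> \oo] --> 0%E ;

  L_A0 : forall F, A0 F -> A0 (L F) ;
  L_sym : forall F G, A0 F -> A0 G -> ('E_nu[G \* L F] = 'E_nu[F \* L G])%E ;
  L_ibp : forall F G, A0 F -> A0 G -> ('E_nu[G \* L F] = - dform nu Gam F G)%E ;
  L_mean : forall F, A0 F -> 'E_nu[L F]%E = 0%E ;

  L_DomL : forall F, DomL nu A0 Gam F -> L F \in Lfun nu 2%:E ;
  L_DomL_ibp : forall F G, DomL nu A0 Gam F -> DomE nu A0 Gam G ->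
    ('E_nu[G \* L F] = - dform nu Gam F G)%E ;
  L_one : DomL nu A0 Gam (cst 1) /\ L (cst 1) = cst 0 %[ae nu] ;
  L_ergodic : forall F, DomL nu A0 Gam F -> L F = cst 0 %[ae nu] ->
    exists c : R, F = cst c %[ae nu] ;

  L_A : forall F, A F -> A (L F) ;
  L_ae : forall F G, A F -> A G -> F = G %[ae nu] -> L F = L G %[ae nu] ;
  L_linear : forall (a : R) F G, A F -> A G ->
    L (fun w => a * F w + G w) = (fun w => a * L F w + L G w) %[ae nu] ;
  Gam_A : forall F G, A F -> A G -> Gam F G =
    (fun w => 2^-1 * (L (F \* G) w - F w * L G w - G w * L F w)) %[ae nu] ;
  Gam_ge0 : forall F, A F -> {ae nu, forall w, 0 <= Gam F F w} ;
  Gam_eq0 : forall F, A F ->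
    (Gam F F = cst 0 %[ae nu] <-> exists c : R, F = cst c %[ae nu]) ;

  Gam_diffusion : forall m (Psi : 'rV[R]_m -> R) (F : 'I_m -> T -> R) G,
    smooth Psi -> (forall i, A (F i)) -> A G ->
    Gam (comp_rv Psi F) G =
      (fun w => \sum_(j < m) comp_rv (partial j Psi) F w * Gam (F j) G w) %[ae nu] ;
  L_diffusion : forall m (Psi : 'rV[R]_m -> R) (F : 'I_m -> T -> R),
    smooth Psi -> (forall i, A (F i)) ->
    L (comp_rv Psi F) =
      (fun w => \sum_(i < m) comp_rv (partial i Psi) F w * L (F i) w +
        \sum_(i < m) \sum_(j < m)
          comp_rv (partial i (partial j Psi)) F w * Gam (F i) (F j) w) %[ae nu] ;

  L_ibp_A : forall F G, A F -> A0 G ->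
    [/\ ('E_nu[G \* L F] = - 'E_nu[Gam F G])%E,
        ('E_nu[F \* L G] = - 'E_nu[Gam F G])%E
      & ('E_nu[G \* L F] = - 'E_nu[Gam G F])%E ]
}.

Section laws.
Context d (T : measurableType d) (R : realType) (nu : probability T R).

(* tau is a version of x |-> E[Y | F = x]. *)
Definition cond_exp_given (Y F : T -> R) (tau : R -> R) : Prop :=
  [/\ measurable_fun setT tau,
      nu.-integrable setT (EFin \o (tau \o F))
    & forall B : set R, measurable B ->
        (\int[nu]_(w in F @^-1` B) (Y w)%:E =
         \int[nu]_(w in F @^-1` B) (tau (F w))%:E)%E ].

Definition is_density (F : T -> R) (p : R -> R) : Prop :=
  [/\ measurable_fun setT p,
      forall x, 0 <= p x
    & forall B : set R, measurable B ->
        pushforward nu F B = (\int[lebesgue_measure]_(x in B) (p x)%:E)%E ].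

End laws.

Section primitive.
Context {R : realType}.

Definition oriented_integral (g : R -> \bar R) (a x : R) : \bar R :=
  (if (a <= x)%R then \int[lebesgue_measure]_(y in `[a, x]) g y
   else - \int[lebesgue_measure]_(y in `[x, a]) g y)%E.

(* Extended-real inverse: 1 / 0 = +oo. *)
Definition inv_tau (tau : R -> R) (y : R) : \bar R := ((tau y)%:E)^-1%E.

(* The integral of 1 / tau from a to x is a well-defined real number. *)
Definition primitive_defined (tau : R -> R) (a x : R) : Prop :=
  lebesgue_measure.-integrable `[Num.min a x, Num.max a x] (inv_tau tau).

(* x |-> \int_a^x dy / tau y, meaningful where primitive_defined holds. *)
Definition primitive_inv (tau : R -> R) (a : R) : R -> R :=
  fun x => fine (oriented_integral (inv_tau tau) a x).

End primitive.

(* Main.v *)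
Require Import Defs.
From HB Require Import structures.
From mathcomp Require Import all_boot all_order all_algebra.
From mathcomp Require Import all_classical all_reals all_analysis.
From mathcomp Require Import measurable_realfun.
From mathcomp Require Import ring lra.

Set Implicit Arguments.
Unset Strict Implicit.
Unset Printing Implicit Defensive.
Import Order.TTheory GRing.Theory Num.Theory.
Import numFieldNormedType.Exports.

Local Open Scope classical_set_scope.
Local Open Scope ring_scope.

(** Let [X] be the random variable [f0 (F)], where [f0] is a primitive of
    [1 / tau], and for a Borel set [B] let [G_B] be the primitive from [a] of
    the indicator of [B].  Suppose that the chain rule
      [Gam (phi F) (psi F) = phi' (F) * psi' (F) * Gam F F]
    holds for these primitives.  Integrating by parts,
      [E[G_B (F) * L X] = - E[1 / tau (F) * 1_B (F) * Gam F F] = - nu (F \in B)],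
    the last equality because [tau (F)] is the conditional expectation of
    [Gam F F].  As [G_B (F)] is the integral over [y] in [B] of
    [1_(y <= F) - 1_(y <= a)] and [E[L X] = 0], Fubini turns the left-hand side
    into the integral over [B] of [E[1_(y <= F) * L X]].  Hence
    [y |-> - E[1_(y <= F) * L X]] is a density of [F]: this is [tail_density].

    The work lies in the chain rule.  The diffusion property gives it for
    smooth functions of elements of [A], whereas here [F] only belongs to the
    domain of the Dirichlet form and the two primitives are in general not
    differentiable.  The relation [has_deriv F X xi] says that [(X, xi)] is in
    the closure of the pairs [(phi F, phi' F)] for the norm
    [E[X^2] + E[xi^2 * Gam F F]], and [has_deriv_dform] shows that
    [E[Gam X Y] = E[xi * eta * Gam F F]] on this closure: energies of [phi (u n)]
    converge along a sequence [u] of [A0] approximating [F] ([psi_cvg]), and a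
    diagonal argument does the rest ([has_deriv_q]).  The class of functions [g]
    for which the primitive of [g], composed with [F], has derivative [g (F)] is
    linear and stable under bounded pointwise limits; it contains sigmoids, hence
    indicators of rays, hence those of Borel sets ([prim_rule_indic]).

    For [f0], approximate [1 / tau] by simple functions ([has_deriv_primitive]).
    The moment condition on [1 / Gam F F] makes [Gam F F], hence [tau (F)],
    almost surely positive, and a conditional Jensen inequality makes
    [tau (F)^-2 * Gam F F] integrable ([inv_tau_sq]), which dominates the
    derivatives.  The primitives are dominated by [f0 (F)] itself, up to the
    following point.  Off the values of [F] the function [tau] is arbitrary, and
    may be negative on a set of positive Lebesgue measure; so [f0] contains the
    primitive of the negative part of [1 / tau].  Its derivative vanishes at [F],
    so composed with [F] it has no energy, and ergodicity makes it constant
    ([prim_neg_cst]). *)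

(** * Integrals and limits *)

Section integrals.
Context d (T : measurableType d) (R : realType) (mu : {measure set T -> \bar R}).
Local Notation intg f := (mu.-integrable setT (EFin \o f)).
Local Notation Ex f := (Rintegral mu setT f).

Lemma ae_and (P Q : T -> Prop) : {ae mu, forall w, P w} -> {ae mu, forall w, Q w} ->
  {ae mu, forall w, P w /\ Q w}.
Proof. exact: filterS2. Qed.

Lemma intg_meas (f : T -> R) : intg f -> measurable_fun setT f.
Proof. by move=> /measurable_int/measurable_EFinP. Qed.

Lemma intgD (f g : T -> R) : intg f -> intg g -> intg (fun w => f w + g w).
Proof. by move=> /integrableD /[apply]; exact. Qed.

Lemma intgB (f g : T -> R) : intg f -> intg g -> intg (fun w => f w - g w).
Proof. by move=> /integrableB /[apply]; exact. Qed.

Lemma intgZ (c : R) (f : T -> R) : intg f -> intg (fun w => c * f w).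
Proof. by move=> fi; have := integrableZl measurableT c fi. Qed.

Lemma intg_norm (f : T -> R) : intg f -> intg (fun w => `|f w|).
Proof. exact: integrable_norm. Qed.

Lemma intg_dom (f g : T -> R) : measurable_fun setT f ->
  {ae mu, forall w, `|f w| <= g w} -> intg g -> intg f.
Proof.
move=> mf fg /integrableP[mg gfin]; apply/integrableP; split.
  exact/measurable_EFinP.
apply: le_lt_trans gfin; apply: ae_ge0_le_integral => //.
- exact/measurableT_comp/measurable_EFinP.
- exact/measurableT_comp.
- apply: filterS fg => w fgw _ /=.
  by rewrite lee_fin (le_trans fgw)// ler_norm.
Qed.

Lemma intg_bddM (h g : T -> R) (M : R) : measurable_fun setT h ->
  {ae mu, forall w, `|h w| <= M} -> intg g -> intg (fun w => h w * g w).
Proof.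
move=> mh hM gi; apply: (@intg_dom _ (fun w => M * `|g w|)).
- exact/measurable_funM/intg_meas.
- by apply: filterS hM => w hw; rewrite normrM ler_wpM2r.
- exact/intgZ/intg_norm.
Qed.

Lemma Ex_ae_eq (f g : T -> R) : measurable_fun setT f -> measurable_fun setT g ->
  {ae mu, forall w, f w = g w} -> Ex f = Ex g.
Proof.
move=> mf mg fg; congr fine; apply: ae_eq_integral => //; try exact/measurable_EFinP.
by apply: filterS fg => w /= + _ => ->.
Qed.

Lemma intg_ae_eq (f g : T -> R) : measurable_fun setT f ->
  {ae mu, forall w, f w = g w} -> intg g -> intg f.
Proof.
move=> mf fg gi; apply: (@intg_dom _ (fun w => `|g w|)) => //; last exact: intg_norm.
by apply: filterS fg => w ->.
Qed.

Lemma ExD (f g : T -> R) : intg f -> intg g -> Ex (fun w => f w + g w) = Ex f + Ex g.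
Proof. exact: RintegralD. Qed.

Lemma ExB (f g : T -> R) : intg f -> intg g -> Ex (fun w => f w - g w) = Ex f - Ex g.
Proof. exact: RintegralB. Qed.

Lemma ExZ (c : R) (f : T -> R) : intg f -> Ex (fun w => c * f w) = c * Ex f.
Proof. exact: RintegralZl. Qed.

Lemma Ex_le (f g : T -> R) : intg f -> intg g ->
  {ae mu, forall w, f w <= g w} -> Ex f <= Ex g.
Proof.
move=> fi gi fg.
have mm : measurable_fun setT (fun w => Num.max (f w) (g w)).
  by apply: measurable_maxr; exact: intg_meas.
have e : {ae mu, forall w, Num.max (f w) (g w) = g w}.
  by apply: filterS fg => w ?; rewrite max_r.
have mi := intg_ae_eq mm e gi.
rewrite -(Ex_ae_eq mm (intg_meas gi) e).
by apply: le_Rintegral => // w _; rewrite le_max lexx.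
Qed.

Lemma Ex_ge0 (f : T -> R) : measurable_fun setT f ->
  {ae mu, forall w, 0 <= f w} -> 0 <= Ex f.
Proof.
move=> mf f0.
have mm : measurable_fun setT (fun w => Num.max (f w) 0).
  by apply: measurable_maxr => //; exact: measurable_cst.
rewrite (@Ex_ae_eq f (fun w => Num.max (f w) 0))//.
  by apply: Rintegral_ge0 => w _; rewrite le_max lexx orbT.
by apply: filterS f0 => w ?; rewrite max_l.
Qed.

Lemma Ex_norm (f : T -> R) : intg f -> `|Ex f| <= Ex (fun w => `|f w|).
Proof. exact: le_normr_Rintegral. Qed.

Lemma dominated_Ex (f_ : nat -> T -> R) (f g : T -> R) :
  (forall n, measurable_fun setT (f_ n)) -> measurable_fun setT f ->
  {ae mu, forall w, f_ n w @[n --> \oo] --> f w} ->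
  intg g -> {ae mu, forall w n, `|f_ n w| <= g w} ->
  [/\ intg f, Ex (f_ n) @[n --> \oo] --> Ex f &
     Ex (fun w => `|f_ n w - f w|) @[n --> \oo] --> 0].
Proof.
move=> mf_ mf ff gi fg.
have [] := @dominated_convergence _ _ _ mu _ measurableT (fun n => EFin \o f_ n)
  (EFin \o f) (EFin \o g).
- by move=> n; exact/measurable_EFinP.
- exact/measurable_EFinP.
- by apply: filterS ff => w fw _; apply: cvg_EFin => //; exact: nearW.
- exact: gi.
- by apply: filterS fg => w fgw n _ /=; rewrite lee_fin.
move=> fi c1 c2; split => //.
- by apply: fine_cvg; rewrite fineK//; exact: integrable_fin_num.
- by apply: fine_cvg.
Qed.

Lemma Ex_eq0_ae (f : T -> R) : intg f -> {ae mu, forall w, 0 <= f w} -> Ex f = 0 ->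
  {ae mu, forall w, f w = 0}.
Proof.
move=> fi f0 Ef.
have e : (\int[mu]_w `|(f w)%:E| = 0)%E.
  transitivity (\int[mu]_w (EFin \o f) w)%E; last first.
    by rewrite -[LHS]fineK ?integrable_fin_num//; congr EFin.
  apply: ae_eq_integral => //.
  - by apply: measurableT_comp => //; exact/measurable_EFinP/intg_meas.
  - exact/measurable_EFinP/intg_meas.
  - by apply: filterS f0 => w w0 _ /=; rewrite ger0_norm.
have := (ae_eq_integral_abs mu measurableT (measurable_int _ fi)).1 e.
by apply: filterS => w /(_ I) /= [].
Qed.

End integrals.

Section real_sequences.
Context (R : realType).
Implicit Types (a b : nat -> R).

Lemma cvg0P a : (forall n, 0 <= a n) ->
  (a n @[n --> \oo] --> 0) <->
  (forall e : R, 0 < e -> exists N : nat, forall n, (N <= n)%N -> a n < e).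
Proof.
move=> a0; split=> [/cvgrPdist_lt ca e e0|h].
  have [N _ hN] := ca _ e0; exists N => n Nn.
  by have := hN n Nn; rewrite /= sub0r normrN ger0_norm.
apply/cvgrPdist_lt => e e0; have [N hN] := h e e0.
by exists N => // n Nn /=; rewrite sub0r normrN ger0_norm// hN.
Qed.

Lemma cvg_uniq a (x y : R) : a n @[n --> \oo] --> x -> a n @[n --> \oo] --> y -> x = y.
Proof. by move=> ax ay; rewrite -(cvg_lim _ ax)// (cvg_lim _ ay). Qed.

Lemma squeeze0 a b : (forall n, 0 <= a n <= b n) -> b n @[n --> \oo] --> 0 ->
  a n @[n --> \oo] --> 0.
Proof.
move=> ab cb; apply: (squeeze_cvgr _ (cvg_cst 0) cb).
exact: nearW.
Qed.

Lemma sqrB_cvg0 a (l : R) : a n @[n --> \oo] --> l ->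
  (l - a n) ^+ 2 @[n --> \oo] --> 0.
Proof.
move=> al; have hl : l - a n @[n --> \oo] --> 0.
  by rewrite -(subrr l); apply: cvgB => //; exact: cvg_cst.
by under eq_fun do rewrite expr2; rewrite -[0](mulr0 0); exact: cvgM.
Qed.

Lemma invn_ge0 (n : nat) : 0 <= n.+1%:R^-1 :> R.
Proof. by rewrite invr_ge0. Qed.

Lemma cvg_invn : (n.+1%:R^-1 : R) @[n --> \oo] --> 0.
Proof.
apply/cvg0P => [n|e e0]; first by rewrite invr_ge0.
near \oo => N; exists N => n Nn.
rewrite invf_plt ?posrE//; apply: (@lt_le_trans _ _ N.+1%:R); last by rewrite ler_nat ltnS.
by rewrite -natr1 ltr_pwDr//; near: N; exact: nbhs_infty_ger.
Unshelve. all: end_near. Qed.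

Lemma min_cvg (x : R) : Num.min x n%:R @[n --> \oo] --> x.
Proof.
apply: cvg_near_cst; near=> n; apply/eqP; rewrite min_l//.
by near: n; exact: nbhs_infty_ger.
Unshelve. all: end_near. Qed.

End real_sequences.

Section L2.
Context d (T : measurableType d) (R : realType) (nu : probability T R).
Local Notation intg f := (nu.-integrable setT (EFin \o f)).
Local Notation Ex f := (Rintegral nu setT f).
Implicit Types f g : T -> R.

Lemma intg_cst (c : R) : intg (fun=> c).
Proof. exact: finite_measure_integrable_cst. Qed.

Lemma Ex_cst (c : R) : Ex (fun=> c) = c.
Proof. rewrite Rintegral_cst// [X in fine X](_ : _ = 1%E) ?mulr1//; exact: probability_setT. Qed.

Lemma expE f : ('E_nu[f] = \int[nu]_w (f w)%:E)%E.
Proof. by rewrite unlock. Qed.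

Lemma exp_Ex f : intg f -> 'E_nu[f]%E = (Ex f)%:E.
Proof. by move=> fi; rewrite expE fineK//; exact: integrable_fin_num. Qed.

Lemma intg_prod f g : measurable_fun setT f -> measurable_fun setT g ->
  intg (fun w => f w ^+ 2) -> intg (fun w => g w ^+ 2) -> intg (fun w => f w * g w).
Proof.
move=> mf mg fi gi; apply: (@intg_dom _ _ _ _ _ (fun w => f w ^+ 2 + g w ^+ 2)).
- exact: measurable_funM.
- apply/aeW => w; rewrite ler_norml; nra.
- exact: intgD.
Qed.

Lemma intg_L1 f : measurable_fun setT f -> intg (fun w => f w ^+ 2) -> intg f.
Proof.
move=> mf fi; apply: (@intg_dom _ _ _ _ _ (fun w => 1 + f w ^+ 2)) => //.
- apply/aeW => w; rewrite ler_norml; nra.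
- exact: intgD (intg_cst 1) fi.
Qed.

Lemma intg_sqD f g : measurable_fun setT f -> measurable_fun setT g ->
  intg (fun w => f w ^+ 2) -> intg (fun w => g w ^+ 2) ->
  intg (fun w => (f w + g w) ^+ 2).
Proof.
move=> mf mg fi gi.
apply: (@intg_dom _ _ _ _ _ (fun w => 2 * f w ^+ 2 + 2 * g w ^+ 2)).
- exact/measurable_funX/measurable_funD.
- by apply/aeW => w; rewrite ger0_norm ?sqr_ge0//; have := sqr_ge0 (f w - g w); move: (f w) (g w) => x y; nra.
- by apply: intgD; exact: intgZ.
Qed.

Lemma intg_sqB f g : measurable_fun setT f -> measurable_fun setT g ->
  intg (fun w => f w ^+ 2) -> intg (fun w => g w ^+ 2) ->
  intg (fun w => (f w - g w) ^+ 2).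
Proof.
move=> mf mg fi gi.
have mNg : measurable_fun setT (fun w => - g w) by exact: measurableT_comp.
apply: (intg_sqD mf mNg fi).
rewrite (_ : (fun w => (- g w) ^+ 2) = (fun w => g w ^+ 2))//.
by apply/funext => w; rewrite sqrrN.
Qed.

Lemma L2norm_sq f : (L2norm nu f `^ 2)%E = (\int[nu]_w (f w ^+ 2)%:E)%E.
Proof.
rewrite /L2norm poweR_Lnorm//; apply: eq_integral => w _ /=.
by rewrite powR_mulrn// real_normK// num_real.
Qed.

Lemma L2normE f : intg (fun w => f w ^+ 2) ->
  L2norm nu f = (Num.sqrt (Ex (fun w => f w ^+ 2)))%:E.
Proof.
move=> fi; rewrite -powR12_sqrt; last by apply: Rintegral_ge0 => w _; exact: sqr_ge0.
rewrite -poweR_EFin fineK ?integrable_fin_num//.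
rewrite -L2norm_sq -poweRrM mulfV// poweRe1//.
exact: Lnorm_ge0.
Qed.

Lemma Lfun2P f : f \in Lfun nu 2%:E <->
  measurable_fun setT f /\ intg (fun w => f w ^+ 2).
Proof.
split=> [fL|[mf fi]].
  split; first by have := sub_Lfun_mfun fL; rewrite inE.
  exact: Lfun2_integrable_sqr.
rewrite inE/=; apply/andP; split; rewrite inE//=.
by rewrite /finite_norm -/(L2norm nu f) L2normE// ltry.
Qed.

Lemma L2norm_cvg0 (f : nat -> T -> R) : (forall n, intg (fun w => f n w ^+ 2)) ->
  (L2norm nu (f n) @[n --> \oo] --> 0%E) <->
  (Ex (fun w => f n w ^+ 2) @[n --> \oo] --> 0).
Proof.
move=> fi; have E n := L2normE (fi n).
have E0 n : 0 <= Ex (fun w => f n w ^+ 2).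
  by apply: Rintegral_ge0 => w _; exact: sqr_ge0.
rewrite (_ : (fun n => _) = EFin \o (fun n => Num.sqrt (Ex (fun w => f n w ^+ 2)))); last first.
  by apply/funext => n; rewrite E.
have s0 n : 0 <= Num.sqrt (Ex (fun w => f n w ^+ 2)) by exact: sqrtr_ge0.
split=> [h|h].
  have h' := (cvg0P s0).1 (fine_cvg h).
  apply/(cvg0P E0) => e e0.
  have /h'[N hN] : 0 < Num.sqrt e by rewrite sqrtr_gt0.
  by exists N => n /hN; rewrite ltr_sqrt.
apply: cvg_EFin; first exact: nearW.
apply/(cvg0P s0) => e e0.
have /((cvg0P E0).1 h)[N hN] : 0 < e ^+ 2 by rewrite exprn_gt0.
exists N => n /hN hn; rewrite -[X in _ < X]ger0_norm ?ltW// -sqrtr_sqr.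
by rewrite ltr_sqrt// exprn_gt0.
Qed.

End L2.

(** * The algebra and the domain of the Dirichlet form *)

Section markov.
Context d (T : measurableType d) (R : realType) (nu : probability T R)
  (A A0 : set (T -> R)) (Gam : (T -> R) -> (T -> R) -> (T -> R))
  (L : (T -> R) -> (T -> R)).
Local Notation intg f := (nu.-integrable setT (EFin \o f)).
Local Notation Ex f := (Rintegral nu setT f).
Local Notation q u := (Ex (Gam u u)).
Implicit Types u v f F G X Y : T -> R.

(** The Cauchy condition bears on the energy alone: convergence in [L^2] of the
    whole sequence already gives its [L^2] part. *)
Definition form_approx (u : nat -> T -> R) F : Prop :=
  [/\ forall n, A0 (u n),
      forall e : R, 0 < e -> exists N : nat, forall m n : nat,
        (N <= m)%N -> (N <= n)%N -> q (u m \- u n) < e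
    & Ex (fun w => (u n w - F w) ^+ 2) @[n --> \oo] --> 0].

Context (HM : full_markov_triple nu A A0 Gam L).

Lemma A0_meas u : A0 u -> measurable_fun setT u.
Proof. by move=> /(A0_sub HM)/(A_measurable HM). Qed.

Lemma A0_intg u : A0 u -> intg u.
Proof.
move=> Au; have [M hM] := A0_bounded HM Au.
by apply: (intg_dom (A0_meas Au) hM); exact: intg_cst.
Qed.

(** A constant is a smooth function of zero variables. *)
Lemma A0_cst c : A0 (fun=> c).
Proof.
have := @A0_smooth _ _ _ _ _ _ _ _ HM 0 (fun=> c) (fun=> fun=> 0).
apply; last by case.
move=> s x; case: s => [|[]//] /=; exact: differentiable_cst.
Qed.

Lemma A0_add u v : A0 u -> A0 v -> A0 (u \+ v).
Proof.
move=> Au Av; have := A0_linear HM 1 Au Av.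
by congr A0; apply/funext => w; rewrite mul1r.
Qed.

Lemma A0_opp_sub u v : (u \- v) = (fun w => -1 * v w + u w).
Proof. by apply/funext => w; rewrite mulN1r addrC. Qed.

Lemma A0_subr u v : A0 u -> A0 v -> A0 (u \- v).
Proof. by move=> Au Av; rewrite A0_opp_sub; exact: A0_linear HM (-1) _ _ Av Au. Qed.

Lemma A0_sq u : A0 u -> intg (fun w => u w ^+ 2).
Proof. by move=> Au; have := A0_intg (A0_mul HM Au Au). Qed.

Lemma Gam_intg u v : A0 u -> A0 v -> intg (Gam u v).
Proof. by move=> Au Av; exact/A0_intg/(Gam_A0 HM). Qed.

Lemma Gam_quad a u v : A0 u -> A0 v ->
  {ae nu, forall w, Gam (fun w => a * u w + v w) (fun w => a * u w + v w) w
    = a ^+ 2 * Gam u u w + 2 * a * Gam u v w + Gam v v w}.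
Proof.
move=> Au Av; have Auv := A0_linear HM a Au Av.
have h1 := Gam_linear HM a Au Av Auv.
have h2 := ae_and (Gam_sym HM Au Auv) (Gam_sym HM Av Auv).
have h3 := ae_and (Gam_linear HM a Au Av Au) (Gam_linear HM a Au Av Av).
have h4 := ae_and h1 (Gam_sym HM Av Au).
move: h4 h2 h3; apply: filterS3 => w.
move=> [/(_ I) e1 /(_ I) e2] [/(_ I) e3 /(_ I) e4] [/(_ I) e5 /(_ I) e6].
rewrite e1 e3 e4 e5 e6 e2; ring.
Qed.

Lemma Gam_D u v : A0 u -> A0 v -> {ae nu, forall w,
  Gam (u \+ v) (u \+ v) w = Gam u u w + 2 * Gam u v w + Gam v v w}.
Proof.
move=> Au Av; have := Gam_quad 1 Au Av.
rewrite (_ : (fun w => 1 * u w + v w) = u \+ v); last first.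
  by apply/funext => w; rewrite mul1r.
by apply: filterS => w ->; ring.
Qed.

Lemma Gam_B u v : A0 u -> A0 v -> {ae nu, forall w,
  Gam (u \- v) (u \- v) w = Gam u u w - 2 * Gam u v w + Gam v v w}.
Proof.
move=> Au Av; have := Gam_quad (-1) Av Au; rewrite -A0_opp_sub.
have := Gam_sym HM Av Au.
by apply: filterS2 => w /(_ I) -> ->; ring.
Qed.

Lemma Gam_nneg u : A0 u -> {ae nu, forall w, 0 <= Gam u u w}.
Proof. by move=> /(A0_sub HM)/(Gam_ge0 HM). Qed.

Lemma q_ge0 u : A0 u -> 0 <= q u.
Proof. by move=> Au; apply: Ex_ge0; [exact/A0_meas/(Gam_A0 HM)|exact: Gam_nneg]. Qed.

(** The parallelogram identity, without its nonnegative term [q (u \- v)]. *)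
Lemma q_D u v : A0 u -> A0 v -> q (u \+ v) <= 2 * q u + 2 * q v.
Proof.
move=> Au Av; have Auv := A0_add Au Av; have Buv := A0_subr Au Av.
have i1 := Gam_intg Au Au; have i2 := Gam_intg Av Av.
rewrite -!ExZ// -ExD; [|exact: intgZ|exact: intgZ].
apply: Ex_le; [exact: Gam_intg|by apply: intgD; exact: intgZ|].
have := Gam_D Au Av; have := Gam_B Au Av; have := Gam_nneg Buv.
by apply: filterS3 => w h1 h2 ->; move: h1; rewrite h2; lra.
Qed.

Lemma q_D3 u v f : A0 u -> A0 v -> A0 f ->
  q (u \+ v \+ f) <= 4 * q u + 4 * q v + 2 * q f.
Proof.
move=> Au Av Af; have := q_D (A0_add Au Av) Af.
have := q_D Au Av; lra.
Qed.

Lemma q_opp u v : A0 u -> A0 v -> q (u \- v) = q (v \- u).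
Proof.
move=> Au Av; apply: Ex_ae_eq.
- by apply: A0_meas; apply: (Gam_A0 HM); exact: A0_subr.
- by apply: A0_meas; apply: (Gam_A0 HM); exact: A0_subr.
- have := Gam_B Au Av; have := Gam_B Av Au; have := Gam_sym HM Au Av.
  by apply: filterS3 => w /(_ I) e -> ->; rewrite e; ring.
Qed.

Lemma dform_q u v : A0 u -> A0 v -> dform nu Gam u v = (Ex (Gam u v))%:E.
Proof. by move=> Au Av; rewrite /dform exp_Ex//; exact: Gam_intg. Qed.

Lemma energy_norm_A0 u : A0 u ->
  energy_norm nu Gam u = (Num.sqrt (Ex (fun w => u w ^+ 2) + q u))%:E.
Proof.
move=> Au; rewrite /energy_norm L2norm_sq dform_q//.
rewrite -[X in (X + _)%E]fineK; last first.
  by have := integrable_fin_num measurableT (A0_sq Au).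
rewrite -EFinD poweR_EFin powR12_sqrt// addr_ge0 ?q_ge0//.
by apply: fine_ge0; apply: integral_ge0 => w _; rewrite lee_fin sqr_ge0.
Qed.

Lemma energy_approxP (u : nat -> T -> R) F : F \in Lfun nu 2%:E ->
  energy_approx nu A0 Gam u F <-> form_approx u F.
Proof.
move=> /Lfun2P[mF F2].
have sqE g : 0 <= Ex (fun w => g w ^+ 2).
  by apply: Rintegral_ge0 => w _; exact: sqr_ge0.
split=> -[Au cu lu].
  have hi n : intg (fun w => (u n w - F w) ^+ 2).
    by apply: intg_sqB => //; [exact: A0_meas|exact: A0_sq].
  split => //; last by apply/(L2norm_cvg0 hi); exact: lu.
  move=> e e0; have /cu[N hN] : 0 < Num.sqrt e by rewrite sqrtr_gt0.
  exists N => m n Nm Nn; have := hN m n Nm Nn.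
  rewrite energy_norm_A0; last exact: A0_subr.
  rewrite lte_fin ltr_sqrt//; apply: le_lt_trans.
  by rewrite lerDr; exact: sqE.
have hi n : intg (fun w => (u n w - F w) ^+ 2).
  by apply: intg_sqB => //; [exact: A0_meas|exact: A0_sq].
split => //; last by apply/(L2norm_cvg0 hi).
move=> e e0.
have e1 : 0 < e ^+ 2 / 6 by rewrite divr_gt0// exprn_gt0.
have [N1 h1] := cu _ e1.
have [N2 h2] := (cvg0P (fun n => sqE _)).1 lu _ e1.
exists (maxn N1 N2) => m n; rewrite !geq_max => /andP[m1 m2] /andP[n1 n2].
rewrite energy_norm_A0; last exact: A0_subr.
rewrite lte_fin -[X in _ < X]ger0_norm ?ltW// -sqrtr_sqr ltr_sqrt ?exprn_gt0//.
have := h1 m n m1 n1; have := h2 m m2; have := h2 n n2.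
have : Ex (fun w => (u m w - u n w) ^+ 2) <=
   Ex (fun w => 2 * (u m w - F w) ^+ 2 + 2 * (u n w - F w) ^+ 2).
  apply: Ex_le.
  - exact: A0_sq (A0_subr (Au m) (Au n)).
  - by apply: intgD; exact: intgZ.
  - apply/aeW => w; have := sqr_ge0 ((u m w - F w) + (u n w - F w)).
    move: (u m w) (u n w) (F w) => x y z; nra.
rewrite ExD; [|exact: intgZ|exact: intgZ]; rewrite !ExZ//.
rewrite /GRing.sub_fun /=; lra.
Qed.

End markov.

Section domE.
Context d (T : measurableType d) (R : realType) (nu : probability T R)
  (A A0 : set (T -> R)) (Gam : (T -> R) -> (T -> R) -> (T -> R))
  (L : (T -> R) -> (T -> R)) (HM : full_markov_triple nu A A0 Gam L).
Local Notation intg f := (nu.-integrable setT (EFin \o f)).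
Local Notation Ex f := (Rintegral nu setT f).
Local Notation q u := (Ex (Gam u u)).
Local Notation DomE := (DomE nu A0 Gam).
Local Notation form_approx := (form_approx nu A0 Gam).
Implicit Types F G X Y : T -> R.
Implicit Types u v : nat -> T -> R.

Lemma DomEP F : DomE F <->
  [/\ measurable_fun setT F, intg (fun w => F w ^+ 2) & exists u, form_approx u F].
Proof.
split=> [[FL [u uF]]|[mF F2 [u uF]]].
  by have [? ?] := (Lfun2P _ _).1 FL; split => //; exists u; exact: (energy_approxP HM u FL).1.
have FL : F \in Lfun nu 2%:E by exact/Lfun2P.
by split => //; exists u; exact: (energy_approxP HM u FL).2.
Qed.

Lemma DomE_meas F : DomE F -> measurable_fun setT F.
Proof. by case/DomEP. Qed.

Lemma DomE_sq F : DomE F -> intg (fun w => F w ^+ 2).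
Proof. by case/DomEP. Qed.

Lemma DomE_Gam_intg F G : DomE F -> DomE G -> intg (Gam F G).
Proof. by move=> HF HG; apply/Lfun1_integrable; exact: (Gam_L1 HM). Qed.

Lemma dformE F G : DomE F -> DomE G -> dform nu Gam F G = (Ex (Gam F G))%:E.
Proof. by move=> HF HG; rewrite /dform exp_Ex//; exact: DomE_Gam_intg. Qed.

Lemma Gam_cvg F G u v : DomE F -> DomE G -> form_approx u F -> form_approx v G ->
  Ex (fun w => `|Gam (u n) (v n) w - Gam F G w|) @[n --> \oo] --> 0.
Proof.
move=> HF HG uF vG.
have h := Gam_ext HM HF HG ((energy_approxP HM u HF.1).2 uF)
  ((energy_approxP HM v HG.1).2 vG).
rewrite (_ : (fun n => _) =
  fine \o (fun n => 'N[nu]_1[EFin \o (Gam (u n) (v n) \- Gam F G)%R]%E)).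
  exact: (fine_cvg h).
by apply/funext => n /=; rewrite Lnorm1.
Qed.

Lemma intg_Gam_diff F G f g : DomE F -> DomE G -> A0 f -> A0 g ->
  intg (fun w => Gam f g w - Gam F G w).
Proof.
by move=> HF HG Af Ag; apply: intgB; [exact: (Gam_intg HM)|exact: DomE_Gam_intg].
Qed.

Lemma cvg_Ex (f : nat -> T -> R) g : (forall n, intg (f n)) -> intg g ->
  Ex (fun w => `|f n w - g w|) @[n --> \oo] --> 0 ->
  Ex (f n) @[n --> \oo] --> Ex g.
Proof.
move=> fi gi h; apply: (subr_cvg0 (fun n => Ex (f n)) (Ex g)).1; apply: norm_cvg0; apply: squeeze0 h => n.
rewrite normr_ge0/= -ExB//; exact/Ex_norm/intgB.
Qed.

Lemma Ex_Gam_cvg F G u v : DomE F -> DomE G -> form_approx u F -> form_approx v G ->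
  Ex (Gam (u n) (v n)) @[n --> \oo] --> Ex (Gam F G).
Proof.
move=> HF HG uF vG; apply: cvg_Ex.
- by move=> n; apply: (Gam_intg HM); [case: uF|case: vG].
- exact: DomE_Gam_intg.
- exact: Gam_cvg.
Qed.

(** The negative part of [Gam F F] is at most its distance to the nonnegative
    [Gam (u n) (u n)], which tends to 0 in [L^1]. *)
Lemma DomE_Gam_ge0 F : DomE F -> {ae nu, forall w, 0 <= Gam F F w}.
Proof.
move=> HF; have [mF F2 [u uF]] := (DomEP F).1 HF.
have Gi := DomE_Gam_intg HF HF; have Au := let: And3 h _ _ := uF in h.
have mN : measurable_fun setT (fun w => Num.max (- Gam F F w) 0).
  apply: measurable_maxr; last exact: measurable_cst.
  by apply: measurableT_comp => //; exact: intg_meas Gi.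
have iN : intg (fun w => Num.max (- Gam F F w) 0).
  apply: intg_dom mN _ (intg_norm Gi); apply/aeW => w.
  rewrite ger0_norm ?le_max ?lexx ?orbT// ge_max normr_ge0 andbT.
  by rewrite -normrN ler_norm.
have N0 w : 0 <= Num.max (- Gam F F w) 0 by rewrite le_max lexx orbT.
suff : Ex (fun w => Num.max (- Gam F F w) 0) = 0.
  move/(Ex_eq0_ae iN (aeW _ N0)); apply: filterS => w e.
  have : - Gam F F w <= 0 by rewrite -e le_max lexx.
  by rewrite oppr_le0.
have := Gam_cvg HF HF uF uF => h.
have c : (Ex (fun w => Num.max (- Gam F F w) 0)) @[n --> \oo] --> 0.
  apply: squeeze0 h => n; apply/andP; split; first exact: Rintegral_ge0.
  apply: Ex_le => //; first by apply: intg_norm; exact: intg_Gam_diff.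
  have := Gam_nneg HM (Au n); apply: filterS => w g0.
  rewrite ge_max normr_ge0 andbT; apply: le_trans (ler_norm _).
  by rewrite lerBrDr addNr.
exact: cvg_uniq (cvg_cst _) c.
Qed.

Lemma sq_add_le (a x y : R) : (a * x + y) ^+ 2 <= 2 * a ^+ 2 * x ^+ 2 + 2 * y ^+ 2.
Proof. by have := sqr_ge0 (a * x - y); nra. Qed.

Lemma q_lin a f g : A0 f -> A0 g ->
  q (fun w => a * f w + g w) <= 2 * a ^+ 2 * q f + 2 * q g.
Proof.
move=> Af Ag; have i1 := Gam_intg HM Af Af; have i2 := Gam_intg HM Ag Ag.
rewrite -!ExZ// -ExD; [|exact: intgZ|exact: intgZ].
apply: Ex_le.
- by apply: (Gam_intg HM); exact: (A0_linear HM).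
- by apply: intgD; exact: intgZ.
- have := Gam_quad HM a Af Ag; have := Gam_quad HM (- a) Af Ag.
  have := Gam_nneg HM (A0_linear HM (- a) Af Ag).
  by apply: filterS3 => w h1 h2 ->; move: h1; rewrite h2; nra.
Qed.

Lemma approx_lin a F G u v : measurable_fun setT F -> intg (fun w => F w ^+ 2) ->
  measurable_fun setT G -> intg (fun w => G w ^+ 2) ->
  form_approx u F -> form_approx v G ->
  form_approx (fun n w => a * u n w + v n w) (fun w => a * F w + G w).
Proof.
move=> mF F2 mG G2 [Au cu lu] [Av cv lv].
split.
- by move=> n; exact: (A0_linear HM).
- move=> e e0.
  have e1 : 0 < e / (2 * (2 * a ^+ 2 + 2)).
    by rewrite divr_gt0//; have := sqr_ge0 a; lra.
  have [N1 h1] := cu _ e1; have [N2 h2] := cv _ e1.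
  exists (maxn N1 N2) => m n; rewrite !geq_max => /andP[m1 m2] /andP[n1 n2].
  rewrite (_ : (_ \- _) = (fun w => a * (u m \- u n) w + (v m \- v n) w)); last first.
    by apply/funext => w /=; ring.
  apply: (le_lt_trans (q_lin a (A0_subr HM (Au m) (Au n)) (A0_subr HM (Av m) (Av n)))).
  have := h1 m n m1 n1; have := h2 m n m2 n2.
  have a0 := sqr_ge0 a; set k := e / _ in e1 *.
  have <- : k * (2 * (2 * a ^+ 2 + 2)) = e by rewrite /k divfK// gt_eqF//; lra.
  set x := q _; set y := q _; nra.
- have hs (H : T -> R) (h : nat -> T -> R) n : (forall n, A0 (h n)) -> measurable_fun setT H ->
      intg (fun w => H w ^+ 2) -> intg (fun w => (h n w - H w) ^+ 2).
    move=> Ah mH H2.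
    by apply: intg_sqB => //; [exact: (A0_meas HM)|exact: (A0_sq HM)].
  pose b n := 2 * a ^+ 2 * Ex (fun w => (u n w - F w) ^+ 2)
     + 2 * Ex (fun w => (v n w - G w) ^+ 2).
  apply: (@squeeze0 _ _ b) => [n|]; last first.
    rewrite -[0](_ : 2 * a ^+ 2 * 0 + 2 * 0 = 0); last by rewrite !mulr0 addr0.
    by apply: cvgD; apply: cvgMr.
  apply/andP; split; first by apply: Rintegral_ge0 => w _; exact: sqr_ge0.
  have iu := hs _ u n Au mF F2; have iv := hs _ v n Av mG G2.
  rewrite /b -!ExZ// -ExD; [|exact: intgZ|exact: intgZ].
  apply: Ex_le.
  + apply: (hs _ (fun n w => a * u n w + v n w)).
    * by move=> k; exact: (A0_linear HM).
    * by apply: measurable_funD => //; exact: measurable_funM.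
    * apply: intg_sqD => //; first exact: measurable_funM.
      rewrite (_ : (fun w => (a * F w) ^+ 2) = (fun w => a ^+ 2 * F w ^+ 2)).
        exact: intgZ.
      by apply/funext => w; rewrite exprMn.
  + by apply: intgD; exact: intgZ.
  + apply/aeW => w; apply: le_trans (sq_add_le _ _ _).
    by rewrite le_eqVlt; apply/orP; left; apply/eqP; ring.
Qed.

Lemma DomE_lin a F G : DomE F -> DomE G -> DomE (fun w => a * F w + G w).
Proof.
move=> /DomEP[mF F2 [u uF]] /DomEP[mG G2 [v vG]]; apply/DomEP; split.
- by apply: measurable_funD => //; exact: measurable_funM.
- apply: intg_sqD => //; first exact: measurable_funM.
  rewrite (_ : (fun w => (a * F w) ^+ 2) = (fun w => a ^+ 2 * F w ^+ 2)).
    exact: intgZ.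
  by apply/funext => w; rewrite exprMn.
- by exists (fun n w => a * u n w + v n w); exact: approx_lin.
Qed.

(** [Gam] is bilinear on the algebra, almost surely; on the domain the same
    expansion is obtained for energies, by a passage to the limit. *)
Lemma q_DomE_quad a F G : DomE F -> DomE G ->
  q (fun w => a * F w + G w) = a ^+ 2 * q F + 2 * a * Ex (Gam F G) + q G.
Proof.
move=> HF HG; have [mF F2 [u uF]] := (DomEP F).1 HF.
have [mG G2 [v vG]] := (DomEP G).1 HG.
have Au := let: And3 h _ _ := uF in h; have Av := let: And3 h _ _ := vG in h.
have HFG := DomE_lin a HF HG.
have uvFG := approx_lin a mF F2 mG G2 uF vG.
apply: cvg_uniq (Ex_Gam_cvg HFG HFG uvFG uvFG) _.
rewrite (_ : (fun n => _) = (fun n => a ^+ 2 * q (u n)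
  + 2 * a * Ex (Gam (u n) (v n)) + q (v n))); last first.
  apply/funext => n; have i1 := Gam_intg HM (Au n) (Au n).
  have i2 := Gam_intg HM (Au n) (Av n); have i3 := Gam_intg HM (Av n) (Av n).
  rewrite (@Ex_ae_eq _ _ _ nu _ (fun w => a ^+ 2 * Gam (u n) (u n) w
    + 2 * a * Gam (u n) (v n) w + Gam (v n) (v n) w)).
  - rewrite ExD//; last by apply: intgD; exact: intgZ.
    by rewrite ExD; [rewrite !ExZ|exact: intgZ|exact: intgZ].
  - by apply/intg_meas/(Gam_intg HM); exact: (A0_linear HM).
  - by apply: (@intg_meas _ _ _ nu); apply: intgD => //; apply: intgD; exact: intgZ.
  - exact: (Gam_quad HM).
apply: cvgD; last exact: Ex_Gam_cvg.
by apply: cvgD; apply: cvgMr; exact: Ex_Gam_cvg.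
Qed.

Lemma approx_A0 f : A0 f -> form_approx (fun=> f) f.
Proof.
move=> Af; split => //.
- move=> e e0; exists 0%N => m n _ _; rewrite (_ : q _ = 0)//.
  rewrite -[RHS](Ex_cst nu); apply: Ex_ae_eq => //.
    by apply/intg_meas/(Gam_intg HM); exact: (A0_subr HM).
  by have := Gam_B HM Af Af; apply: filterS => w ->; ring.
- rewrite (_ : (fun n => _) = (fun=> 0)); first exact: cvg_cst.
  apply/funext => n; rewrite -[RHS](Ex_cst nu); congr (Rintegral nu setT).
  by apply/funext => w; rewrite subrr expr0n.
Qed.

Lemma DomE_A0 f : A0 f -> DomE f.
Proof.
move=> Af; apply/DomEP; split; [exact: (A0_meas HM)|exact: (A0_sq HM)|].
by exists (fun=> f); exact: approx_A0.
Qed.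

(** The degenerate case of Cauchy--Schwarz: the energy of [t F + G] is an affine
    function of [t], bounded below by 0, so its slope vanishes. *)
Lemma Ex_Gam_null F G : DomE F -> DomE G -> q F = 0 -> Ex (Gam F G) = 0.
Proof.
move=> HF HG qF; set b := Ex (Gam F G).
have H t : 0 <= 2 * t * b + q G.
  have HFG := DomE_lin t HF HG.
  have := q_DomE_quad t HF HG; rewrite qF mulr0 add0r => <-.
  by apply: Ex_ge0; [exact/intg_meas/DomE_Gam_intg|exact: DomE_Gam_ge0].
(* at this [t] the energy of [t F + G] would be -1 *)
have := H (- (q G + 1) / (2 * b)).
have [//|b0] := eqVneq b 0.
rewrite (_ : 2 * _ * b = - (q G + 1)); first lra.
by field.
Qed.

End domE.

(** * Energies of smooth functions along an approximating sequence *)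

Section lipschitz.
Context (R : realType).

Lemma lipschitz_measurable (f : R -> R) (K : R) :
  (forall x y, `|f x - f y| <= K * `|x - y|) -> measurable_fun setT f.
Proof.
move=> fK; apply: continuous_measurable_fun => x.
have K0 : 0 <= K.
  by have := fK 1 0; rewrite subr0 normr1 mulr1; apply: le_trans.
apply/cvgrPdist_lt => e e0; apply/nbhs_ballP.
exists (e / (K + 1)) => /= [|y]; first by rewrite divr_gt0//; lra.
rewrite /ball /= ltr_pdivlMr; last lra.
move=> h; apply: (le_lt_trans (fK _ _)).
have := normr_ge0 (x - y); nra.
Qed.

End lipschitz.

Section chain_pair.
Context d (T : measurableType d) (R : realType) (nu : probability T R)
  (A A0 : set (T -> R)) (Gam : (T -> R) -> (T -> R) -> (T -> R))
  (L : (T -> R) -> (T -> R)) (HM : full_markov_triple nu A A0 Gam L).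
Local Notation intg f := (nu.-integrable setT (EFin \o f)).
Local Notation Ex f := (Rintegral nu setT f).
Local Notation q u := (Ex (Gam u u)).
Local Notation DomE := (DomE nu A0 Gam).
Local Notation form_approx := (form_approx nu A0 Gam).

(** [psi] stands for the derivative of [phi].  Its boundedness and Lipschitz
    continuity are what makes energies converge along sequences that converge
    in [L^2] only. *)
Definition chain_pair (phi psi : R -> R) : Prop :=
  [/\ exists K : R, [/\ forall x y, `|phi x - phi y| <= K * `|x - y|,
        forall x y, `|psi x - psi y| <= K * `|x - y| & forall x, `|psi x| <= K],
      forall f, A0 f -> A0 (phi \o f)
    & forall f g, A0 f -> A0 g ->
        {ae nu, forall w, Gam (phi \o f) g w = psi (f w) * Gam f g w}].

Lemma chain_meas phi psi : chain_pair phi psi ->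
  measurable_fun setT phi /\ measurable_fun setT psi.
Proof.
by case=> -[K [h1 h2 _]] _ _; split; [exact: lipschitz_measurable h1|exact: lipschitz_measurable h2].
Qed.

(** With zero variables the sum in the diffusion property is empty. *)
Lemma chain_cst c : chain_pair (fun=> c) (fun=> 0).
Proof.
split.
- by exists 0; split=> [x y|x y|x]; rewrite ?subrr ?normr0 ?mul0r.
- by move=> f _; exact: A0_cst HM c.
- move=> f g Af Ag.
  have h := @Gam_diffusion _ _ _ _ _ _ _ _ HM 0 (fun=> c) (fun=> fun=> 0) g.
  have /h : smooth (fun _ : 'rV[R]_0 => c).
    by move=> s x; case: s => [|[]//] /=; exact: differentiable_cst.
  move=> /(_ _ (A0_sub HM Ag)) h2.
  have /h2 : forall i : 'I_0, A (fun=> 0) by case.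
  by apply: filterS => w /(_ I); rewrite big_ord0 mul0r.
Qed.

Lemma chain_lin a phi1 psi1 phi2 psi2 : chain_pair phi1 psi1 -> chain_pair phi2 psi2 ->
  chain_pair (fun x => a * phi1 x + phi2 x) (fun x => a * psi1 x + psi2 x).
Proof.
move=> [[K1 [l1 m1 b1]] p1 c1] [[K2 [l2 m2 b2]] p2 c2]; split.
- exists (`|a| * K1 + K2); split => [x y|x y|x].
  + rewrite (_ : _ - _ = a * (phi1 x - phi1 y) + (phi2 x - phi2 y)); last by ring.
    apply: (le_trans (ler_normD _ _)); rewrite mulrDl lerD// normrM -mulrA.
    by rewrite ler_wpM2l.
  + rewrite (_ : _ - _ = a * (psi1 x - psi1 y) + (psi2 x - psi2 y)); last by ring.
    apply: (le_trans (ler_normD _ _)); rewrite mulrDl lerD// normrM -mulrA.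
    by rewrite ler_wpM2l.
  + apply: (le_trans (ler_normD _ _)); rewrite lerD// normrM.
    by rewrite ler_wpM2l.
- by move=> f Af; apply: (A0_linear HM); [exact: p1|exact: p2].
- move=> f g Af Ag; have := Gam_linear HM a (p1 _ Af) (p2 _ Af) Ag.
  have := c1 _ _ Af Ag; have := c2 _ _ Af Ag.
  by apply: filterS3 => w e2 e1 /(_ I) ->; rewrite e1 e2; ring.
Qed.

Lemma chain_B phi1 psi1 phi2 psi2 : chain_pair phi1 psi1 -> chain_pair phi2 psi2 ->
  chain_pair (fun x => phi1 x - phi2 x) (fun x => psi1 x - psi2 x).
Proof.
move=> h1 h2; have := chain_lin (-1) h2 h1.
congr (chain_pair _ _); apply/funext => x; ring.
Qed.

Lemma chain_Gam phi psi f g : chain_pair phi psi -> A0 f -> A0 g ->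
  {ae nu, forall w, Gam (phi \o f) (phi \o g) w = psi (f w) * psi (g w) * Gam f g w}.
Proof.
move=> [_ p c] Af Ag; have := c _ _ Af (p _ Ag).
have := ae_and (c _ _ Ag Af) (Gam_sym HM Af Ag).
have := Gam_sym HM Af (p _ Ag).
by apply: filterS3 => w /(_ I) e1 [e2 /(_ I) e3] ->; rewrite e1 e2 e3; ring.
Qed.

Section along.
Context (F : T -> R) (u : nat -> T -> R) (HF : DomE F) (uF : form_approx u F).
Local Notation GF := (Gam F F).

Let Au n : A0 (u n). Proof. by case: uF. Qed.
Let mF : measurable_fun setT F. Proof. exact: (DomE_meas HM HF). Qed.
Let F2 : intg (fun w => F w ^+ 2). Proof. exact: (DomE_sq HM HF). Qed.
Let Gi : intg GF. Proof. exact: (DomE_Gam_intg HM). Qed.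
Let G0 : {ae nu, forall w, 0 <= GF w}. Proof. exact: (DomE_Gam_ge0 HM HF). Qed.
Let mu_ n : measurable_fun setT (u n). Proof. exact: (A0_meas HM (Au n)). Qed.
Let mG : measurable_fun setT GF. Proof. exact: intg_meas Gi. Qed.

Let tail : Ex (fun w => `|Num.min (GF w) n%:R - GF w|) @[n --> \oo] --> 0.
Proof.
have [] // := @dominated_Ex _ _ _ nu (fun n w => Num.min (GF w) n%:R) GF (fun w => `|GF w|).
- by move=> n; apply: measurable_minr => //; exact: measurable_cst.
- by apply/aeW => w; exact: min_cvg.
- exact: intg_norm.
- apply: filterS G0 => w g0 n; rewrite !ger0_norm//; last by rewrite le_min g0 ler0n.
  by rewrite ge_min lexx.
Qed.

(** The weight [G] is cut at [m], its minimum with [N]: on [m] the Lipschitz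
    bound on [h] is used, through [`|x| <= e + x^2 / e], and on [G - m] the
    uniform bound [2 K]. *)
Let mul_bdd_le (K N e h G m x : R) : 0 <= K -> 0 < e -> 0 <= h -> h <= K * `|x| ->
  h <= 2 * K -> 0 <= m -> m <= N -> m <= G ->
  h * G <= N * K * e + N * K / e * x ^+ 2 + 2 * K * (G - m).
Proof.
move=> K0 e0 h0 hx hK m0 mN mG'.
have hm : h * (G - m) <= 2 * K * (G - m) by rewrite ler_wpM2r// subr_ge0.
have hx2 : `|x| <= e + x ^+ 2 / e.
  rewrite -(@ler_pM2r _ e)// mulrDl divfK ?gt_eqF// -real_normK ?num_real//.
  have := normr_ge0 x; nra.
have hm2 : h * m <= N * K * (e + x ^+ 2 / e).
  apply: (@le_trans _ _ (N * (K * `|x|))).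
    by rewrite mulrC ler_pM.
  by rewrite -mulrA ler_wpM2l// ?ler_wpM2l// (le_trans m0).
have -> : h * G = h * m + h * (G - m) by ring.
apply: le_trans (lerD hm2 hm) _.
by rewrite le_eqVlt; apply/orP; left; apply/eqP; field; rewrite gt_eqF.
Qed.

(** [psi (u n)] tends to [psi (F)] in [L^2], but the weight [Gam F F] is merely
    integrable.  It is cut at a level [N]: above [N] its mass is small and [psi]
    is bounded; below [N] the Lipschitz continuity of [psi] and the [L^2]
    convergence of [u] suffice. *)
Lemma psi_cvg phi psi : chain_pair phi psi ->
  Ex (fun w => `|psi (u n w) - psi (F w)| * GF w) @[n --> \oo] --> 0.
Proof.
move=> ht; have [mphi mpsi] := chain_meas ht.
have [[K [_ lip bd]] _ _] := ht.
have K0 : 0 <= K by exact: le_trans (bd 0).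
have mdiff n : measurable_fun setT (fun w => `|psi (u n w) - psi (F w)|).
  apply: measurableT_comp => //; apply: measurable_funB.
  - exact: measurableT_comp mpsi (mu_ n).
  - exact: measurableT_comp mpsi mF.
have i0 n : intg (fun w => `|psi (u n w) - psi (F w)| * GF w).
  apply: (@intg_bddM _ _ _ _ _ _ (K + K)) => //.
  by apply/aeW => w; rewrite normr_id (le_trans (ler_normB _ _))// lerD.
have E0 n : 0 <= Ex (fun w => `|psi (u n w) - psi (F w)| * GF w).
  by apply: Ex_ge0; [exact: intg_meas (i0 n)|apply: filterS G0 => w g; exact: mulr_ge0].
have i2 n : intg (fun w => (u n w - F w) ^+ 2).
  by apply: intg_sqB => //; exact: (A0_sq HM).
have imin N : intg (fun w => `|Num.min (GF w) N%:R - GF w|).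
  apply/intg_norm/intgB => //; apply: intg_dom (intg_norm Gi).
    by apply: measurable_minr => //; exact: measurable_cst.
  apply: filterS G0 => w g0; rewrite !ger0_norm//; last by rewrite le_min g0 ler0n.
  by rewrite ge_min lexx.
have [_ _ /cvg0P lu] := uF.
have {}lu := lu (fun n => Rintegral_ge0 _ (fun w _ => sqr_ge0 _)).
have tl := (cvg0P (fun n => Rintegral_ge0 _ (fun w _ => normr_ge0 _))).1 tail.
apply/(cvg0P E0) => e e0.
(* three errors of size [e / 3], fixed in this order: the level [N] of the cut,
   the parameter [del] of [mul_bdd_le], the index [n] *)
have e1 : 0 < e / (3 * (2 * K + 1)) by rewrite divr_gt0//; lra.
have [N /(_ _ (leqnn N)) hN] := tl _ e1.
pose c := N%:R * K; have c0 : 0 <= c by rewrite mulr_ge0.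
pose del := e / (3 * (c + 1)).
have del0 : 0 < del by rewrite divr_gt0//; lra.
have e2 : 0 < e / (3 * (c / del + 1)).
  by rewrite divr_gt0// mulr_gt0// ltr_wpDl// divr_ge0// ltW.
have [n0 hn] := lu _ e2; exists n0 => n /hn {hn} hn.
have : Ex (fun w => `|psi (u n w) - psi (F w)| * GF w) <=
    Ex (fun w => (c * del + c / del * (u n w - F w) ^+ 2)
       + 2 * K * `|Num.min (GF w) N%:R - GF w|).
  apply: Ex_le => //.
    by apply: intgD; [apply: intgD; [exact: intg_cst|exact: intgZ]|exact: intgZ].
  apply: filterS G0 => w g0.
  rewrite [X in _ + 2 * K * X]ler0_norm; last by rewrite subr_le0 ge_min lexx.
  rewrite opprB; apply: mul_bdd_le => //.
  - by rewrite (le_trans (ler_normB _ _))// mulr_natl mulr2n lerD.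
  - by rewrite le_min g0 ler0n.
  - by rewrite ge_min lexx orbT.
  - by rewrite ge_min lexx.
rewrite ExD; [|apply: intgD; [exact: intg_cst|exact: intgZ]|exact: intgZ].
rewrite ExD; [|exact: intg_cst|exact: intgZ].
rewrite Ex_cst !ExZ// => /le_lt_trans; apply.
have h1 : c * del <= e / 3.
  rewrite /del mulrA ler_pdivrMr; last lra.
  rewrite (_ : e / 3 * _ = e * (c + 1)); last by field.
  nra.
have cd : 0 <= c / del by rewrite divr_ge0// ltW.
have h2 : c / del * Ex (fun w => (u n w - F w) ^+ 2) <= e / 3.
  move: hn cd; set a := Rintegral _ _ _; set b := c / del => hn cd.
  move: hn; rewrite ltr_pdivlMr; last lra.
  have : 0 <= a by apply: Rintegral_ge0 => w _; exact: sqr_ge0.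
  nra.
have h3 : 2 * K * Ex (fun w => `|Num.min (GF w) N%:R - GF w|) < e / 3.
  move: hN; set a := Rintegral _ _ _; rewrite ltr_pdivlMr; last lra.
  have : 0 <= a by apply: Rintegral_ge0.
  nra.
lra.
Qed.

End along.
End chain_pair.

Section chain_limits.
Context d (T : measurableType d) (R : realType) (nu : probability T R)
  (A A0 : set (T -> R)) (Gam : (T -> R) -> (T -> R) -> (T -> R))
  (L : (T -> R) -> (T -> R)) (HM : full_markov_triple nu A A0 Gam L).
Local Notation intg f := (nu.-integrable setT (EFin \o f)).
Local Notation Ex f := (Rintegral nu setT f).
Local Notation q u := (Ex (Gam u u)).
Local Notation DomE := (DomE nu A0 Gam).
Local Notation form_approx := (form_approx nu A0 Gam).
Local Notation chain_pair := (chain_pair nu A0 Gam).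
Context (F : T -> R) (u : nat -> T -> R) (HF : DomE F) (uF : form_approx u F).
Local Notation GF := (Gam F F).

Let Au n : A0 (u n). Proof. by case: uF. Qed.
Let mF : measurable_fun setT F. Proof. exact: (DomE_meas HM HF). Qed.
Let F2 : intg (fun w => F w ^+ 2). Proof. exact: (DomE_sq HM HF). Qed.
Let Gi : intg GF. Proof. exact: (DomE_Gam_intg HM). Qed.
Let G0 : {ae nu, forall w, 0 <= GF w}. Proof. exact: (DomE_Gam_ge0 HM HF). Qed.
Let mu_ n : measurable_fun setT (u n). Proof. exact: (A0_meas HM (Au n)). Qed.
Let i2 n : intg (fun w => (u n w - F w) ^+ 2).
Proof. by apply: intg_sqB => //; exact: (A0_sq HM). Qed.

Lemma chain_measF phi psi : chain_pair phi psi ->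
  measurable_fun setT (phi \o F) /\ measurable_fun setT (psi \o F).
Proof. by case/chain_meas => m1 m2; split; apply: measurableT_comp. Qed.

Lemma chain_sq phi psi : chain_pair phi psi -> intg (fun w => phi (F w) ^+ 2).
Proof.
move=> ht; have [m1 _] := chain_measF ht.
have [[K [lip _ _]] _ _] := ht.
apply: (@intg_dom _ _ _ _ _ (fun w => 2 * phi 0 ^+ 2 + 2 * K ^+ 2 * F w ^+ 2)).
- exact: measurable_funX.
- apply/aeW => w; rewrite ger0_norm ?sqr_ge0//.
  have h : (phi (F w) - phi 0) ^+ 2 <= K ^+ 2 * F w ^+ 2.
    rewrite -exprMn -real_normK ?num_real// -[leRHS]real_normK ?num_real//.
    have := lip (F w) 0; rewrite subr0 => h.
    by rewrite lerXn2r ?nnegrE// normrM (le_trans h)// ler_wpM2r// ler_norm.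
  have := sqr_ge0 (phi (F w) - 2 * phi 0); nra.
- by apply: intgD; [exact: intg_cst|exact: intgZ].
Qed.

Lemma chain_GF phi psi : chain_pair phi psi -> intg (fun w => psi (F w) ^+ 2 * GF w).
Proof.
move=> ht; have [_ m2] := chain_measF ht; have [[K [_ _ bd]] _ _] := ht.
apply: (@intg_bddM _ _ _ _ _ _ (K ^+ 2)) => //; first exact: measurable_funX.
by apply/aeW => w; rewrite normrX lerXn2r ?nnegrE// (le_trans _ (bd 0)).
Qed.

Lemma chain_l2 phi psi : chain_pair phi psi ->
  Ex (fun w => (phi (u n w) - phi (F w)) ^+ 2) @[n --> \oo] --> 0.
Proof.
move=> ht; have [[K [lip _ _]] pA _] := ht.
have [_ _ lu] := uF.
apply: (@squeeze0 _ _ (fun n => K ^+ 2 * Ex (fun w => (u n w - F w) ^+ 2))).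
  move=> n; apply/andP; split; first by apply: Rintegral_ge0 => w _; exact: sqr_ge0.
  rewrite -ExZ//; apply: Ex_le.
  - apply: intg_sqB.
    + exact: (A0_meas HM (pA _ (Au n))).
    + by have [] := chain_measF ht.
    + exact: (A0_sq HM (pA _ (Au n))).
    + exact: chain_sq ht.
  - exact: intgZ.
  - apply/aeW => w; rewrite -exprMn -real_normK ?num_real// -[leRHS]real_normK ?num_real//.
    rewrite lerXn2r ?nnegrE// normrM (le_trans (lip _ _))// ler_wpM2r//.
    exact: ler_norm.
by rewrite -[0](mulr0 (K ^+ 2)); exact: cvgMr.
Qed.

Let q_le (K a f x y : R) : `|a| <= K -> `|f| <= K -> 0 <= y ->
  `|a ^+ 2 * x - f ^+ 2 * y| <= K ^+ 2 * `|x - y| + 2 * K * (`|a - f| * y).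
Proof.
move=> aK fK y0.
have -> : a ^+ 2 * x - f ^+ 2 * y = a ^+ 2 * (x - y) + (a + f) * ((a - f) * y) by ring.
apply: (le_trans (ler_normD _ _)); apply: lerD.
  rewrite normrM ler_wpM2r// normrX lerXn2r ?nnegrE// (le_trans _ aK)//.
rewrite !normrM (ger0_norm y0) ler_wpM2r ?mulr_ge0//.
by rewrite (le_trans (ler_normD _ _))// mulr_natl mulr2n lerD.
Qed.

(** The energy of [phi (u n)] is [E[psi (u n)^2 * Gam (u n) (u n)]]; the factor
    [Gam] converges in [L^1] and [psi] is handled by [psi_cvg]. *)
Lemma chain_q_cvg phi psi : chain_pair phi psi ->
  q (phi \o u n) @[n --> \oo] --> Ex (fun w => psi (F w) ^+ 2 * GF w).
Proof.
move=> ht; have [[K [_ _ bd]] pA _] := ht; have [mphi mpsi] := chain_meas ht.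
have K0 : 0 <= K by exact: le_trans (bd 0).
apply: cvg_Ex => [n||]; first by apply: (Gam_intg HM); exact: pA.
  exact: chain_GF ht.
have igd n := intg_Gam_diff HM HF HF (Au n) (Au n).
have ip n : intg (fun w => `|psi (u n w) - psi (F w)| * GF w).
  apply: (@intg_bddM _ _ _ _ _ _ (K + K)) => //.
    apply: measurableT_comp => //; apply: measurable_funB.
    - exact: measurableT_comp mpsi (mu_ n).
    - exact: measurableT_comp mpsi mF.
  by apply/aeW => w; rewrite normr_id (le_trans (ler_normB _ _))// lerD.
apply: (@squeeze0 _ _ (fun n => K ^+ 2 * Ex (fun w => `|Gam (u n) (u n) w - GF w|)
   + 2 * K * Ex (fun w => `|psi (u n w) - psi (F w)| * GF w))); last first.
  rewrite -[0](_ : K ^+ 2 * 0 + 2 * K * 0 = 0); last by rewrite !mulr0 addr0.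
  apply: cvgD; apply: cvgMr; first exact: (Gam_cvg HM).
  exact: (psi_cvg HM HF uF ht).
move=> n; apply/andP; split; first exact: Rintegral_ge0.
rewrite -!ExZ//; [|exact: intg_norm]; rewrite -ExD; [|exact/intgZ/intg_norm|exact: intgZ].
apply: Ex_le.
- apply/intg_norm/intgB; last exact: chain_GF ht.
  by apply: (Gam_intg HM); exact: pA.
- by apply: intgD; [exact/intgZ/intg_norm|exact: intgZ].
- have := chain_Gam HM ht (Au n) (Au n); move: G0.
  apply: filterS2 => w g0 ->; rewrite -expr2; exact: q_le.
Qed.

(** Here [a], [b] and [f] are the values of [psi] at [u m], [u n] and [F], the
    left-hand side is [Gam] of [phi (u m) - phi (u n)] and [x - 2 z + y] is [Gam]
    of [u m - u n].  The first identity of the proof isolates the latter; what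
    remains carries the factor [a - b], bounded through [`|a - f|] and
    [`|b - f|]. *)
Let cauchy_le (K a b f x y z g : R) : `|a| <= K -> `|b| <= K ->
  0 <= x -> 0 <= y -> 0 <= g -> 0 <= x - 2 * z + y ->
  a * a * x - 2 * (a * b * z) + b * b * y <=
  2 * K ^+ 2 * `|x - g| + 2 * K ^+ 2 * `|y - g|
   + 2 * K * (`|a - f| * g) + 2 * K * (`|b - f| * g) + K ^+ 2 * (x - 2 * z + y).
Proof.
move=> aK bK x0 y0 g0 s0.
have K0 : 0 <= K by exact: le_trans aK.
have -> : a * a * x - 2 * (a * b * z) + b * b * y =
  a * ((a - b) * x) - b * ((a - b) * y) + a * b * (x - 2 * z + y) by ring.
have h1 : a * b * (x - 2 * z + y) <= K ^+ 2 * (x - 2 * z + y).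
  rewrite ler_wpM2r// (le_trans (ler_norm _))// normrM expr2.
  by rewrite ler_pM.
have h2 c t : `|c| <= K -> 0 <= t -> c * ((a - b) * t) <=
    2 * K ^+ 2 * `|t - g| + K * (`|a - f| * g) + K * (`|b - f| * g).
  move=> cK t0; apply: (le_trans (ler_norm _)); rewrite normrM.
  apply: (@le_trans _ _ (K * `|(a - b) * t|)); first by rewrite ler_wpM2r.
  rewrite (_ : 2 * K ^+ 2 * `|t - g| + K * (`|a - f| * g) + K * (`|b - f| * g)
    = K * (2 * K * `|t - g| + (`|a - f| + `|b - f|) * g)); last by ring.
  rewrite ler_wpM2l// (_ : (a - b) * t = (a - b) * (t - g) + (a - b) * g); last by ring.
  apply: (le_trans (ler_normD _ _)); rewrite !normrM (ger0_norm g0).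
  apply: lerD; rewrite ler_wpM2r//.
    by rewrite (le_trans (ler_normB _ _))// mulr_natl mulr2n lerD.
  rewrite (_ : a - b = (a - f) - (b - f)); last by ring.
  exact: ler_normB.
have := h2 _ _ aK x0; have := h2 (- b) y; rewrite normrN mulNr => /(_ bK y0).
lra.
Qed.

(** The pointwise bound [cauchy_le] leaves three kinds of terms: the [L^1]
    distance of [Gam (u n) (u n)] to [Gam F F], the quantity of [psi_cvg], and
    the energy of [u m - u n]. *)
Lemma chain_cauchy phi psi : chain_pair phi psi -> forall e : R, 0 < e ->
  exists N : nat, forall m n : nat, (N <= m)%N -> (N <= n)%N ->
    q ((phi \o u m) \- (phi \o u n)) < e.
Proof.
move=> ht; have [[K [_ _ bd]] pA _] := ht; have [mphi mpsi] := chain_meas ht.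
have K0 : 0 <= K by exact: le_trans (bd 0).
have igd n := intg_norm (intg_Gam_diff HM HF HF (Au n) (Au n)).
have ip n : intg (fun w => `|psi (u n w) - psi (F w)| * GF w).
  apply: (@intg_bddM _ _ _ _ _ _ (K + K)) => //.
    apply: measurableT_comp => //; apply: measurable_funB.
    - exact: measurableT_comp mpsi (mu_ n).
    - exact: measurableT_comp mpsi mF.
  by apply/aeW => w; rewrite normr_id (le_trans (ler_normB _ _))// lerD.
have h1 := (cvg0P (fun n => Rintegral_ge0 _ (fun w _ => normr_ge0 _))).1
   (Gam_cvg HM HF HF uF uF).
have p0 n : 0 <= Ex (fun w => `|psi (u n w) - psi (F w)| * GF w).
  by apply: Ex_ge0; [exact: intg_meas (ip n)|apply: filterS G0 => w g; exact: mulr_ge0].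
have h2 := (cvg0P p0).1 (psi_cvg HM HF uF ht).
have [_ cu _] := uF.
move=> e e0.
pose k := 2 * K ^+ 2 + 2 * K + 1.
have k0 : 0 < k by have := sqr_ge0 K; rewrite /k; lra.
have e1 : 0 < e / (5 * k) by rewrite divr_gt0// mulr_gt0.
have [N1 hN1] := h1 _ e1; have [N2 hN2] := h2 _ e1; have [N3 hN3] := cu _ e1.
exists (maxn N1 (maxn N2 N3)) => m n; rewrite !geq_max.
move=> /and3P[m1 m2 m3] /and3P[n1 n2 n3].
have := hN1 m m1; have := hN1 n n1; have := hN2 m m2; have := hN2 n n2.
have := hN3 m n m3 n3.
have Amn := A0_subr HM (pA _ (Au m)) (pA _ (Au n)).
have Bmn := A0_subr HM (Au m) (Au n).
have iB := Gam_intg HM Bmn Bmn.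
have : q ((phi \o u m) \- (phi \o u n)) <=
  Ex (fun w => 2 * K ^+ 2 * `|Gam (u m) (u m) w - GF w|
    + 2 * K ^+ 2 * `|Gam (u n) (u n) w - GF w|
    + 2 * K * (`|psi (u m w) - psi (F w)| * GF w)
    + 2 * K * (`|psi (u n w) - psi (F w)| * GF w)
    + K ^+ 2 * Gam (u m \- u n) (u m \- u n) w).
  apply: Ex_le; first exact: (Gam_intg HM).
    by do !apply: intgD; exact: intgZ.
  have t1 := ae_and (chain_Gam HM ht (Au m) (Au m)) (chain_Gam HM ht (Au n) (Au n)).
  have t2 := ae_and (chain_Gam HM ht (Au m) (Au n)) (Gam_B HM (pA _ (Au m)) (pA _ (Au n))).
  have t3 := ae_and (Gam_nneg HM (Au m)) (Gam_nneg HM (Au n)).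
  have t4 := ae_and (Gam_nneg HM Bmn) (Gam_B HM (Au m) (Au n)).
  move: (ae_and (ae_and t1 t2) (ae_and t3 t4)) G0; apply: filterS2 => w.
  move=> [[[e1' e2'] [e3' e4']] [[x0 y0] [s0 s1]]] g0.
  rewrite e4' e1' e2' e3'; rewrite s1 in s0 *.
  exact: cauchy_le.
rewrite ExD; [|by do !apply: intgD; exact: intgZ|exact: intgZ].
rewrite ExD; [|by do !apply: intgD; exact: intgZ|exact: intgZ].
rewrite ExD; [|by do !apply: intgD; exact: intgZ|exact: intgZ].
rewrite ExD; [|exact: intgZ|exact: intgZ].
rewrite !ExZ// => /le_lt_trans h b1 b2 b3 b4 b5; apply: h.
have Ke : e / (5 * k) * (5 * k) = e by rewrite divfK// gt_eqF// mulr_gt0.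
move: e1 b1 b2 b3 b4 b5 Ke; set r := e / _ => r0 b1 b2 b3 b4 b5 <-.
have K2 := sqr_ge0 K.
have l (c y : R) : 0 <= c -> y < r -> c * y <= c * r.
  by move=> c0 yr; rewrite ler_wpM2l// ltW.
have KK : 0 <= 2 * K ^+ 2 by rewrite mulr_ge0.
have KK2 : 0 <= 2 * K by rewrite mulr_ge0.
have := l _ _ KK b5; have := l _ _ KK b4; have := l _ _ KK2 b3.
have := l _ _ KK2 b2; have := l _ _ K2 b1.
have := mulr_ge0 K2 (ltW r0); have := mulr_ge0 K0 (ltW r0).
rewrite /k; lra.
Qed.

End chain_limits.

(** * Derivatives along a random variable *)

Section weighted.
Context d (T : measurableType d) (R : realType) (mu : {measure set T -> \bar R}).
Local Notation intg f := (mu.-integrable setT (EFin \o f)).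
Local Notation Ex f := (Rintegral mu setT f).
Implicit Types f g G : T -> R.

Lemma wsq_lin a f g G : measurable_fun setT f -> measurable_fun setT g ->
  measurable_fun setT G -> {ae mu, forall w, 0 <= G w} ->
  intg (fun w => f w ^+ 2 * G w) -> intg (fun w => g w ^+ 2 * G w) ->
  intg (fun w => (a * f w + g w) ^+ 2 * G w) /\
  Ex (fun w => (a * f w + g w) ^+ 2 * G w) <=
    2 * a ^+ 2 * Ex (fun w => f w ^+ 2 * G w) + 2 * Ex (fun w => g w ^+ 2 * G w).
Proof.
move=> mf mg mG G0 fi gi.
have le w : 0 <= G w -> (a * f w + g w) ^+ 2 * G w <=
    2 * a ^+ 2 * (f w ^+ 2 * G w) + 2 * (g w ^+ 2 * G w).
  move=> g0; rewrite [leRHS](_ : _ = (2 * a ^+ 2 * f w ^+ 2 + 2 * g w ^+ 2) * G w).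
    by rewrite ler_wpM2r// sq_add_le.
  by ring.
have i : intg (fun w => (a * f w + g w) ^+ 2 * G w).
  apply: (@intg_dom _ _ _ _ _ (fun w => 2 * a ^+ 2 * (f w ^+ 2 * G w) + 2 * (g w ^+ 2 * G w))).
  - apply: measurable_funM => //; apply: measurable_funX; apply: measurable_funD => //.
    exact: measurable_funM.
  - apply: filterS G0 => w g0; rewrite ger0_norm; first exact: le.
    by rewrite mulr_ge0// sqr_ge0.
  - by apply: intgD; exact: intgZ.
split=> //; rewrite -!ExZ// -ExD; [|exact: intgZ|exact: intgZ].
apply: Ex_le => //; first by apply: intgD; exact: intgZ.
by apply: filterS G0 => w; exact: le.
Qed.

Lemma sq_lin a f g : measurable_fun setT f -> measurable_fun setT g ->
  intg (fun w => f w ^+ 2) -> intg (fun w => g w ^+ 2) ->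
  intg (fun w => (a * f w + g w) ^+ 2) /\
  Ex (fun w => (a * f w + g w) ^+ 2) <=
    2 * a ^+ 2 * Ex (fun w => f w ^+ 2) + 2 * Ex (fun w => g w ^+ 2).
Proof.
move=> mf mg fi gi; have E (h : T -> R) : (fun w => h w ^+ 2) = (fun w => h w ^+ 2 * 1).
  by apply/funext => w; rewrite mulr1.
have E3 : (fun w => (a * f w + g w) ^+ 2) = (fun w => (a * f w + g w) ^+ 2 * 1).
  exact: E.
rewrite E in fi; rewrite E in gi; rewrite E3 (E f) (E g).
by apply: (@wsq_lin a f g (fun=> 1)) => //; apply/aeW.
Qed.

End weighted.

Section has_deriv.
Context d (T : measurableType d) (R : realType) (nu : probability T R)
  (A0 : set (T -> R)) (Gam : (T -> R) -> (T -> R) -> (T -> R)).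
Local Notation intg f := (nu.-integrable setT (EFin \o f)).
Local Notation Ex f := (Rintegral nu setT f).
Local Notation chain_pair := (chain_pair nu A0 Gam).

(** [(X, xi)] belongs to the closure of the pairs [(phi F, psi F)] for the norm
    [E[X^2] + E[xi^2 * Gam F F]], so that [X] is a function of [F] with weak
    derivative [xi]; the weight means that [xi] is determined only where
    [Gam F F] is positive. *)
Definition has_deriv F (X xi : T -> R) : Prop :=
  [/\ measurable_fun setT X, measurable_fun setT xi
    & forall e : R, 0 < e -> exists phi psi, [/\ chain_pair phi psi,
        intg (fun w => (X w - phi (F w)) ^+ 2),
        intg (fun w => (xi w - psi (F w)) ^+ 2 * Gam F F w)
      & Ex (fun w => (X w - phi (F w)) ^+ 2) +
        Ex (fun w => (xi w - psi (F w)) ^+ 2 * Gam F F w) < e]].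

End has_deriv.

Section closure_energy.
Context d (T : measurableType d) (R : realType) (nu : probability T R)
  (A A0 : set (T -> R)) (Gam : (T -> R) -> (T -> R) -> (T -> R))
  (L : (T -> R) -> (T -> R)) (HM : full_markov_triple nu A A0 Gam L).
Local Notation intg f := (nu.-integrable setT (EFin \o f)).
Local Notation Ex f := (Rintegral nu setT f).
Local Notation q u := (Ex (Gam u u)).
Local Notation DomE := (DomE nu A0 Gam).
Local Notation form_approx := (form_approx nu A0 Gam).
Local Notation chain_pair := (chain_pair nu A0 Gam).

Context (F : T -> R) (HF : DomE F).
Local Notation GF := (Gam F F).
Local Notation has_deriv := (has_deriv nu A0 Gam F).

Let mF : measurable_fun setT F. Proof. exact: (DomE_meas HM HF). Qed.
Let F2 : intg (fun w => F w ^+ 2). Proof. exact: (DomE_sq HM HF). Qed.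
Let Gi : intg GF. Proof. exact: (DomE_Gam_intg HM). Qed.
Let G0 : {ae nu, forall w, 0 <= GF w}. Proof. exact: (DomE_Gam_ge0 HM HF). Qed.
Let mG : measurable_fun setT GF. Proof. exact: intg_meas Gi. Qed.

Let E0 (f : T -> R) : 0 <= Ex (fun w => f w ^+ 2).
Proof. by apply: Rintegral_ge0 => w _; exact: sqr_ge0. Qed.

Let EG0 (f : T -> R) : measurable_fun setT f -> 0 <= Ex (fun w => f w ^+ 2 * GF w).
Proof.
move=> mf; apply: Ex_ge0; first by apply: measurable_funM => //; exact: measurable_funX.
by apply: filterS G0 => w g0; rewrite mulr_ge0// sqr_ge0.
Qed.

Lemma has_deriv_chain phi psi : chain_pair phi psi -> has_deriv (phi \o F) (psi \o F).
Proof.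
move=> ht; have [m1 m2] := chain_measF HM HF ht; split => // e e0.
exists phi, psi.
have -> : (fun w => ((phi \o F) w - phi (F w)) ^+ 2) = (fun=> 0).
  by apply/funext => w /=; rewrite subrr expr0n.
have -> : (fun w => ((psi \o F) w - psi (F w)) ^+ 2 * GF w) = (fun=> 0).
  by apply/funext => w /=; rewrite subrr expr0n mul0r.
by split; rewrite ?Ex_cst ?addr0//; exact: intg_cst.
Qed.

Lemma has_deriv_lin a X xi Y eta : has_deriv X xi -> has_deriv Y eta ->
  has_deriv (fun w => a * X w + Y w) (fun w => a * xi w + eta w).
Proof.
move=> [mX mxi hX] [mY meta hY]; split.
- by apply: measurable_funD => //; exact: measurable_funM.
- by apply: measurable_funD => //; exact: measurable_funM.
move=> e e0; have a0 := sqr_ge0 a.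
have e1 : 0 < e / (2 * a ^+ 2 + 2) by rewrite divr_gt0//; lra.
have [p1 [s1 [t1 i1 j1 l1]]] := hX _ e1.
have [p2 [s2 [t2 i2 j2 l2]]] := hY _ e1.
have [mp1 ms1] := chain_measF HM HF t1; have [mp2 ms2] := chain_measF HM HF t2.
exists (fun x => a * p1 x + p2 x), (fun x => a * s1 x + s2 x).
have [|||| iX leX] := @sq_lin _ _ _ nu a (fun w => X w - p1 (F w)) (fun w => Y w - p2 (F w)) => //.
  exact: measurable_funB. exact: measurable_funB.
have [|||| ix lex] := @wsq_lin _ _ _ nu a (fun w => xi w - s1 (F w)) (fun w => eta w - s2 (F w)) GF _ _ mG G0 => //.
  exact: measurable_funB. exact: measurable_funB.
have E1 : (fun w => (a * X w + Y w - (a * p1 (F w) + p2 (F w))) ^+ 2) =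
    (fun w => (a * (X w - p1 (F w)) + (Y w - p2 (F w))) ^+ 2).
  by apply/funext => w; congr (_ ^+ 2); ring.
have E2 : (fun w => (a * xi w + eta w - (a * s1 (F w) + s2 (F w))) ^+ 2 * GF w) =
    (fun w => (a * (xi w - s1 (F w)) + (eta w - s2 (F w))) ^+ 2 * GF w).
  by apply/funext => w; congr (_ ^+ 2 * _); ring.
rewrite E1 E2; split => //; first exact: (chain_lin HM).
apply: (le_lt_trans (lerD leX lex)).
move: l1 l2; rewrite !ltr_pdivlMr; [|lra|lra].
set x1 := Ex (fun w => (X w - _) ^+ 2); set y1 := Ex (fun w => (Y w - _) ^+ 2).
set x2 := Ex (fun w => (xi w - _) ^+ 2 * _); set y2 := Ex (fun w => (eta w - _) ^+ 2 * _).
have : 0 <= x1 + x2.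
  apply: addr_ge0; first exact: (E0 (fun w => X w - p1 (F w))).
  by apply: (@EG0 (fun w => xi w - s1 (F w))); exact: measurable_funB.
have : 0 <= y1 + y2.
  apply: addr_ge0; first exact: (E0 (fun w => Y w - p2 (F w))).
  by apply: (@EG0 (fun w => eta w - s2 (F w))); exact: measurable_funB.
nra.
Qed.

Let sqD (f g : T -> R) : measurable_fun setT f -> measurable_fun setT g ->
  intg (fun w => f w ^+ 2) -> intg (fun w => g w ^+ 2) ->
  intg (fun w => (f w + g w) ^+ 2) /\
  Ex (fun w => (f w + g w) ^+ 2) <= 2 * Ex (fun w => f w ^+ 2) + 2 * Ex (fun w => g w ^+ 2).
Proof.
move=> mf mg fi gi; have [] := sq_lin 1 mf mg fi gi.
rewrite expr1n mulr1 (_ : (fun w => (1 * f w + g w) ^+ 2) = (fun w => (f w + g w) ^+ 2))//.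
by apply/funext => w; rewrite mul1r.
Qed.

Let wsqD (f g : T -> R) : measurable_fun setT f -> measurable_fun setT g ->
  intg (fun w => f w ^+ 2 * GF w) -> intg (fun w => g w ^+ 2 * GF w) ->
  intg (fun w => (f w + g w) ^+ 2 * GF w) /\
  Ex (fun w => (f w + g w) ^+ 2 * GF w) <=
    2 * Ex (fun w => f w ^+ 2 * GF w) + 2 * Ex (fun w => g w ^+ 2 * GF w).
Proof.
move=> mf mg fi gi; have [] := wsq_lin 1 mf mg mG G0 fi gi.
rewrite expr1n mulr1 (_ : (fun w => (1 * f w + g w) ^+ 2 * GF w) =
  (fun w => (f w + g w) ^+ 2 * GF w))//.
by apply/funext => w; rewrite mul1r.
Qed.

Let sqB (f g : T -> R) : measurable_fun setT f -> measurable_fun setT g ->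
  intg (fun w => f w ^+ 2) -> intg (fun w => g w ^+ 2) ->
  intg (fun w => (f w - g w) ^+ 2) /\
  Ex (fun w => (f w - g w) ^+ 2) <= 2 * Ex (fun w => f w ^+ 2) + 2 * Ex (fun w => g w ^+ 2).
Proof.
move=> mf mg fi gi; have [] := sq_lin (-1) mg mf gi fi.
rewrite sqrrN expr1n mulr1 addrC.
rewrite (_ : (fun w => (-1 * g w + f w) ^+ 2) = (fun w => (f w - g w) ^+ 2))//.
by apply/funext => w; rewrite mulN1r addrC.
Qed.

Let wsqB (f g : T -> R) : measurable_fun setT f -> measurable_fun setT g ->
  intg (fun w => f w ^+ 2 * GF w) -> intg (fun w => g w ^+ 2 * GF w) ->
  intg (fun w => (f w - g w) ^+ 2 * GF w) /\
  Ex (fun w => (f w - g w) ^+ 2 * GF w) <=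
    2 * Ex (fun w => f w ^+ 2 * GF w) + 2 * Ex (fun w => g w ^+ 2 * GF w).
Proof.
move=> mf mg fi gi; have [] := wsq_lin (-1) mg mf mG G0 gi fi.
rewrite sqrrN expr1n mulr1 addrC (_ : (fun w => (-1 * g w + f w) ^+ 2 * GF w) =
  (fun w => (f w - g w) ^+ 2 * GF w))//.
by apply/funext => w; rewrite mulN1r addrC.
Qed.

Lemma has_deriv_int X xi : has_deriv X xi ->
  intg (fun w => X w ^+ 2) /\ intg (fun w => xi w ^+ 2 * GF w).
Proof.
move=> [mX mxi /(_ 1 ltr01)[p [s [ht i1 i2 _]]]].
have [mp ms] := chain_measF HM HF ht; split.
- have [|||| + _] := @sqD (fun w => X w - p (F w)) (fun w => p (F w)) => //.
  + exact: measurable_funB.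
  + exact: (chain_sq HM HF ht).
  + by congr (_.-integrable _ (_ \o _)); apply/funext => w; rewrite subrK.
- have [|||| + _] := @wsqD (fun w => xi w - s (F w)) (fun w => s (F w)) => //.
  + exact: measurable_funB.
  + exact: (chain_GF HM HF ht).
  + by congr (_.-integrable _ (_ \o _)); apply/funext => w; rewrite subrK.
Qed.

Lemma has_deriv_limit (X_ xi_ : nat -> T -> R) (X xi : T -> R) :
  measurable_fun setT X -> measurable_fun setT xi ->
  (forall n, has_deriv (X_ n) (xi_ n)) ->
  (forall n, intg (fun w => (X w - X_ n w) ^+ 2)) ->
  (forall n, intg (fun w => (xi w - xi_ n w) ^+ 2 * GF w)) ->
  Ex (fun w => (X w - X_ n w) ^+ 2) @[n --> \oo] --> 0 ->
  Ex (fun w => (xi w - xi_ n w) ^+ 2 * GF w) @[n --> \oo] --> 0 ->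
  has_deriv X xi.
Proof.
move=> mX mxi hd iX ix cX cx; split => // e e0.
have mxn n : measurable_fun setT (fun w => xi w - xi_ n w).
  by apply: measurable_funB => //; case: (hd n).
have e8 : 0 < e / 8 by lra.
have [N1 h1] := (cvg0P (fun n => E0 (fun w => X w - X_ n w))).1 cX _ e8.
have [N2 h2] := (cvg0P (fun n => EG0 (mxn n))).1 cx _ e8.
pose n := maxn N1 N2.
have {}h1 := h1 n (leq_maxl _ _); have {}h2 := h2 n (leq_maxr _ _).
have [mXn mxin /(_ _ e8)[p [s [ht i1 i2 l]]]] := hd n.
have [mp ms] := chain_measF HM HF ht.
exists p, s.
have [|||| j1 l1] := @sqD (fun w => X w - X_ n w) (fun w => X_ n w - p (F w)) => //.
  exact: measurable_funB. exact: measurable_funB.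
have [|||| j2 l2] := @wsqD (fun w => xi w - xi_ n w) (fun w => xi_ n w - s (F w)) => //.
  exact: measurable_funB.
have E1 : (fun w => (X w - p (F w)) ^+ 2) =
    (fun w => (X w - X_ n w + (X_ n w - p (F w))) ^+ 2).
  by apply/funext => w; congr (_ ^+ 2); ring.
have E2 : (fun w => (xi w - s (F w)) ^+ 2 * GF w) =
    (fun w => (xi w - xi_ n w + (xi_ n w - s (F w))) ^+ 2 * GF w).
  by apply/funext => w; congr (_ ^+ 2 * _); ring.
rewrite E1 E2; split => //; apply: (le_lt_trans (lerD l1 l2)); lra.
Qed.

Let young_cross (a b del : R) : 0 < del ->
  `|2 * b * (a - b)| <= del^-1 * (a - b) ^+ 2 + del * b ^+ 2.
Proof.
move=> d0.
have hp : 0 <= (del * b - (a - b)) ^+ 2 / del by rewrite divr_ge0 ?sqr_ge0// ltW.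
have hm : 0 <= (del * b + (a - b)) ^+ 2 / del by rewrite divr_ge0 ?sqr_ge0// ltW.
have Ep : (del * b - (a - b)) ^+ 2 / del = del^-1 * (a - b) ^+ 2 + del * b ^+ 2 - 2 * b * (a - b).
  by field; rewrite gt_eqF.
have Em : (del * b + (a - b)) ^+ 2 / del = del^-1 * (a - b) ^+ 2 + del * b ^+ 2 + 2 * b * (a - b).
  by field; rewrite gt_eqF.
rewrite Ep in hp; rewrite Em in hm; rewrite ler_norml; apply/andP; split; lra.
Qed.

Let young_sq (a b del : R) : 0 < del ->
  `|a ^+ 2 - b ^+ 2| <= (1 + del^-1) * (a - b) ^+ 2 + del * b ^+ 2.
Proof.
move=> d0.
have -> : a ^+ 2 - b ^+ 2 = (a - b) ^+ 2 + 2 * b * (a - b) by ring.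
apply: (le_trans (ler_normD _ _)).
rewrite (_ : (1 + _) * _ + _ = (a - b) ^+ 2 + (del^-1 * (a - b) ^+ 2 + del * b ^+ 2)).
  by rewrite ger0_norm ?sqr_ge0// lerD2l; exact: young_cross.
by ring.
Qed.
(** Convergence in weighted [L^2] implies that of the norms, here through
    Young's inequality with a small parameter [del]. *)
Lemma wsq_cvg (f : nat -> T -> R) (g : T -> R) : (forall n, measurable_fun setT (f n)) ->
  measurable_fun setT g -> (forall n, intg (fun w => f n w ^+ 2 * GF w)) ->
  intg (fun w => g w ^+ 2 * GF w) ->
  (forall n, intg (fun w => (f n w - g w) ^+ 2 * GF w)) ->
  Ex (fun w => (f n w - g w) ^+ 2 * GF w) @[n --> \oo] --> 0 ->
  Ex (fun w => f n w ^+ 2 * GF w) @[n --> \oo] --> Ex (fun w => g w ^+ 2 * GF w).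
Proof.
move=> mf mg fi gi fgi c; apply: cvg_Ex => //.
apply/cvg0P => [n|e e0]; first exact: Rintegral_ge0.
have mfg n : measurable_fun setT (fun w => f n w - g w) by exact: measurable_funB.
set b := Ex (fun w => g w ^+ 2 * GF w).
have b0 : 0 <= b by exact: EG0.
pose del := e / (2 * (b + 1)).
have d0 : 0 < del by rewrite divr_gt0// mulr_gt0//; lra.
have k0 : 0 < 1 + del^-1 by rewrite ltr_wpDl// invr_gt0.
have e1 : 0 < e / (2 * (1 + del^-1)) by rewrite divr_gt0// mulr_gt0.
have [N hN] := (cvg0P (fun n => EG0 (mfg n))).1 c _ e1.
exists N => n /hN {}hN.
have : Ex (fun w => `|f n w ^+ 2 * GF w - g w ^+ 2 * GF w|) <=
  Ex (fun w => (1 + del^-1) * ((f n w - g w) ^+ 2 * GF w) + del * (g w ^+ 2 * GF w)).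
  apply: Ex_le; first exact/intg_norm/intgB.
    by apply: intgD; exact: intgZ.
  apply: filterS G0 => w g0; rewrite -mulrBl normrM (ger0_norm g0).
  apply: (le_trans (ler_wpM2r g0 (young_sq (f n w) (g w) d0))).
  by rewrite le_eqVlt; apply/orP; left; apply/eqP; ring.
rewrite ExD; [|exact: intgZ|exact: intgZ]; rewrite !ExZ// -/b => /le_lt_trans; apply.
have h1 : del * b <= e / 2.
  rewrite (_ : e / 2 = del * (b + 1)); last by rewrite /del; field; lra.
  by rewrite ler_wpM2l ?ltW//; lra.
move: hN; rewrite ltr_pdivlMr ?mulr_gt0// => hN.
have : (1 + del^-1) * Ex (fun w => (f n w - g w) ^+ 2 * GF w) < e / 2.
  by move: hN; set x := Rintegral _ _ _; set y := del^-1; lra.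
by move: h1; lra.
Qed.

(** [X] is approximated by the diagonal sequence [v n = phi_n (u (k n))], where
    [(phi_n, psi_n)] approximates [(X, xi)] and [k n] is so large that [v n] is
    close to [phi_n (F)] in [L^2] and in energy.  To compare [v m] with [v n],
    move both to a common later index [j]: the difference is then the value at
    [u j] of the single chain pair [phi_m - phi_n], whose energy is close to
    [E[(psi_m - psi_n)(F)^2 * Gam F F]]. *)
Lemma has_deriv_q X xi : has_deriv X xi ->
  DomE X /\ q X = Ex (fun w => xi w ^+ 2 * GF w).
Proof.
move=> hd; have [X2 xi2] := has_deriv_int hd; have [mX mxi happ] := hd.
have [u uF] : exists u, form_approx u F by have [] := (DomEP HM F).1 HF.
have Au n : A0 (u n) by case: uF.
have /choice[p hp] : forall n : nat, exists p : (R -> R) * (R -> R), [/\ chain_pair p.1 p.2,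
   intg (fun w => (X w - p.1 (F w)) ^+ 2),
   intg (fun w => (xi w - p.2 (F w)) ^+ 2 * GF w),
   Ex (fun w => (X w - p.1 (F w)) ^+ 2) < n.+1%:R^-1
   & Ex (fun w => (xi w - p.2 (F w)) ^+ 2 * GF w) < n.+1%:R^-1].
  move=> n; have /happ[f [s [ht i1 i2 l]]] : 0 < n.+1%:R^-1 :> R by rewrite invr_gt0.
  have [mf ms] := chain_measF HM HF ht.
  exists (f, s); split => //=; apply: le_lt_trans l.
  - by rewrite lerDl (@EG0 (fun w => xi w - s (F w)))//; exact: measurable_funB.
  - by rewrite lerDr (@E0 (fun w => X w - f (F w))).
have tp n : chain_pair (p n).1 (p n).2 by case: (hp n).
have pA n f : A0 f -> A0 ((p n).1 \o f) by case: (tp n) => _ + _; exact.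
have mp n := (chain_measF HM HF (tp n)).1; have ms n := (chain_measF HM HF (tp n)).2.
pose S n := Ex (fun w => (p n).2 (F w) ^+ 2 * GF w).
have /choice[k hk] : forall n : nat, exists k : nat, [/\
    forall j, (k <= j)%N -> q (((p n).1 \o u k) \- ((p n).1 \o u j)) < n.+1%:R^-1,
    Ex (fun w => ((p n).1 (u k w) - (p n).1 (F w)) ^+ 2) < n.+1%:R^-1
  & `|q ((p n).1 \o u k) - S n| < n.+1%:R^-1].
  move=> n; have n0 : 0 < n.+1%:R^-1 :> R by rewrite invr_gt0.
  have [N1 h1] := chain_cauchy HM HF uF (tp n) n0.
  have [N2 h2] := (cvg0P (fun m => E0 (fun w => (p n).1 (u m w) - (p n).1 (F w)))).1
    (chain_l2 HM HF uF (tp n)) _ n0.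
  have /cvgrPdist_lt/(_ _ n0)[N3 _ h3] := chain_q_cvg HM HF uF (tp n).
  pose N := maxn N1 (maxn N2 N3); exists N; split.
  - by move=> j Nj; apply: h1; [exact: leq_maxl|exact: leq_trans (leq_maxl _ _) Nj].
  - by apply: h2; rewrite /N maxnCA leq_maxl.
  - by rewrite distrC; apply: h3; rewrite /= /N maxnA leq_maxr.
pose v n := (p n).1 \o u (k n).
have Av n : A0 (v n) by exact: pA.
have vX : form_approx v X.
  split => //.
  - move=> e e0.
    (* [q_D3] will be used with the budget 4 (e / 40) + 4 (e / 8) + 2 (e / 40) *)
    have e1 : 0 < e / 40 by lra.
    have [N hN] := (cvg0P (@invn_ge0 R)).1 (@cvg_invn R) _ e1.
    exists N => m n Nm Nn.
    have {}Nm := hN m Nm; have {}Nn := hN n Nn.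
    have [m1 _ _] := hk m; have [n1 _ _] := hk n.
    have tmn := chain_B HM (tp m) (tp n).
    have /cvgrPdist_lt/(_ _ e1)[N3 _ h3] := chain_q_cvg HM HF uF tmn.
    pose j := maxn N3 (maxn (k m) (k n)).
    have {}m1 := m1 j; have {}n1 := n1 j.
    have {}m1 : q (((p m).1 \o u (k m)) \- ((p m).1 \o u j)) < m.+1%:R^-1.
      by apply: m1; rewrite /j maxnCA leq_maxl.
    have {}n1 : q (((p n).1 \o u (k n)) \- ((p n).1 \o u j)) < n.+1%:R^-1.
      by apply: n1; rewrite /j maxnA leq_maxr.
    have {}m1 := lt_trans m1 Nm; have {}n1 := lt_trans n1 Nn.
    pose f (x : R) := (p m).1 x - (p n).1 x.
    pose D := Ex (fun w => ((p m).2 (F w) - (p n).2 (F w)) ^+ 2 * GF w).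
    have hj : `|q (f \o u j) - D| < e / 40.
      by rewrite distrC; exact: (h3 j (leq_maxl _ _)).
    have hD : D < e / 10.
      have [_ _ i1 _ l1] := hp m; have [_ _ i2 _ l2] := hp n.
      have [||||_] := @wsqB (fun w => (xi w - (p n).2 (F w))) (fun w => (xi w - (p m).2 (F w))) => //.
      + exact: (measurable_funB mxi (ms n)).
      + exact: (measurable_funB mxi (ms m)).
      rewrite (_ : Rintegral _ _ _ = D); last first.
        by apply: eq_Rintegral => w _; congr (_ ^+ 2 * _); ring.
      rewrite /= in l1 l2 * => h.
      have := lt_trans l1 Nm; have := lt_trans l2 Nn; lra.
    have hq : q (f \o u j) < e / 8.
      have := ler_norm (q (f \o u j) - D); lra.
    rewrite (_ : v m \- v n = (((p m).1 \o u (k m)) \- ((p m).1 \o u j)) \+ (f \o u j)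
      \+ (((p n).1 \o u j) \- ((p n).1 \o u (k n)))); last first.
      by apply/funext => w; rewrite /v /f /=; ring.
    apply: (le_lt_trans (q_D3 HM _ _ _)).
    + by apply: (A0_subr HM); exact: pA.
    + have [_ h _] := tmn; exact: h.
    + by apply: (A0_subr HM); exact: pA.
    rewrite [X in 2 * X](q_opp HM); [|exact: pA|exact: pA]; lra.
  - apply: (@squeeze0 _ _ (fun n => 4 * n.+1%:R^-1)); last first.
      by rewrite -[0](mulr0 4); apply: cvgMr; exact: (@cvg_invn R).
    move=> n; rewrite E0/=.
    have [_ i1 _ l1 _] := hp n; have [_ l2 _] := hk n.
    have mv : measurable_fun setT (v n) by exact: (A0_meas HM).
    have [||||_] := @sqB (fun w => v n w - (p n).1 (F w)) (fun w => X w - (p n).1 (F w)) => //.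
    + exact: (measurable_funB mv (mp n)).
    + exact: (measurable_funB mX (mp n)).
    + exact: (intg_sqB mv (mp n) (A0_sq HM (Av n)) (chain_sq HM HF (tp n))).
    rewrite [X in X <= _](_ : _ = Ex (fun w => (v n w - X w) ^+ 2)); last first.
      by apply: eq_Rintegral => w _; congr (_ ^+ 2); ring.
    rewrite /v /= in l1 l2 *; move: l1 l2; set r := n.+1%:R^-1; lra.
have DX : DomE X by apply/(DomEP HM); split => //; exists v.
split => //.
have c1 := Ex_Gam_cvg HM DX DX vX vX.
have c2 : S n @[n --> \oo] --> Ex (fun w => xi w ^+ 2 * GF w).
  apply: wsq_cvg => //.
  - by move=> n; exact: (chain_GF HM HF (tp n)).
  - move=> n; have [_ _ + _ _] := hp n.
    by congr (_.-integrable _ (_ \o _)); apply/funext => w; rewrite -sqrrN opprB.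
  - apply: squeeze0 (@cvg_invn R) => n.
    rewrite (@EG0 (fun w => (p n).2 (F w) - xi w)) /=; last exact: (measurable_funB (ms n) mxi).
    have [_ _ _ _ /ltW] := hp n; apply: le_trans; rewrite le_eqVlt; apply/orP; left; apply/eqP.
    by apply: eq_Rintegral => w _; rewrite -sqrrN opprB.
apply: (cvg_uniq c1).
apply/(subr_cvg0 (fun n => q (v n)) _).
rewrite (_ : (fun n => _) = (fun n => (q (v n) - S n) + (S n - Ex (fun w => xi w ^+ 2 * GF w)))); last first.
  by apply/funext => n; rewrite /=; ring.
rewrite -[0]addr0; apply: cvgD.
  apply: norm_cvg0; apply: squeeze0 (@cvg_invn R) => n; rewrite normr_ge0 /=.
  by have [_ _ /ltW] := hk n.
by apply/(subr_cvg0 S).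
Qed.

(** Polarization of [has_deriv_q]. *)
Lemma has_deriv_dform X xi Y eta : has_deriv X xi -> has_deriv Y eta ->
  intg (fun w => xi w * eta w * GF w) /\
  Ex (Gam X Y) = Ex (fun w => xi w * eta w * GF w).
Proof.
move=> hX hY; have hXY := has_deriv_lin 1 hX hY.
have [mX mxi _] := hX; have [mY meta _] := hY.
have [_ i1] := has_deriv_int hX; have [_ i2] := has_deriv_int hY.
have [_ i3] := has_deriv_int hXY.
have [DX qX] := has_deriv_q hX; have [DY qY] := has_deriv_q hY.
have [_ qXY] := has_deriv_q hXY.
have i : intg (fun w => xi w * eta w * GF w).
  apply: (@intg_dom _ _ _ _ _ (fun w => xi w ^+ 2 * GF w + eta w ^+ 2 * GF w)).
  - by apply: measurable_funM => //; exact: measurable_funM.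
  - apply: filterS G0 => w g0; rewrite normrM (ger0_norm g0) -mulrDl ler_wpM2r//.
    rewrite ler_norml; nra.
  - exact: intgD.
split => //; move: qXY; rewrite (q_DomE_quad HM)// qX qY.
rewrite (_ : Ex (fun w => (1 * xi w + eta w) ^+ 2 * GF w) =
  Ex (fun w => xi w ^+ 2 * GF w + 2 * (xi w * eta w * GF w) + eta w ^+ 2 * GF w)); last first.
  by apply: eq_Rintegral => w _; ring.
rewrite ExD//; last by apply: intgD => //; exact: intgZ.
rewrite ExD//; last exact: intgZ.
rewrite ExZ//; lra.
Qed.

End closure_energy.

(** * Primitives of Borel indicators *)

Section primitive_of_bounded.
Context (R : realType).
Local Notation mu := (@lebesgue_measure R).
Local Notation intg f := (mu.-integrable setT (EFin \o f)).
Local Notation Ix f := (Rintegral mu setT f).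
Implicit Types (g : R -> R) (a x y : R).

Lemma indic_le1 (B : set R) y : `|\1_B y : R| <= 1.
Proof. by rewrite indicE; case: (_ \in _); rewrite ?normr1 ?normr0. Qed.

(** The kernel that turns the oriented integral from [a] to [x] into an integral
    over the whole line, with no case distinction on the order of [a] and [x]. *)
Definition oriented a x : R -> R := fun y => \1_(`]-oo, x]) y - \1_(`]-oo, a]) y.

Lemma oriented_meas a x : measurable_fun setT (oriented a x).
Proof. by apply: measurable_funB. Qed.

Lemma oriented_le a x y : a <= x -> oriented a x y = \1_(`]a, x]) y.
Proof.
move=> ax; rewrite /oriented !indicE !mem_setE !in_itv/=.
case: (leP y a) => ya; case: (leP y x) => yx; rewrite ?subrr ?subr0//.
by move: (le_lt_trans ax yx); rewrite ltNge ya.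
Qed.

Lemma oriented_ge a x y : x <= a -> oriented a x y = - \1_(`]x, a]) y.
Proof. by move=> xa; rewrite -(oriented_le _ xa) /oriented opprB. Qed.

Lemma oriented_intg a x : intg (oriented a x).
Proof.
have [ax|/ltW xa] := leP a x.
- rewrite (_ : oriented a x = \1_(`]a, x])); first exact: integrable_indic_itv.
  by apply/funext => y; rewrite oriented_le.
- rewrite (_ : oriented a x = (fun y => -1 * \1_(`]x, a]) y)).
    by apply: intgZ; exact: integrable_indic_itv.
  by apply/funext => y; rewrite oriented_ge// mulN1r.
Qed.

Lemma Ix_oriented a x : Ix (fun y => `|oriented a x y|) = `|x - a|.
Proof.
have H c b : c <= b -> Ix \1_(`]c, b]) = b - c.
  move=> cb; rewrite /Rintegral integral_indic// setIT.
  rewrite [X in fine X]lebesgue_measure_itv/= lte_fin; case: ltP => //= bc.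
  by apply/esym/eqP; rewrite subr_eq0 eq_le cb bc.
have [ax|/ltW xa] := leP a x.
- rewrite (ger0_norm (_ : 0 <= x - a)) ?subr_ge0// -H//.
  by apply: eq_Rintegral => y _; rewrite oriented_le// ger0_norm.
- rewrite (ler0_norm (_ : x - a <= 0)) ?subr_le0// opprB -H//.
  by apply: eq_Rintegral => y _; rewrite oriented_ge// normrN ger0_norm.
Qed.

Definition prim a g x : R := Ix (fun y => g y * oriented a x y).

Lemma prim_intg a g x (M : R) : measurable_fun setT g ->
  (forall y, `|g y| <= M) -> intg (fun y => g y * oriented a x y).
Proof.
move=> mg gM; apply: (@intg_bddM _ _ _ mu g (oriented a x) M mg _ (oriented_intg a x)).
by apply: aeW => y; exact: gM.
Qed.

Lemma prim_bound a g x (M : R) : measurable_fun setT g ->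
  (forall y, `|g y| <= M) -> `|prim a g x| <= M * `|x - a|.
Proof.
move=> mg gM; have i := prim_intg a x mg gM.
apply: (le_trans (Ex_norm i)); rewrite -Ix_oriented -ExZ; last exact/intg_norm/oriented_intg.
apply: Ex_le; [exact: intg_norm|exact/intgZ/intg_norm/oriented_intg|].
by apply/aeW => y; rewrite normrM ler_wpM2r.
Qed.

Lemma prim_shift a b g x (M : R) : measurable_fun setT g ->
  (forall y, `|g y| <= M) -> prim a g x - prim a g b = prim b g x.
Proof.
move=> mg gM; rewrite /prim -ExB; [|exact: prim_intg gM|exact: prim_intg gM].
by apply: eq_Rintegral => y _; rewrite /oriented; ring.
Qed.

Lemma prim_lip a g x y (M : R) : measurable_fun setT g ->
  (forall y, `|g y| <= M) -> `|prim a g x - prim a g y| <= M * `|x - y|.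
Proof. by move=> mg gM; rewrite (prim_shift _ _ _ mg gM); exact: prim_bound. Qed.

Lemma prim_meas a g (M : R) : measurable_fun setT g ->
  (forall y, `|g y| <= M) -> measurable_fun setT (prim a g).
Proof.
by move=> mg gM; apply: (@lipschitz_measurable _ _ M) => x y; exact: prim_lip.
Qed.

Lemma prim_lin a (c : R) g (h : R -> R) x (M N : R) : measurable_fun setT g ->
  (forall y, `|g y| <= M) -> measurable_fun setT h ->
  (forall y, `|h y| <= N) ->
  prim a (fun y => c * g y + h y) x = c * prim a g x + prim a h x.
Proof.
move=> mg gM mh hN.
have i1 := prim_intg a x mg gM; have i2 := prim_intg a x mh hN.
rewrite /prim -ExZ// -ExD//; last exact: intgZ.
by apply: eq_Rintegral => y _; ring.
Qed.

Lemma prim_cvg a (g : nat -> R -> R) (h : R -> R) x (M : R) :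
  (forall n, measurable_fun setT (g n)) -> measurable_fun setT h ->
  (forall n y, `|g n y| <= M) -> (forall y, g n y @[n --> \oo] --> h y) ->
  prim a (g n) x @[n --> \oo] --> prim a h x.
Proof.
move=> mg mh gM gh.
have [] // := @dominated_Ex _ _ _ mu (fun n y => g n y * oriented a x y)
  (fun y => h y * oriented a x y) (fun y => M * `|oriented a x y|).
- by move=> n; exact: (measurable_funM (mg n) (oriented_meas a x)).
- exact: (measurable_funM mh (oriented_meas a x)).
- by apply: aeW => y; apply: cvgM; [exact: gh|exact: cvg_cst].
- exact/intgZ/intg_norm/oriented_intg.
- by apply/aeW => y n; rewrite normrM ler_wpM2r.
Qed.

Lemma bdd_cvg (g : nat -> R -> R) (h : R -> R) (M : R) :
  (forall n y, `|g n y| <= M) -> (forall y, g n y @[n --> \oo] --> h y) ->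
  forall y, `|h y| <= M.
Proof.
move=> gM gh y; have h1 : `|g n y| @[n --> \oo] --> `|h y| by apply: cvg_norm; exact: gh.
rewrite -(cvg_lim _ h1)//; apply: limr_le; first by apply/cvg_ex; eexists; exact: h1.
exact: nearW.
Qed.

End primitive_of_bounded.

Section prim_rule.
Context d (T : measurableType d) (R : realType) (nu : probability T R)
  (A A0 : set (T -> R)) (Gam : (T -> R) -> (T -> R) -> (T -> R))
  (L : (T -> R) -> (T -> R)) (HM : full_markov_triple nu A A0 Gam L).
Local Notation intg f := (nu.-integrable setT (EFin \o f)).
Local Notation Ex f := (Rintegral nu setT f).
Local Notation DomE := (DomE nu A0 Gam).
Local Notation chain_pair := (chain_pair nu A0 Gam).
Context (F : T -> R) (HF : DomE F) (a : R).
Local Notation GF := (Gam F F).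
Local Notation has_deriv := (has_deriv nu A0 Gam F).

Let mF : measurable_fun setT F. Proof. exact: (DomE_meas HM HF). Qed.
Let F2 : intg (fun w => F w ^+ 2). Proof. exact: (DomE_sq HM HF). Qed.
Let Gi : intg GF. Proof. exact: (DomE_Gam_intg HM). Qed.
Let G0 : {ae nu, forall w, 0 <= GF w}. Proof. exact: (DomE_Gam_ge0 HM HF). Qed.
Let mG : measurable_fun setT GF. Proof. exact: intg_meas Gi. Qed.

(** The chain rule for the function [prim a g], whose derivative [g] may be
    discontinuous. *)
Definition prim_rule (g : R -> R) := has_deriv (prim a g \o F) (g \o F).

Lemma prim_rule_lin (c : R) (g h : R -> R) (M N : R) : measurable_fun setT g ->
  (forall y, `|g y| <= M) -> measurable_fun setT h ->
  (forall y, `|h y| <= N) -> prim_rule g -> prim_rule h -> prim_rule (fun y => c * g y + h y).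
Proof.
move=> mg gM mh hN hg hh; have := has_deriv_lin HM HF c hg hh.
rewrite /prim_rule; congr has_deriv; apply/funext => w /=.
by rewrite (prim_lin a c _ mg gM mh hN).
Qed.

(** Dominated convergence: for functions bounded by [M], the primitives at [F]
    are bounded by [M * `|F - a|], which is in [L^2], and the squared derivatives
    are integrated against the integrable weight [Gam F F]. *)
Lemma prim_rule_limit (g : nat -> R -> R) (h : R -> R) (M : R) :
  (forall n, measurable_fun setT (g n)) -> measurable_fun setT h ->
  (forall n y, `|g n y| <= M) -> (forall y, g n y @[n --> \oo] --> h y) ->
  (forall n, prim_rule (g n)) -> prim_rule h.
Proof.
move=> mg mh gM gh hg.
have hM := bdd_cvg gM gh.
have M0 : 0 <= M by exact: le_trans (hM 0).
have mp n : measurable_fun setT (prim a (g n) \o F).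
  exact: measurableT_comp (prim_meas a (mg n) (gM n)) mF.
have mph : measurable_fun setT (prim a h \o F).
  exact: measurableT_comp (prim_meas a mh hM) mF.
have mgF n : measurable_fun setT (g n \o F) by exact: measurableT_comp (mg n) mF.
have mhF : measurable_fun setT (h \o F) by exact: measurableT_comp mh mF.
have dX : intg (fun w => 4 * M ^+ 2 * (F w - a) ^+ 2).
  by apply: intgZ; apply: intg_sqB => //; exact: intg_cst.
have dG : intg (fun w => 4 * M ^+ 2 * GF w) by exact: intgZ.
have bX n w : `|(prim a h (F w) - prim a (g n) (F w)) ^+ 2| <= 4 * M ^+ 2 * (F w - a) ^+ 2.
  have b1 := prim_bound a (F w) mh hM; have b2 := prim_bound a (F w) (mg n) (gM n).
  rewrite normrX (_ : 4 * M ^+ 2 * (F w - a) ^+ 2 = (2 * M * `|F w - a|) ^+ 2); last first.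
    by rewrite !exprMn real_normK ?num_real//; ring.
  rewrite lerXn2r ?nnegrE// ?mulr_ge0//.
  by apply: (le_trans (ler_normB _ _)); lra.
have bG n w : 0 <= GF w ->
    `|(h (F w) - g n (F w)) ^+ 2 * GF w| <= 4 * M ^+ 2 * GF w.
  move=> g0; rewrite normrM (ger0_norm g0) ler_wpM2r// normrX.
  rewrite (_ : 4 * M ^+ 2 = (2 * M) ^+ 2); last by ring.
  rewrite lerXn2r ?nnegrE// ?mulr_ge0//.
  by apply: (le_trans (ler_normB _ _)); have := hM (F w); have := gM n (F w); lra.
have mX n : measurable_fun setT (fun w => (prim a h (F w) - prim a (g n) (F w)) ^+ 2).
  by apply: measurable_funX; exact: (measurable_funB mph (mp n)).
have mx n : measurable_fun setT (fun w => (h (F w) - g n (F w)) ^+ 2 * GF w).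
  by apply: measurable_funM => //; apply: measurable_funX; exact: (measurable_funB mhF (mgF n)).
apply: (has_deriv_limit HM HF mph mhF hg).
- by move=> n; apply: (intg_dom (mX n) _ dX); apply: aeW => w; exact: bX.
- by move=> n; apply: (intg_dom (mx n) _ dG); apply: filterS G0 => w; exact: bG.
- have [] := @dominated_Ex _ _ _ nu (fun n w => (prim a h (F w) - prim a (g n) (F w)) ^+ 2)
    (fun=> 0) _ mX (measurable_cst _) _ dX.
  + apply: aeW => w; apply: (@sqrB_cvg0 _ (fun n => prim a (g n) (F w))).
    by apply: prim_cvg; [exact: mg|exact: mh|exact: gM|exact: gh].
  + by apply/aeW => w n; exact: bX.
  + by rewrite Ex_cst.
- have [] := @dominated_Ex _ _ _ nu (fun n w => (h (F w) - g n (F w)) ^+ 2 * GF w)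
    (fun=> 0) _ mx (measurable_cst _) _ dG.
  + by apply/aeW => w; rewrite -[0](mul0r (GF w)); apply: cvgM; [exact: sqrB_cvg0|exact: cvg_cst].
  + by apply: filterS G0 => w g0 n; exact: bG.
  + by rewrite Ex_cst.
Qed.

Lemma prim_rule_chain phi psi : chain_pair phi psi ->
  (forall x, prim a psi x = phi x - phi a) -> prim_rule psi.
Proof.
move=> ht hp; have := has_deriv_chain HM HF (chain_B HM ht (chain_cst HM (phi a))).
rewrite /prim_rule; congr has_deriv; apply/funext => w /=; first by rewrite hp.
by rewrite subr0.
Qed.

End prim_rule.

Section prim_rule_borel.
Context d (T : measurableType d) (R : realType) (nu : probability T R)
  (A A0 : set (T -> R)) (Gam : (T -> R) -> (T -> R) -> (T -> R))
  (L : (T -> R) -> (T -> R)) (HM : full_markov_triple nu A A0 Gam L).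
Local Notation DomE := (DomE nu A0 Gam).
Context (F : T -> R) (HF : DomE F) (a : R).
Local Notation prim_rule := (prim_rule nu A0 Gam F a).
Context (Hray : forall c : R, prim_rule \1_(`]c, +oo[)).

Let indic_cvg (B : nat -> set R) (C : set R) :
  (forall y, exists N, forall n, (N <= n)%N -> B n y <-> C y) ->
  forall y, (\1_(B n) y : R) @[n --> \oo] --> (\1_C y : R).
Proof.
move=> h y; apply: cvg_near_cst; have [N hN] := h y; exists N => // n Nn /=.
rewrite !indicE; have [h1 h2] := hN n Nn.
have [Cy|nCy] := pselect (C y).
  by rewrite (mem_set Cy) (mem_set (h2 Cy)).
by rewrite (memNset nCy) memNset// => /h1.
Qed.

Lemma prim_rule_setT : prim_rule \1_setT.
Proof.
apply: (prim_rule_limit HM HF (g := fun n => \1_(`]- n%:R, +oo[)) (M := 1)).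
- by move=> n; exact: measurable_indic.
- exact: measurable_indic.
- by move=> n y; exact: indic_le1.
- apply: indic_cvg => y; near \oo => N; exists N => n Nn; split => // _ /=.
  rewrite in_itv/= andbT ltrNl; apply: (@lt_le_trans _ _ N%:R); last by rewrite ler_nat.
  near: N; exact: nbhs_infty_gtr.
- by move=> n; exact: Hray.
Unshelve. all: end_near. Qed.

(** Open rays form a generating pi-system, and the sets satisfying the
    conclusion form a Dynkin system by linearity and bounded limits. *)
Lemma prim_rule_indic (B : set R) : measurable B -> prim_rule \1_B.
Proof.
move=> mB.
have GE : @measurable _ (measurableTypeR R) = <<s @RGenOInfty.G R >>.
  exact: RGenOInfty.measurableE.
have sB : <<s @RGenOInfty.G R >> B by rewrite -GE.
apply: (@dynkin_induction _ (measurableTypeR R) (@RGenOInfty.G R)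
  [set C | prim_rule \1_C] GE _ _ _ _ _ B sB).
- move=> _ _ [x ->] [y ->]; exists (Num.max x y).
  by apply/seteqP; split => z /=; rewrite !in_itv/= !andbT gt_max => /andP.
- exact: prim_rule_setT.
- by move=> _ [x ->]; exact: Hray.
- move=> S mS gS /=.
  have := prim_rule_lin HM HF (-1) (measurable_indic mS) (indic_le1 S)
    (measurable_indic measurableT) (indic_le1 setT) gS prim_rule_setT.
  congr prim_rule; apply/funext => y; rewrite !indicE in_setC in_setT mulN1r.
  by case: (_ \in _); rewrite /= ?oppr0 ?add0r ?addNr.
- move=> S mS tS gS /=.
  (* finite unions are handled by disjointness, the countable one as a limit *)
  pose U n := \bigcup_(k in `I_n) S k.
  have mU n : measurable (U n) by apply: bigcup_measurable => k _; exact: mS.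
  have US n : \1_(U n.+1) = (fun y => 1 * \1_(U n) y + \1_(S n) y :> R).
    apply/funext => y; rewrite mul1r !indicE.
    have [Sy|nSy] := pselect (S n y).
      rewrite (mem_set Sy) (_ : y \in U n.+1); last by apply/mem_set; exists n => /=.
      rewrite memNset ?add0r// => -[k /= kn Sky].
      by have := tS k n I I; rewrite (_ : k = n)// in kn; 
         [rewrite ltnn in kn|apply: tS => //; exists y].
    rewrite (memNset nSy) addr0.
    have -> // : U n.+1 = U n `|` S n.
      apply/seteqP; split => z [].
        move=> k /=; rewrite ltnS leq_eqVlt => /predU1P[->|kn] Sz; first by right.
        by left; exists k.
      - by move=> [k /= kn Sz]; exists k => //=; exact: ltnW.
      - by move=> Sz; exists n => /=.
    by rewrite in_setU (memNset nSy) orbF.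
  have gU n : prim_rule \1_(U n).
    elim: n => [|n IH].
      have -> : U 0%N = ~` setT by rewrite setCT -subset0 => z [].
      have := prim_rule_lin HM HF (-1) (measurable_indic measurableT) (indic_le1 setT)
        (measurable_indic measurableT) (indic_le1 setT) prim_rule_setT prim_rule_setT.
      congr prim_rule; apply/funext => y; rewrite setCT !indicE in_setT in_set0.
      by rewrite mulr1 addNr.
    rewrite US; exact: (prim_rule_lin HM HF 1 (measurable_indic (mU n)) (indic_le1 (U n))
      (measurable_indic (mS n)) (indic_le1 (S n)) IH (gS n)).
  apply: (prim_rule_limit HM HF (g := fun n => \1_(U n)) (M := 1)) => //.
  + by move=> n; exact: (measurable_indic (mU n)).
  + exact: (measurable_indic (bigcupT_measurable _ mS)).
  + by move=> n y; exact: indic_le1.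
  + apply: indic_cvg => y; have [[k _ Sk]|nS] := pselect ((\bigcup_k S k) y).
      exists k.+1 => n kn; split => _; [by exists k|by exists k].
    by exists 0%N => n _; split => [[k _ Sk]|//]; exists k.
Qed.

Lemma prim_rule_sum (s : seq R) (B : R -> set R) : (forall x, measurable (B x)) ->
  [/\ measurable_fun setT (fun y => \sum_(x <- s) x * \1_(B x) y),
     exists M, forall y, `|\sum_(x <- s) x * \1_(B x) y| <= M
   & prim_rule (fun y => \sum_(x <- s) x * \1_(B x) y)].
Proof.
move=> mB; elim: s => [|x s [mS [M sM] gs]].
  have E : (fun y => \sum_(x <- [::]) x * \1_(B x) y) = \1_(set0 : set R).
    by apply/funext => y; rewrite big_nil indicE in_set0.
  rewrite E; split; [exact: measurable_indic| |exact: prim_rule_indic].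
  by exists 0 => y; rewrite big_nil normr0.
have E : (fun y => \sum_(x <- x :: s) x * \1_(B x) y) =
    (fun y => x * \1_(B x) y + \sum_(x <- s) x * \1_(B x) y).
  by apply/funext => y; rewrite big_cons.
rewrite E; split.
- exact: (measurable_funD (measurable_funM (measurable_cst x) (measurable_indic (mB x))) mS).
- exists (`|x| + M) => y; rewrite big_cons.
  apply: (le_trans (ler_normD _ _)); apply: lerD => //.
  by rewrite normrM ler_piMr// indic_le1.
- apply: (prim_rule_lin HM HF x (measurable_indic (mB x)) (indic_le1 (B x)) mS sM) => //.
  exact: prim_rule_indic.
Qed.

Import HBNNSimple.

Lemma prim_rule_nnsfun (h : {nnsfun R >-> R}) :
  (exists M : R, forall y, `|h y| <= M) /\ prim_rule h.
Proof.
have mB x : measurable (h @^-1` [set x]) by exact: measurable_sfunP.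
have [_ [M hM] gh] := prim_rule_sum (finmap.enum_fset (fset_set (range h))) mB.
have E : (h : R -> R) = (fun y => \sum_(x <- finmap.enum_fset (fset_set (range h)))
    x * \1_(h @^-1` [set x]) y).
  apply/funext => y; rewrite {1}(fimfunE h y) fsbig_finite//; exact: fimfunP.
by split; [exists M => y; rewrite E|rewrite E].
Qed.

End prim_rule_borel.

(** * Rays as limits of sigmoids *)

Section smooth_line.
Context (R : realType).
Implicit Types f : nat -> R -> R.

(** Explicit successive derivatives: from this datum, smoothness in the sense of
    iterated partial derivatives follows by induction ([smooth_lift]). *)
Definition deriv_seq f := forall n x, is_derive x (1 : R) (f n) (f n.+1 x).

Definition lift_fun (g : R -> R) : 'rV[R]_1 -> R := fun v => g (v 0 0).

Lemma partial_lift (g : R -> R) (i : 'I_1) :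
  partial i (lift_fun g) = lift_fun (fun x => 'D_1 g x).
Proof.
apply/funext => v; rewrite /partial /lift_fun /derive.
set k1 := (X in lim (X @ _)); set k2 := (X in _ = lim (X @ _)).
suff -> : k1 = k2 by [].
apply/funext => h; rewrite /k1 /k2 /=; congr (_ *: (g _ - _)).
by rewrite !mxE (ord1 i) !eqxx.
Qed.

Lemma smooth_lift f : deriv_seq f -> smooth (lift_fun (f 0%N)).
Proof.
move=> df s x.
have -> : foldr (@partial R 1) (lift_fun (f 0%N)) s = lift_fun (f (size s)).
  elim: s => [//|i s IH] /=; rewrite IH partial_lift; congr lift_fun.
  by apply/funext => y; have h := df (size s) y; rewrite derive_val.
apply: (@differentiable_comp _ _ _ _ (fun v : 'rV[R]_1 => v 0 0) (f (size s))).
  exact: differentiable_coord.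
by apply/derivable1_diffP; have [] := df (size s) (x 0 0).
Qed.

Lemma deriv_seq_cont f n : deriv_seq f -> continuous (f n).
Proof.
move=> df x; apply: differentiable_continuous.
by apply/derivable1_diffP; have [] := df n x.
Qed.

Lemma deriv_seq_lip f n (K : R) : deriv_seq f -> (forall x, `|f n.+1 x| <= K) ->
  forall x y, `|f n x - f n y| <= K * `|x - y|.
Proof.
move=> df fK.
have H x y : x <= y -> `|f n y - f n x| <= K * `|y - x|.
  move=> xy; have [||c _ ->] := @MVT_segment _ (f n) (f n.+1) x y xy.
  - by move=> z _; exact: df.
  - by apply: continuous_subspaceT; exact: deriv_seq_cont.
  - by rewrite normrM ler_wpM2r.
move=> x y; have [xy|/ltW yx] := leP x y; last exact: H.
by rewrite distrC (distrC x); exact: H.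
Qed.

(** The fundamental theorem of calculus, on either side of [a]. *)
Lemma deriv_seq_prim f n a x (K : R) : deriv_seq f -> (forall x, `|f n.+1 x| <= K) ->
  prim a (f n.+1) x = f n x - f n a.
Proof.
move=> df fK.
have mf : measurable_fun setT (f n.+1).
  by apply: continuous_measurable_fun; exact: deriv_seq_cont.
have H c b : c < b -> Rintegral lebesgue_measure setT
    (fun y => f n.+1 y * \1_(`]c, b]) y) = f n b - f n c.
  move=> cb; transitivity (\int[lebesgue_measure]_(y in `]c, b]) f n.+1 y).
    rewrite [RHS]Rintegral_mkcond; apply: eq_Rintegral => y _.
    by rewrite patchE indicE; case: ifP; rewrite ?mulr1 ?mulr0.
  have i : lebesgue_measure.-integrable setT (EFin \o f n.+1 \_ `]c, b]).
    rewrite (_ : _ \_ _ = fun y => f n.+1 y * \1_(`]c, b]) y).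
      apply: (@intg_bddM _ _ _ lebesgue_measure _ _ K mf); first exact/aeW.
      exact: integrable_indic_itv.
    by apply/funext => y; rewrite patchE indicE; case: ifP; rewrite ?mulr1 ?mulr0.
  rewrite Rintegral_itv_obnd_cbnd; last first.
    by apply/(integrable_mkcond _ _).2 => //; rewrite restrict_EFin.
  rewrite /Rintegral (continuous_FTC2 (F := f n))//.
  - by apply: continuous_subspaceT; exact: deriv_seq_cont.
  - split.
    + by move=> z _; have [] := df n z.
    + by apply: cvg_at_right_filter; exact: deriv_seq_cont.
    + by apply: cvg_at_left_filter; exact: deriv_seq_cont.
  - by move=> z _; have h := df n z; rewrite derive1E derive_val.
rewrite /prim; have [ax|xa|->] := ltgtP a x.
- by rewrite -(H _ _ ax); apply: eq_Rintegral => y _; rewrite (oriented_le _ (ltW ax)).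
- rewrite (_ : f n x - f n a = -1 * (f n a - f n x)); last by ring.
  rewrite -(H _ _ xa) -ExZ.
    by apply: eq_Rintegral => y _; rewrite (oriented_ge _ (ltW xa)) mulN1r mulrN.
  apply: (@intg_bddM _ _ _ lebesgue_measure _ _ K mf); first exact/aeW.
  exact: integrable_indic_itv.
- rewrite subrr (_ : (fun y => _) = (fun=> 0)).
    by rewrite Rintegral_cst// mul0r.
  by apply/funext => y; rewrite /oriented subrr mulr0.
Qed.

End smooth_line.

Section sigmoids.
Context (R : realType).
Implicit Types (x al be : R).

(** The logistic function [s] is a convenient smooth step: its primitive
    [softplus] is explicit, and [s' = s (1 - s)] bounds all its derivatives. *)
Definition sigmoid x : R := (1 + expR (- x))^-1.
Definition softplus x : R := ln (1 + expR x).

Let den x : 0 < 1 + expR x. Proof. by rewrite ltr_wpDl// expR_gt0. Qed.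

Lemma sigmoid_gt0 x : 0 < sigmoid x. Proof. by rewrite invr_gt0. Qed.

Lemma sigmoidN x : 1 - sigmoid x = sigmoid (- x).
Proof.
have := den x; have := den (- x); rewrite /sigmoid opprK => h1 h2.
have e : expR x * expR (- x) = 1 by rewrite -expRD subrr expR0.
apply: (mulfI (lt0r_neq0 h1)); apply: (mulfI (lt0r_neq0 h2)).
rewrite mulrBr mulr1 mulfV ?gt_eqF// [RHS]mulrCA mulfV ?gt_eqF//.
by rewrite mulr1; lra.
Qed.

Lemma sigmoid_lt1 x : sigmoid x < 1.
Proof. by rewrite -subr_gt0 sigmoidN sigmoid_gt0. Qed.

Lemma sigmoid_le x : 0 < x -> sigmoid (- x) <= x^-1.
Proof.
move=> x0; rewrite /sigmoid opprK lef_pV2 ?posrE//.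
by have := expR_ge1Dx x; lra.
Qed.

Lemma is_derive_sigmoid x : is_derive x (1 : R) sigmoid (sigmoid x * (1 - sigmoid x)).
Proof.
have d0 : is_derive x (1 : R) (expR \o (-%R : R -> R)) (expR (- x) * -1).
  exact: is_derive1_comp.
have d1 : is_derive x (1 : R) (fun y => 1 + expR (- y)) (0 + expR (- x) * -1).
  exact: (is_deriveD (is_derive_cst (1 : R) x (1 : R)) d0).
have n0 : 1 + expR (- x) != 0 by rewrite gt_eqF.
have d2 := @is_deriveV R (fun y : R => 1 + expR (- y)) x _ _ n0 d1.
apply: (@is_derive_eq _ _ _ _ _ _ _ _ d2).
by rewrite /sigmoid /GRing.scale /=; field.
Qed.

Lemma is_derive_softplus x : is_derive x (1 : R) softplus (sigmoid x).
Proof.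
have d1 : is_derive x (1 : R) (fun y => 1 + expR y) (0 + expR x).
  exact: (is_deriveD (is_derive_cst (1 : R) x (1 : R)) (is_derive_expR x)).
have d2 : is_derive x (1 : R) (@ln R \o (fun y => 1 + expR y)) ((1 + expR x)^-1 * (0 + expR x)).
  by apply: is_derive1_comp => //; exact: is_derive1_ln.
apply: (@is_derive_eq _ _ _ _ _ _ _ _ d2).
have h1 := den x; have h2 := den (- x).
have e : expR x * expR (- x) = 1 by rewrite -expRD subrr expR0.
apply: (mulfI (lt0r_neq0 h1)); apply: (mulfI (lt0r_neq0 h2)).
rewrite /sigmoid [RHS]mulrCA mulfV ?gt_eqF// mulVKf ?gt_eqF// mulr1; lra.
Qed.

(** As [s' = s (1 - s)], the [n]-th derivative of [s (al * x + be)] is a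
    polynomial in [s (al * x + be)], namely this one. *)
Fixpoint sigmoid_poly (al : R) n : {poly R} :=
  if n is n'.+1 then al *: ((sigmoid_poly al n')^`() * ('X * (1 - 'X))) else 'X.

(** Index 0 is a primitive of the sigmoid, so that the sigmoid itself can serve
    as the derivative in a chain pair. *)
Definition softplus_derivs al be n x : R :=
  if n is n'.+1 then (sigmoid_poly al n').[sigmoid (al * x + be)]
  else al^-1 * softplus (al * x + be).

Lemma softplus_derivsP al be : al != 0 -> deriv_seq (softplus_derivs al be).
Proof.
move=> al0 n x.
have da : is_derive x (1 : R) (fun y => al * y + be) al.
  have d0 := is_deriveZ al (is_derive_id x (1 : R)).
  have d1 : is_derive x (1 : R) (fun y => al * y + be) (al *: (1 : R) + 0).
    exact: (is_deriveD d0 (is_derive_cst be x (1 : R))).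
  by apply: (@is_derive_eq _ _ _ _ _ _ _ _ d1); rewrite addr0 /GRing.scale /= mulr1.
case: n => [|n].
  have d := @is_derive1_comp R softplus _ x _ _ (is_derive_softplus _) da.
  have d1 : is_derive x (1 : R) (softplus_derivs al be 0) (al^-1 *: (sigmoid (al * x + be) * al)).
    exact: (is_deriveZ al^-1 d).
  apply: (@is_derive_eq _ _ _ _ _ _ _ _ d1).
  by rewrite /GRing.scale /= hornerX; field.
have d := @is_derive1_comp R sigmoid _ x _ _ (is_derive_sigmoid _) da.
have d2 := @is_derive1_comp R (horner (sigmoid_poly al n)) _ x _ _ (is_derive_poly _ _) d.
apply: (@is_derive_eq _ _ _ _ _ _ _ _ d2).
by rewrite /= hornerZ !hornerM hornerD hornerN hornerX hornerC; ring.
Qed.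

End sigmoids.

Section rays.
Context d (T : measurableType d) (R : realType) (nu : probability T R)
  (A A0 : set (T -> R)) (Gam : (T -> R) -> (T -> R) -> (T -> R))
  (L : (T -> R) -> (T -> R)) (HM : full_markov_triple nu A A0 Gam L).
Local Notation DomE := (DomE nu A0 Gam).
Local Notation chain_pair := (chain_pair nu A0 Gam).

(** The diffusion property in one variable. *)
Lemma chain_deriv_seq (f : nat -> R -> R) (K : R) : deriv_seq f ->
  (forall x, `|f 1%N x| <= K) -> (forall x, `|f 2%N x| <= K) -> chain_pair (f 0%N) (f 1%N).
Proof.
move=> df f1 f2; have sf := smooth_lift df.
have E g : f 0%N \o g = comp_rv (lift_fun (f 0%N)) (fun=> g) :> (T -> R).
  by apply/funext => w; rewrite /comp_rv /lift_fun mxE.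
split.
- by exists K; split => //; exact: deriv_seq_lip.
- by move=> g Ag; rewrite E; exact: (A0_smooth HM).
- move=> g h Ag Ah; rewrite E.
  have := Gam_diffusion HM (F := fun=> g) sf (fun=> A0_sub HM Ag) (A0_sub HM Ah).
  apply: filterS => w /(_ I) ->; rewrite big_ord1 partial_lift /comp_rv /lift_fun mxE.
  by have h0 := df 0%N (g w); rewrite derive_val.
Qed.

Context (F : T -> R) (HF : DomE F) (a : R).
Local Notation prim_rule := (prim_rule nu A0 Gam F a).

Let sigmoid_abs (x : R) : `|sigmoid x| <= 1.
Proof. by rewrite ger0_norm ltW ?sigmoid_gt0 ?sigmoid_lt1. Qed.

Lemma prim_rule_sigmoid (al be : R) : al != 0 -> prim_rule (fun x => sigmoid (al * x + be)).
Proof.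
move=> al0; have df := softplus_derivsP be al0.
have E : softplus_derivs al be 1 = (fun x => sigmoid (al * x + be)).
  by apply/funext => x /=; rewrite hornerX.
pose K := 1 + `|al|.
have f1 x : `|softplus_derivs al be 1 x| <= K.
  by rewrite E (le_trans (sigmoid_abs _))// lerDl.
have f2 x : `|softplus_derivs al be 2 x| <= K.
  rewrite /= derivX mul1r hornerZ hornerM hornerD hornerN hornerX hornerC.
  rewrite sigmoidN !normrM.
  apply: (@le_trans _ _ `|al|); last by rewrite lerDr.
  by rewrite ler_piMr// mulr_ile1.
rewrite -E; apply: (prim_rule_chain HM HF (chain_deriv_seq df f1 f2)) => x.
exact: deriv_seq_prim df f1.
Qed.

(** With [k = n.+1] the argument is [k^2 (y - c) - k].  If [y > c] it eventually
    exceeds [k]; if [y <= c] it is at most [- k].  The shift by [- k] serves for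
    [y = c], where the limit must be 0. *)
Lemma sigmoid_step (c y : R) :
  sigmoid (n.+1%:R ^+ 2 * y + (- n.+1%:R ^+ 2 * c - n.+1%:R)) @[n --> \oo]
    --> (\1_(`]c, +oo[) y : R).
Proof.
have n0 n : 0 < n.+1%:R :> R by [].
rewrite indicE; have [cy|yc] := ltP c y.
  rewrite mem_set /= ?in_itv/= ?cy//.
  apply/cvgrPdist_lt => e e0.
  have [N1 h1] := (cvg0P (@invn_ge0 R)).1 (@cvg_invn R) _ e0.
  have yc0 : 0 < (y - c) / 2 by rewrite divr_gt0// subr_gt0.
  have [N2 h2] := (cvg0P (@invn_ge0 R)).1 (@cvg_invn R) _ yc0.
  exists (maxn N1 N2) => // n /=; rewrite geq_max => /andP[nN1 nN2].
  rewrite sigmoidN ger0_norm ?ltW ?sigmoid_gt0//.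
  apply: (@le_lt_trans _ _ n.+1%:R^-1); last exact: h1.
  set x := _ + _; have nx : n.+1%:R <= x.
    have := h2 n nN2; rewrite ltr_pdivlMr// ltr_pdivrMl//.
    by rewrite /x; have := n0 n; move: (n.+1%:R : R) => r; nra.
  apply: (le_trans (sigmoid_le (lt_le_trans (n0 n) nx))).
  by rewrite lef_pV2 ?posrE// (lt_le_trans (n0 n) nx).
rewrite memNset /=; last by rewrite in_itv/= andbT; apply/negP; rewrite -leNgt.
apply: squeeze0 (@cvg_invn R) => n; rewrite ltW ?sigmoid_gt0//=.
set x := _ + _; have nx : n.+1%:R <= - x.
  rewrite /x; have := n0 n; move: (n.+1%:R : R) => r; nra.
rewrite -[x]opprK; apply: (le_trans (sigmoid_le (lt_le_trans (n0 n) nx))).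
by rewrite lef_pV2 ?posrE// (lt_le_trans (n0 n) nx).
Qed.

Lemma prim_rule_ray (c : R) : prim_rule \1_(`]c, +oo[).
Proof.
pose g n x : R := sigmoid (n.+1%:R ^+ 2 * x + (- n.+1%:R ^+ 2 * c - n.+1%:R)).
have n0 n : n.+1%:R ^+ 2 != 0 :> R by rewrite expf_neq0// pnatr_eq0.
have gg n : prim_rule (g n) by exact: prim_rule_sigmoid.
have mg n : measurable_fun setT (g n).
  have df := softplus_derivsP (- n.+1%:R ^+ 2 * c - n.+1%:R) (n0 n).
  have -> : g n = softplus_derivs (n.+1%:R ^+ 2) (- n.+1%:R ^+ 2 * c - n.+1%:R) 1.
    by apply/funext => x /=; rewrite hornerX.
  by apply: continuous_measurable_fun; exact: deriv_seq_cont df.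
have mi : measurable_fun setT (\1_(`]c, +oo[) : R -> R) by exact: measurable_indic.
have gb n y : `|g n y| <= 1 by exact: sigmoid_abs.
by apply: (prim_rule_limit HM HF (g := g) (M := 1)) => //; exact: sigmoid_step.
Qed.

End rays.

(** * Elements of zero energy *)

Section ergodic.
Context d (T : measurableType d) (R : realType) (nu : probability T R)
  (A A0 : set (T -> R)) (Gam : (T -> R) -> (T -> R) -> (T -> R))
  (L : (T -> R) -> (T -> R)) (HM : full_markov_triple nu A A0 Gam L).
Local Notation intg f := (nu.-integrable setT (EFin \o f)).
Local Notation Ex f := (Rintegral nu setT f).
Local Notation DomE := (DomE nu A0 Gam).

(** By [Ex_Gam_null] the form vanishes against [X], so [X] is in the domain of
    [L] with constant 0, and [L X] is orthogonal to the algebra by integration by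
    parts.  The algebra is dense in [L^2], hence [L X = 0] and ergodicity
    applies. *)
Lemma null_energy_cst X : DomE X -> Ex (Gam X X) = 0 ->
  exists c : R, {ae nu, forall w, X w = c}.
Proof.
move=> HX qX.
have BX G : DomE G -> Ex (Gam X G) = 0 by move=> HG; exact: (Ex_Gam_null HM).
have LX : DomL nu A0 Gam X.
  split => //; exists 0 => G HG.
  by rewrite (dformE HM)// BX// abse0 mul0e.
have [mL iL] := (Lfun2P _ _).1 (L_DomL HM LX).
have ort g : A0 g -> Ex (fun w => g w * L X w) = 0.
  move=> Ag; have := L_DomL_ibp HM LX (DomE_A0 HM Ag).
  rewrite (dformE HM)//; last exact: (DomE_A0 HM).
  rewrite (BX _ (DomE_A0 HM Ag)) oppe0 exp_Ex; first by case.
  exact: (intg_prod (A0_meas HM Ag) mL (A0_sq HM Ag) iL).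
have E0 : 0 <= Ex (fun w => L X w ^+ 2).
  by apply: Rintegral_ge0 => w _; exact: sqr_ge0.
have LX0 : Ex (fun w => L X w ^+ 2) = 0.
  apply/eqP; rewrite eq_le E0 andbT leNgt; apply/negP => pos.
  have s0 : 0 < Num.sqrt (Ex (fun w => L X w ^+ 2)) by rewrite sqrtr_gt0.
  have [g [Ag]] := A0_dense HM (ler1n R 2) (L_DomL HM LX) s0.
  have id2 : intg (fun w => (L X w - g w) ^+ 2).
    by apply: (intg_sqB mL (A0_meas HM Ag) iL); exact: (A0_sq HM Ag).
  rewrite -/(L2norm nu (L X \- g)) L2normE// lte_fin ltr_sqrt//.
  (* the two sides differ pointwise by [g^2 / 2], and [E[g * L X] = 0] *)
  have : Ex (fun w => L X w ^+ 2) <= Ex (fun w =>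
      (2^-1 * (L X w - g w) ^+ 2 + 2^-1 * L X w ^+ 2) + g w * L X w).
    apply: Ex_le => //.
      apply: intgD; first by apply: intgD; exact: intgZ.
      exact: (intg_prod (A0_meas HM Ag) mL (A0_sq HM Ag) iL).
    by apply/aeW => w; have := sqr_ge0 (g w); nra.
  rewrite ExD; [|by apply: intgD; exact: intgZ|]; last first.
    exact: (intg_prod (A0_meas HM Ag) mL (A0_sq HM Ag) iL).
  rewrite ExD; [|exact: intgZ|exact: intgZ].
  rewrite !ExZ// (ort _ Ag) /=; lra.
have /(L_ergodic HM LX)[c hc] : L X = cst 0 %[ae nu].
  have := Ex_eq0_ae iL (aeW _ (fun w => sqr_ge0 (L X w))) LX0.
  by apply: filterS => w /eqP; rewrite sqrf_eq0 => /eqP.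
by exists c; apply: filterS hc => w /(_ I).
Qed.

End ergodic.

(** * Integrability of the inverse of the conditional expectation *)

Section inverse_moment.
Context d (T : measurableType d) (R : realType) (nu : probability T R).
Local Notation intg f := (nu.-integrable setT (EFin \o f)).

(** The inverse of the positive part, equal to 0 where [x <= 0]; thus
    [1 / x = posinv x - posinv (- x)] for [x] nonzero. *)
Definition posinv (x : R) : R := (Num.max x 0)^-1.

Lemma posinv_ge0 x : 0 <= posinv x.
Proof. by rewrite invr_ge0 le_max lexx orbT. Qed.

Lemma posinv_pos x : 0 < x -> posinv x = x^-1.
Proof. by move=> x0; rewrite /posinv max_l// ltW. Qed.

Lemma posinv_neg x : x <= 0 -> posinv x = 0.
Proof. by move=> x0; rewrite /posinv max_r// invr0. Qed.

Lemma posinv_meas : measurable_fun setT posinv.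
Proof.
rewrite (_ : posinv = fun x => (Num.max x 0) `^ (-1)).
  apply: (measurableT_comp (measurable_powR (-1 : R))).
  by apply: measurable_maxr; [exact: measurable_id|exact: measurable_cst].
by apply/funext => x; rewrite powR_inv1// le_max lexx orbT.
Qed.

(** [1 / G <= 1 + 1 / G^p]: compare [G] with 1. *)
Lemma inverse_moment (G : T -> R) (p : R) : 1 < p -> measurable_fun setT G ->
  {ae nu, forall w, 0 <= G w} ->
  (\int[nu]_w ((G w)%:E `^ p)^-1 < +oo)%E ->
  {ae nu, forall w, 0 < G w} /\ intg (fun w => posinv (G w)).
Proof.
move=> p1 mG G0 fin.
have mp : measurable_fun setT (fun w => G w `^ p).
  exact: measurableT_comp (measurable_powR p) mG.
pose h w : \bar R := ((G w)%:E `^ p)^-1%E.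
have hE w : h w = if G w `^ p == 0 then +oo%E else (posinv (G w `^ p))%:E.
  rewrite /h poweR_EFin inver; case: eqVneq => // n0.
  by rewrite posinv_pos// lt_neqAle eq_sym n0 powR_ge0.
have mh : measurable_fun setT h.
  rewrite (funext hE); apply: measurable_fun_ifT.
  - by apply: measurable_fun_eqr; [exact: mp|exact: measurable_cst].
  - exact: measurable_cst.
  - by apply/measurable_EFinP; exact: measurableT_comp posinv_meas mp.
have h0 w : (0 <= h w)%E by rewrite inve_ge0 poweR_ge0.
have ih : nu.-integrable setT h.
  apply/integrableP; split => //.
  by under eq_integral do rewrite gee0_abs//.
have hfin := integrable_ae measurableT ih.
have Gpos : {ae nu, forall w, 0 < G w}.
  move: hfin G0; apply: filterS2 => w /(_ I) + g0; rewrite hE.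
  case: eqVneq => // n0 _; rewrite lt_neqAle g0 andbT eq_sym.
  apply/negP => /eqP Gw; move: n0; rewrite Gw powR0 ?eqxx//.
  by rewrite gt_eqF// (lt_trans ltr01).
split => //.
have ik : intg (fun w => posinv (G w `^ p)).
  apply: (le_integrable measurableT _ _ ih).
    by apply/measurable_EFinP; exact: measurableT_comp posinv_meas mp.
  move=> w _; rewrite (gee0_abs (h0 w)) hE /=.
  case: eqVneq => [->|_]; first exact: leey.
  by rewrite ger0_norm// posinv_ge0.
apply: (@intg_dom _ _ _ _ _ (fun w => 1 + posinv (G w `^ p))).
- exact: measurableT_comp posinv_meas mG.
- apply: filterS Gpos => w g0; rewrite ger0_norm ?posinv_ge0// !posinv_pos ?powR_gt0//.
  have [G1|G1] := leP 1 (G w).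
    rewrite -[leLHS]addr0 lerD// ?invr_ge0 ?powR_ge0//.
    by rewrite invf_ple ?posrE// invr1.
  rewrite -[leLHS]add0r lerD// lef_pV2 ?posrE ?powR_gt0//.
  by apply: ge1r_powR; [rewrite g0 ltW|exact: ltW].
- exact: intgD (intg_cst nu 1) ik.
Qed.

End inverse_moment.

Section simple_approximation.
Context (R : realType).
Import HBNNSimple.

Lemma simple_approx (k : R -> R) : measurable_fun setT k -> (forall y, 0 <= k y) ->
  exists h : nat -> {nnsfun R >-> R},
    (forall n y, 0 <= h n y <= k y) /\ (forall y, h n y @[n --> \oo] --> k y).
Proof.
move=> mk k0.
have mf : measurable_fun setT (EFin \o k) by exact/measurable_EFinP.
exists (nnsfun_approx measurableT mf).
have c y : nnsfun_approx measurableT mf n y @[n --> \oo] --> k y.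
  have h := @cvg_nnsfun_approx _ _ _ setT measurableT (EFin \o k) mf _ y I.
  have /fine_cvg := h (fun x _ => k0 x : (0 <= (EFin \o k) x)%E).
  exact.
split=> // n y; apply/andP; split; first by [].
have nd : nondecreasing_seq (fun n => nnsfun_approx measurableT mf n y).
  by move=> i j ij; have /lefP := @nd_nnsfun_approx _ _ _ setT measurableT (EFin \o k) mf i j ij; exact.
have cv : cvgn (fun n => nnsfun_approx measurableT mf n y) by apply/cvg_ex; eexists; exact: c.
by have := nondecreasing_cvgn_le nd cv n; rewrite (cvg_lim _ (c y)).
Qed.

End simple_approximation.

Section conditional.
Context d (T : measurableType d) (R : realType) (nu : probability T R).
Local Notation intg f := (nu.-integrable setT (EFin \o f)).
Local Notation Ex f := (Rintegral nu setT f).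
Context (F G : T -> R) (tau : R -> R).
Context (mF : measurable_fun setT F) (iG : intg G) (H2 : cond_exp_given nu G F tau).
Import HBNNSimple.

Let mtau : measurable_fun setT tau. Proof. by case: H2. Qed.
Let itau : intg (tau \o F). Proof. by case: H2. Qed.
Let mG : measurable_fun setT G. Proof. exact: intg_meas iG. Qed.

Let mulB (B : set R) (f : T -> R) : measurable B -> intg f ->
  intg (fun w => \1_B (F w) * f w).
Proof.
move=> mB fi; apply: (@intg_bddM _ _ _ _ _ _ 1) => //.
  exact: measurableT_comp (measurable_indic mB) mF.
by apply/aeW => w; exact: indic_le1.
Qed.

Lemma cond_indic (B : set R) : measurable B ->
  Ex (fun w => \1_B (F w) * G w) = Ex (fun w => \1_B (F w) * tau (F w)).
Proof.
move=> mB; have [_ _ /(_ B mB) e] := H2.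
have E (f : T -> R) : Ex (fun w => \1_B (F w) * f w) =
    fine (\int[nu]_(w in F @^-1` B) (f w)%:E)%E.
  transitivity (\int[nu]_(w in F @^-1` B) f w)%R => //.
  rewrite [RHS]Rintegral_mkcond; apply: eq_Rintegral => w _.
  rewrite patchE indicE (_ : (w \in F @^-1` B) = (F w \in B)).
    by case: ifP; rewrite ?mul1r ?mul0r.
  by apply/idP/idP; rewrite !inE.
by rewrite !E e.
Qed.

(** From indicators to simple functions by linearity, then by dominated
    convergence. *)
Lemma cond_mult (k : R -> R) (M : R) : measurable_fun setT k ->
  (forall y, 0 <= k y <= M) ->
  Ex (fun w => k (F w) * G w) = Ex (fun w => k (F w) * tau (F w)).
Proof.
move=> mk k0M.
have M0 : 0 <= M by have /andP[h1 h2] := k0M 0; exact: le_trans h2.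
have H (s : seq R) (B : R -> set R) : (forall x, measurable (B x)) ->
    exists N : R, forall y, `|\sum_(x <- s) x * \1_(B x) y| <= N.
  move=> mB; elim: s => [|x s [N hN]].
    by exists 0 => y; rewrite big_nil normr0.
  exists (`|x| + N) => y; rewrite big_cons (le_trans (ler_normD _ _))// lerD//.
  by rewrite normrM ler_piMr// indicE; case: (_ \in _); rewrite ?normr1 ?normr0.
have mS (s : seq R) (B : R -> set R) : (forall x, measurable (B x)) ->
    measurable_fun setT (fun w => \sum_(x <- s) x * \1_(B x) (F w)).
  move=> mB; apply: measurable_sum => x.
  apply: (measurable_funM (measurable_cst x)).
  exact: measurableT_comp (measurable_indic (mB x)) mF.
have sums (s : seq R) (B : R -> set R) : (forall x, measurable (B x)) ->
    Ex (fun w => (\sum_(x <- s) x * \1_(B x) (F w)) * G w) =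
    Ex (fun w => (\sum_(x <- s) x * \1_(B x) (F w)) * tau (F w)).
  move=> mB; elim: s => [|x s IH].
    by apply: eq_Rintegral => w _; rewrite big_nil !mul0r.
  have E f : intg f -> Ex (fun w => (\sum_(x <- x :: s) x * \1_(B x) (F w)) * f w) =
      x * Ex (fun w => \1_(B x) (F w) * f w) +
      Ex (fun w => (\sum_(x <- s) x * \1_(B x) (F w)) * f w).
    move=> fi; rewrite -ExZ; last exact: mulB.
    rewrite -ExD; first by apply: eq_Rintegral => w _; rewrite big_cons; ring.
      by apply: intgZ; exact: mulB.
    have [N hN] := H s B mB.
    by apply: (@intg_bddM _ _ _ _ _ _ N (mS s B mB)) => //; exact/aeW.
  by rewrite (E _ iG) (E _ itau) IH cond_indic.
have simple (h : {nnsfun R >-> R}) :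
    Ex (fun w => h (F w) * G w) = Ex (fun w => h (F w) * tau (F w)).
  have mB x : measurable (h @^-1` [set x]) by exact: measurable_sfunP.
  have E y : h y = \sum_(x <- finmap.enum_fset (fset_set (range h))) x * \1_(h @^-1` [set x]) y.
    by rewrite {1}(fimfunE h y) fsbig_finite//; exact: fimfunP.
  have Eg (f : T -> R) : Ex (fun w => h (F w) * f w) = Ex (fun w =>
      (\sum_(x <- finmap.enum_fset (fset_set (range h))) x * \1_(h @^-1` [set x]) (F w)) * f w).
    by apply: eq_Rintegral => w _; rewrite E.
  by rewrite !Eg sums.
have [h [hk ch]] := simple_approx mk (fun y => (andP (k0M y)).1).
have lim f : intg f -> Ex (fun w => h n (F w) * f w) @[n --> \oo] --> Ex (fun w => k (F w) * f w).
  move=> fi; have mf := intg_meas fi.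
  have [] // := @dominated_Ex _ _ _ nu (fun n w => h n (F w) * f w)
    (fun w => k (F w) * f w) (fun w => M * `|f w|).
  - move=> n; apply: measurable_funM => //; apply: measurableT_comp mF.
    exact: measurable_funPT.
  - by apply: measurable_funM => //; exact: measurableT_comp mk mF.
  - by apply: aeW => w; apply: cvgM; [exact: ch|exact: cvg_cst].
  - exact/intgZ/intg_norm.
  - apply: aeW => w n; rewrite normrM ler_wpM2r//.
    have /andP[a1 a2] := hk n (F w); rewrite ger0_norm// (le_trans a2)//.
    by have /andP[] := k0M (F w).
apply: (cvg_uniq (lim _ iG)).
under eq_fun do rewrite simple.
exact: lim.
Qed.

End conditional.

Section bounded_monotone.
Context d (T : measurableType d) (R : realType) (mu : {measure set T -> \bar R}).
Local Notation intg f := (mu.-integrable setT (EFin \o f)).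
Local Notation Ex f := (Rintegral mu setT f).

Lemma monotone_intg (f_ : nat -> T -> R) (f : T -> R) (C : R) :
  (forall n, intg (f_ n)) -> measurable_fun setT f ->
  (forall n w, 0 <= f_ n w) -> (forall w, nondecreasing_seq (fun n => f_ n w)) ->
  (forall w, f_ n w @[n --> \oo] --> f w) -> (forall n, Ex (f_ n) <= C) -> intg f.
Proof.
move=> fi mf f0 nd cf fC.
have f0' w : 0 <= f w.
  rewrite -(cvg_lim _ (cf w))//; apply: limr_ge; last exact: nearW.
  by apply/cvg_ex; eexists; exact: cf.
have E : (fun w => limn (fun n => (f_ n w)%:E)) = EFin \o f.
  apply/funext => w; apply: (cvg_lim (@ereal_hausdorff R)).
  by apply: cvg_EFin (cf w); exact: nearW.
apply/integrableP; split; first exact/measurable_EFinP.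
under eq_integral do rewrite gee0_abs ?lee_fin//.
apply: (@le_lt_trans _ _ C%:E); last exact: ltry.
have := @cvg_monotone_convergence _ _ _ mu setT measurableT (fun n => EFin \o f_ n).
rewrite E => h.
have {}h := h (fun n => measurable_int _ (fi n)) (fun n w _ => f0 n w : (0 <= (f_ n w)%:E)%E)
  (fun w _ m n mn => nd w m n mn : ((f_ m w)%:E <= (f_ n w)%:E)%E).
rewrite -(cvg_lim (@ereal_hausdorff R) h)//; apply: lime_le.
  by apply/cvg_ex; eexists; exact: h.
apply: nearW => n; rewrite -[leLHS]fineK; first by rewrite lee_fin; exact: fC.
exact: integrable_fin_num (fi n).
Qed.

End bounded_monotone.

Section inverse_tau.
Context d (T : measurableType d) (R : realType) (nu : probability T R).
Local Notation intg f := (nu.-integrable setT (EFin \o f)).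
Local Notation Ex f := (Rintegral nu setT f).
Context (F G : T -> R) (tau : R -> R).
Context (mF : measurable_fun setT F) (iG : intg G) (H2 : cond_exp_given nu G F tau).
Context (Gpos : {ae nu, forall w, 0 < G w}) (iV : intg (fun w => posinv (G w))).

Let mtau : measurable_fun setT tau. Proof. by case: H2. Qed.
Let itau : intg (tau \o F). Proof. by case: H2. Qed.
Let mG : measurable_fun setT G. Proof. exact: intg_meas iG. Qed.

(** For [B] the set where [tau <= 0], [E[1_B (F) * G] = E[1_B (F) * tau (F)]] is
    nonpositive although [G] is positive, so [F] avoids [B]. *)
Lemma tau_pos : {ae nu, forall w, 0 < tau (F w)}.
Proof.
pose B := tau @^-1` `]-oo, 0].
have mB : measurable B.
  by rewrite -[B]setTI; apply: mtau => //; exact: measurable_itv.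
have mBF : measurable_fun setT (fun w => \1_B (F w) : R).
  exact: measurableT_comp (measurable_indic mB) mF.
have iB (f : T -> R) : intg f -> intg (fun w => \1_B (F w) * f w).
  move=> fi; apply: (@intg_bddM _ _ _ _ _ _ 1) => //.
  by apply/aeW => w; exact: indic_le1.
have e := cond_indic H2 mB.
have p0 : {ae nu, forall w, 0 <= (\1_B (F w) : R) * G w}.
  apply: filterS Gpos => w g0; apply: mulr_ge0; last exact: ltW.
  by rewrite indicE.
have z : Ex (fun w => \1_B (F w) * G w) = 0.
  apply/eqP; rewrite eq_le (Ex_ge0 _ p0) ?andbT; last exact: measurable_funM.
  rewrite e -[leRHS](Ex_cst nu); apply: Ex_le; [exact: iB|exact: intg_cst|].
  apply: aeW => w; rewrite indicE; have [|] := boolP (F w \in B); rewrite ?mul0r//.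
  by rewrite inE /B /= in_itv/= mul1r.
have := Ex_eq0_ae (iB _ iG) p0 z; move: Gpos; apply: filterS2 => w g0.
rewrite indicE; have [|nB _] := boolP (F w \in B).
  by rewrite mul1r => _ G0; move: g0; rewrite G0 ltxx.
rewrite ltNge; apply/negP => tB; move/negP: nB; apply.
by rewrite inE /B /= in_itv.
Qed.

Local Notation g0 := (fun y => posinv (tau y)).
Local Notation k n := (fun y => Num.min (posinv (tau y)) n%:R).

Let mg0 : measurable_fun setT g0. Proof. exact: measurableT_comp (@posinv_meas R) mtau. Qed.

Let mk n : measurable_fun setT (k n).
Proof. by apply: measurable_minr => //; exact: measurable_cst. Qed.

Let k_ge0 n y : 0 <= k n y. Proof. by rewrite le_min posinv_ge0 ler0n. Qed.
Let k_le n y : k n y <= g0 y. Proof. by rewrite ge_min lexx. Qed.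
Let k_len n y : k n y <= n%:R. Proof. by rewrite ge_min lexx orbT. Qed.

Let mkF n : measurable_fun setT (fun w => k n (F w)).
Proof. exact: measurableT_comp (mk n) mF. Qed.

Let k_tau n y : 0 < tau y -> k n y * tau y <= 1.
Proof.
move=> t0; apply: (@le_trans _ _ (g0 y * tau y)).
  by rewrite ler_wpM2r// ltW.
by rewrite (posinv_pos t0) mulVf// gt_eqF.
Qed.

Let k_intg n (f : T -> R) : intg f -> intg (fun w => k n (F w) * f w).
Proof.
move=> fi; apply: (@intg_bddM _ _ _ _ _ _ n%:R) => //.
by apply: aeW => w; rewrite ger0_norm.
Qed.

Let k2_intg n (f : T -> R) : intg f -> intg (fun w => k n (F w) ^+ 2 * f w).
Proof.
move=> fi; apply: (@intg_bddM _ _ _ _ _ _ (n%:R ^+ 2)) => //.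
  exact: measurable_funX.
by apply: aeW => w; rewrite ger0_norm ?sqr_ge0// lerXn2r// nnegrE.
Qed.

Let ki n : intg (fun w => k n (F w)).
Proof. by have := k_intg n (intg_cst nu 1); under eq_fun do rewrite mulr1. Qed.

(** A conditional Jensen inequality.  Write [k] for the truncation of [1 / tau]
    at [n], taken at [F].  Then [E[k^2 * G] = E[k^2 * tau] <= E[k]] since
    [k * tau <= 1], while [2 k <= k^2 * G + 1 / G] by completing the square;
    together, [E[k^2 * G] <= E[k] <= E[1 / G]]. *)
Let k2_bound n : Ex (fun w => k n (F w) ^+ 2 * G w) <= Ex (fun w => posinv (G w)).
Proof.
have e : Ex (fun w => k n (F w) ^+ 2 * G w) = Ex (fun w => k n (F w) ^+ 2 * tau (F w)).
  apply: (@cond_mult _ _ _ nu F G tau mF iG H2 (fun y => k n y ^+ 2) (n%:R ^+ 2)).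
    exact: measurable_funX.
  by move=> y; rewrite sqr_ge0 lerXn2r// nnegrE.
have h1 : Ex (fun w => k n (F w) ^+ 2 * G w) <= Ex (fun w => k n (F w)).
  rewrite e; apply: Ex_le; [exact: k2_intg|exact: ki|].
  apply: filterS tau_pos => w t0; rewrite expr2 -mulrA.
  by rewrite ler_piMr// k_tau.
have h2 : Ex (fun w => 2 * k n (F w)) <= Ex (fun w => k n (F w) ^+ 2 * G w + posinv (G w)).
  apply: Ex_le; [exact/intgZ/ki|by apply: intgD => //; exact: k2_intg|].
  apply: filterS Gpos => w G0; rewrite (posinv_pos G0).
  rewrite -(@ler_pM2r _ (G w))// [leRHS]mulrDl mulVf ?gt_eqF//.
  by have := sqr_ge0 (k n (F w) * G w - 1); nra.
rewrite (ExZ _ (ki n)) (ExD (k2_intg n iG) iV) in h2.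
lra.
Qed.

Let k_cvg y : k n y @[n --> \oo] --> g0 y.
Proof. exact: min_cvg. Qed.

(** Monotone convergence in [k2_bound].  The weight is replaced by its positive
    part, equal to it almost surely, to have monotonicity everywhere. *)
Lemma inv_tau_sq : intg (fun w => g0 (F w) ^+ 2 * G w).
Proof.
have mgF : measurable_fun setT (fun w => g0 (F w)) by exact: measurableT_comp mg0 mF.
have i : intg (fun w => g0 (F w) ^+ 2 * Num.max (G w) 0).
  apply: (@monotone_intg _ _ _ nu (fun n w => k n (F w) ^+ 2 * Num.max (G w) 0) _
     (Ex (fun w => posinv (G w)))).
  - move=> n; apply: k2_intg; apply: (intg_ae_eq _ _ iG).
      by apply: measurable_maxr => //; exact: measurable_cst.
    by apply: filterS Gpos => w g; rewrite max_l// ltW.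
  - apply: measurable_funM; first exact: measurable_funX.
    by apply: measurable_maxr => //; exact: measurable_cst.
  - by move=> n w; rewrite mulr_ge0 ?sqr_ge0// le_max lexx orbT.
  - move=> w m n mn; rewrite ler_wpM2r ?le_max ?lexx ?orbT//.
    rewrite lerXn2r ?nnegrE// le_min ge_min lexx/= ge_min.
    by apply/orP; right; rewrite ler_nat.
  - move=> w; apply: cvgM; last exact: cvg_cst.
    by under eq_fun do rewrite expr2; rewrite expr2; apply: cvgM; exact: k_cvg.
  - move=> n; rewrite (@Ex_ae_eq _ _ _ nu _ (fun w => k n (F w) ^+ 2 * G w)) ?k2_bound//.
    + apply: measurable_funM; first exact: measurable_funX.
      by apply: measurable_maxr => //; exact: measurable_cst.
    + by apply: measurable_funM => //; exact: measurable_funX.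
    + by apply: filterS Gpos => w g; rewrite max_l// ltW.
apply: (intg_ae_eq _ _ i); first by apply: measurable_funM => //; exact: measurable_funX.
by apply: filterS Gpos => w g; rewrite max_l// ltW.
Qed.

(** The factor [1 / tau (F)] pulled out of the conditional expectation cancels
    [tau (F)]; as it is unbounded, it is first truncated at [n].  Domination uses
    [1 / tau <= 1 / tau^2 + 1]. *)
Lemma inv_tau_indic (B : set R) : measurable B ->
  Ex (fun w => g0 (F w) * \1_B (F w) * G w) = Ex (fun w => \1_B (F w)).
Proof.
move=> mB.
have mBF : measurable_fun setT (fun w => \1_B (F w) : R).
  exact: measurableT_comp (measurable_indic mB) mF.
have mgF : measurable_fun setT (fun w => g0 (F w)) by exact: measurableT_comp mg0 mF.
have B01 y : 0 <= (\1_B y : R) <= 1 by rewrite indicE; case: (_ \in _); rewrite /= ?lexx ?ler01.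
have B0 y : 0 <= (\1_B y : R) by case/andP: (B01 y).
have B1 y : (\1_B y : R) <= 1 by case/andP: (B01 y).
have e n : Ex (fun w => k n (F w) * \1_B (F w) * G w) =
    Ex (fun w => k n (F w) * \1_B (F w) * tau (F w)).
  apply: (@cond_mult _ _ _ nu F G tau mF iG H2 (fun y => k n y * \1_B y) n%:R).
    by apply: measurable_funM => //; exact: measurable_indic.
  move=> y; rewrite mulr_ge0//= -[leRHS]mulr1 ler_pM//.
have [] // := @dominated_Ex _ _ _ nu (fun n w => k n (F w) * \1_B (F w) * G w)
  (fun w => g0 (F w) * \1_B (F w) * G w) (fun w => g0 (F w) ^+ 2 * G w + G w).
- by move=> n; apply: measurable_funM => //; exact: measurable_funM.
- by apply: measurable_funM => //; exact: measurable_funM.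
- apply: aeW => w; apply: cvgM; last exact: cvg_cst.
  by apply: cvgM; [exact: k_cvg|exact: cvg_cst].
- by apply: intgD => //; exact: inv_tau_sq.
- apply: filterS Gpos => w g n; rewrite ger0_norm; last first.
    by rewrite !mulr_ge0// ltW.
  rewrite -[X in _ + X]mul1r -mulrDl; apply: ler_wpM2r; first exact: ltW.
  apply: (@le_trans _ _ (g0 (F w))).
    by rewrite -[leRHS]mulr1 ler_pM.
  by have := sqr_ge0 (g0 (F w) - 1); have := posinv_ge0 (tau (F w)); nra.
move=> _ c1 _.
have [] // := @dominated_Ex _ _ _ nu (fun n w => k n (F w) * \1_B (F w) * tau (F w))
  (fun w => \1_B (F w)) (fun w => 1).
- move=> n; apply: measurable_funM; first exact: measurable_funM.
  exact: measurableT_comp mtau mF.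
- apply: filterS tau_pos => w t0.
  have e1 : g0 (F w) * \1_B (F w) * tau (F w) = \1_B (F w) :> R.
    by rewrite (posinv_pos t0) mulrAC mulVf ?mul1r// gt_eqF.
  have h : k n (F w) * \1_B (F w) * tau (F w) @[n --> \oo] -->
      g0 (F w) * \1_B (F w) * tau (F w).
    apply: cvgM; last exact: cvg_cst.
    by apply: cvgM; [exact: k_cvg|exact: cvg_cst].
  by rewrite e1 in h.
- exact: intg_cst.
- apply: filterS tau_pos => w t0 n; rewrite ger0_norm; last first.
    by rewrite !mulr_ge0// ltW.
  by rewrite mulrAC mulr_ile1 ?k_tau// mulr_ge0// ltW.
move=> _ c2 _; apply: (cvg_uniq c1).
by under eq_fun do rewrite e.
Qed.

End inverse_tau.

(** * The primitive of the inverse of the conditional expectation *)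

Section primitive_split.
Context (R : realType).
Local Notation mu := (@lebesgue_measure R).
Local Notation intg f := (mu.-integrable setT (EFin \o f)).
Local Notation Ix f := (Rintegral mu setT f).
Context (tau : R -> R) (mtau : measurable_fun setT tau).
Local Notation gp := (fun y => posinv (tau y)).
Local Notation gm := (fun y => posinv (- tau y)).

Let mgp : measurable_fun setT gp.
Proof. exact: measurableT_comp (@posinv_meas R) mtau. Qed.

Let mgm : measurable_fun setT gm.
Proof.
apply: (measurableT_comp (@posinv_meas R)); exact: measurableT_comp mtau.
Qed.

Lemma inv_tauE y : tau y != 0 -> inv_tau tau y = (gp y - gm y)%:E.
Proof.
move=> n0; rewrite /inv_tau inver (negbTE n0); congr (_%:E).
have [t0|t0] := ltP 0 (tau y).
  by rewrite (posinv_pos t0) posinv_neg ?subr0// oppr_le0 ltW.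
rewrite (posinv_neg t0) posinv_pos ?invrN ?sub0r ?opprK// oppr_gt0.
by rewrite lt_neqAle n0.
Qed.

Let le_inv (s y : R) : s = tau y \/ s = - tau y -> ((posinv s)%:E <= `|inv_tau tau y|)%E.
Proof.
move=> hs; rewrite /inv_tau inver; case: eqVneq => [t0|n0]; first exact: leey.
rewrite /= lee_fin; have [s0|s0] := ltP 0 s; last by rewrite posinv_neg.
rewrite (posinv_pos s0) normfV lef_pV2 ?posrE ?normr_gt0//.
by case: hs s0 => -> s0; [rewrite gtr0_norm|rewrite -normrN gtr0_norm].
Qed.

Let oriented_itv (a x y : R) : `|oriented a x y| <= \1_(`[Num.min a x, Num.max a x]) y.
Proof.
have [ax|/ltW xa] := leP a x.
- rewrite (oriented_le _ ax) ger0_norm// !indicE ler_nat.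
  case: (boolP (y \in `]a, x]%classic)) => // yi; rewrite mem_set//=.
  by move: yi; rewrite inE/= !in_itv/= => /andP[/ltW -> ->].
- rewrite (oriented_ge _ xa) normrN ger0_norm// !indicE ler_nat.
  case: (boolP (y \in `]x, a]%classic)) => // yi; rewrite mem_set//=.
  by move: yi; rewrite inE/= !in_itv/= => /andP[/ltW -> ->].
Qed.

Let oriented_intg2 (s : R -> R) (a x : R) : measurable_fun setT s -> (forall y, 0 <= s y) ->
  (forall y, ((s y)%:E <= `|inv_tau tau y|)%E) -> primitive_defined tau a x ->
  intg (fun y => s y * oriented a x y).
Proof.
move=> ms s0 sle H0; have mI : measurable (`[Num.min a x, Num.max a x]%classic : set (measurableTypeR R)) by exact: measurable_itv.
have H := (integrable_mkcond _ mI).1 H0.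
apply: (le_integrable measurableT _ _ H).
  by apply/measurable_EFinP/measurable_funM => //; exact: oriented_meas.
move=> y _; rewrite patchE.
have := oriented_itv a x y; rewrite indicE; case: ifPn => [_ c1|_ c0].
  apply: le_trans (sle y); rewrite /= lee_fin normrM ger0_norm//.
  by rewrite ler_piMr.
have e : oriented a x y = 0 by apply/eqP; rewrite -normr_le0.
by rewrite /= e mulr0 normr0.
Qed.

Let itv_split (c b : R) : c <= b -> mu.-integrable `[c, b] (inv_tau tau) ->
  fine (\int[mu]_(y in `[c, b]) inv_tau tau y) =
  Ix (fun y => (gp y - gm y) * \1_(`]c, b]) y).
Proof.
move=> cb H.
have mI : measurable (`[c, b]%classic : set (measurableTypeR R)) by exact: measurable_itv.
have mD : measurable_fun setT (fun y => gp y - gm y) by exact: measurable_funB.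
have ae1 : inv_tau tau = (EFin \o (fun y => gp y - gm y)) %[ae mu in `[c, b]%classic].
  have := integrable_ae mI H; apply: filterS => y h /h.
  rewrite /inv_tau inver; case: eqVneq => // n0 _.
  by have := inv_tauE n0; rewrite /inv_tau inver (negbTE n0).
have mE : measurable_fun `[c, b]%classic (EFin \o (fun y => gp y - gm y)).
  by apply/measurable_EFinP; exact: measurable_funTS.
have iD : mu.-integrable `[c, b] (EFin \o (fun y => gp y - gm y)).
  apply/integrableP; split; first exact: mE.
  have /integrableP[mi] := H; apply: le_lt_trans.
  rewrite le_eqVlt; apply/orP; left; apply/eqP; apply: ae_eq_integral => //.
  - apply: measurableT_comp => //; exact: mE.
  - exact: measurableT_comp.
  - exact/ae_eq_sym/(ae_eq_abse ae1).
transitivity (\int[mu]_(y in `[c, b]) (gp y - gm y)).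
  congr fine; apply: ae_eq_integral => //.
  by have /integrableP[] := H.
rewrite -Rintegral_itv_obnd_cbnd; last first.
  apply: (integrableS mI _ _ iD); first exact: measurable_itv.
  by apply: subset_itvr; rewrite bnd_simp.
rewrite Rintegral_mkcond; apply: eq_Rintegral => y _.
by rewrite patchE indicE; case: ifP; rewrite ?mulr1 ?mulr0.
Qed.

(** Integrability of [1 / tau] on the interval excludes zeros of [tau] up to a
    null set, and makes the positive and negative parts of [1 / tau] separately
    integrable. *)
Lemma primitive_split a x : primitive_defined tau a x ->
  [/\ intg (fun y => gp y * oriented a x y), intg (fun y => gm y * oriented a x y)
    & primitive_inv tau a x = prim a gp x - prim a gm x].
Proof.
move=> H.
have ip : intg (fun y => gp y * oriented a x y).
  by apply: oriented_intg2 => // y; [exact: posinv_ge0|apply: le_inv; left].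
have im : intg (fun y => gm y * oriented a x y).
  by apply: oriented_intg2 => // y; [exact: posinv_ge0|apply: le_inv; right].
split => //.
rewrite /prim -ExB// /primitive_inv /oriented_integral.
move: H; rewrite /primitive_defined; have [ax|xa] := leP a x => H.
  rewrite itv_split//; apply: eq_Rintegral => y _.
  by rewrite (oriented_le _ ax); ring.
have xa' := ltW xa; rewrite fineN itv_split// -mulN1r -ExZ.
  by apply: eq_Rintegral => y _; rewrite (oriented_ge _ xa'); ring.
have := intgB im ip; congr (_.-integrable _ (_ \o _)).
by apply/funext => y; rewrite (oriented_ge _ xa'); ring.
Qed.

(** The second assertion holds because the two primitives have the same sign,
    the approximating one being the smaller in absolute value; it dominates the errors by a function that does
    not depend on [n]. *)
Lemma prim_mono (a : R) (h : nat -> R -> R) (g : R -> R) (x : R) :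
  (forall n, measurable_fun setT (h n)) -> measurable_fun setT g ->
  (forall n y, 0 <= h n y <= g y) -> (forall y, h n y @[n --> \oo] --> g y) ->
  intg (fun y => g y * oriented a x y) ->
  prim a (h n) x @[n --> \oo] --> prim a g x /\
  (forall n, `|prim a g x - prim a (h n) x| <= `|prim a g x|).
Proof.
move=> mh mg hg ch ig; split.
  have [] // := @dominated_Ex _ _ _ mu (fun n y => h n y * oriented a x y)
    (fun y => g y * oriented a x y) (fun y => `|g y * oriented a x y|).
  - by move=> n; exact: (measurable_funM (mh n) (oriented_meas a x)).
  - exact: (measurable_funM mg (oriented_meas a x)).
  - by apply: aeW => y; apply: cvgM; [exact: ch|exact: cvg_cst].
  - exact: intg_norm.
  - apply: aeW => y n; rewrite !normrM ler_wpM2r//.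
    have /andP[h0 hle] := hg n y; rewrite ger0_norm// ger0_norm//.
    exact: le_trans hle.
move=> n.
have ih : intg (fun y => h n y * oriented a x y).
  apply: (@intg_dom _ _ _ mu _ (fun y => `|g y * oriented a x y|)).
  - exact: (measurable_funM (mh n) (oriented_meas a x)).
  - apply: aeW => y; rewrite !normrM ler_wpM2r//.
    have /andP[h0 hle] := hg n y; rewrite ger0_norm// ger0_norm//.
    exact: le_trans hle.
  - exact: intg_norm.
have [ax|/ltW xa] := leP a x.
- have c0 y : 0 <= oriented a x y by rewrite (oriented_le _ ax).
  have p0 : 0 <= prim a (h n) x.
    by apply: Rintegral_ge0 => y _; rewrite mulr_ge0//; case/andP: (hg n y).
  have p1 : prim a (h n) x <= prim a g x.
    by apply: Ex_le => //; apply: aeW => y; rewrite ler_wpM2r//; case/andP: (hg n y).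
  by rewrite !ger0_norm; lra.
- have c0 y : oriented a x y <= 0 by rewrite (oriented_ge _ xa) oppr_le0.
  have p0 : prim a (h n) x <= 0.
    rewrite -oppr_ge0 -mulN1r -ExZ//; apply: Rintegral_ge0 => y _.
    rewrite mulN1r oppr_ge0 mulr_ge0_le0//; by case/andP: (hg n y).
  have p1 : prim a g x <= prim a (h n) x.
    by apply: Ex_le => //; apply: aeW => y; rewrite ler_wnM2r//; case/andP: (hg n y).
  by rewrite !ler0_norm; lra.
Qed.

End primitive_split.

Section assembly.
Context d (T : measurableType d) (R : realType) (nu : probability T R)
  (A A0 : set (T -> R)) (Gam : (T -> R) -> (T -> R) -> (T -> R))
  (L : (T -> R) -> (T -> R)) (HM : full_markov_triple nu A A0 Gam L).
Local Notation intg f := (nu.-integrable setT (EFin \o f)).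
Local Notation Ex f := (Rintegral nu setT f).
Local Notation DomE := (DomE nu A0 Gam).
Context (F : T -> R) (HF : DomE F) (tau : R -> R) (a : R).
Local Notation GF := (Gam F F).
Local Notation has_deriv := (has_deriv nu A0 Gam F).
Local Notation gp := (fun y => posinv (tau y)).
Local Notation gm := (fun y => posinv (- tau y)).
Context (H2 : cond_exp_given nu GF F tau).
Context (Gpos : {ae nu, forall w, 0 < GF w}) (iV : intg (fun w => posinv (GF w))).
Context (Hdef : {ae nu, forall w, primitive_defined tau a (F w)}).
Import HBNNSimple.

Let mF : measurable_fun setT F. Proof. exact: (DomE_meas HM HF). Qed.
Let Gi : intg GF. Proof. exact: (DomE_Gam_intg HM). Qed.
Let mtau : measurable_fun setT tau. Proof. by case: H2. Qed.

Let mgp : measurable_fun setT gp.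
Proof. exact: measurableT_comp (@posinv_meas R) mtau. Qed.

Let mgm : measurable_fun setT gm.
Proof.
apply: (measurableT_comp (@posinv_meas R)); exact: measurableT_comp mtau.
Qed.

Let simple_deriv (h : {nnsfun R >-> R}) : has_deriv (prim a h \o F) (h \o F).
Proof. by case: (prim_rule_nnsfun HM HF (prim_rule_ray HM HF a) h). Qed.

Let simple_meas (h : {nnsfun R >-> R}) : measurable_fun setT (h : R -> R).
Proof. exact: measurable_funPT. Qed.

(** Since [tau (F)] is positive, simple functions below the negative part of
    [1 / tau] vanish at [F].  Their primitives at [F] therefore have zero energy
    and are constant by [null_energy_cst]; so is the limit. *)
Lemma prim_neg_cst : exists c : R, {ae nu, forall w, prim a gm (F w) = c}.
Proof.
have [h [hg ch]] := simple_approx mgm (fun y => posinv_ge0 (- tau y)).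
have tpos := tau_pos mF Gi H2 Gpos.
have /choice[c hc] : forall n, exists c : R, {ae nu, forall w, prim a (h n) (F w) = c}.
  move=> n; have [DX qX] := has_deriv_q HM HF (simple_deriv (h n)).
  apply: (null_energy_cst HM DX); rewrite qX -[RHS](Ex_cst nu).
  apply: Ex_ae_eq => //.
  - apply: measurable_funM; last exact: intg_meas Gi.
    by apply: measurable_funX; exact: measurableT_comp (simple_meas (h n)) mF.
  - apply: filterS tpos => w t0.
    have /andP[h0] := hg n (F w); rewrite posinv_neg; last by rewrite oppr_le0 ltW.
    by move=> h1; rewrite /= (_ : h n (F w) = 0) ?expr0n ?mul0r//; apply/eqP; rewrite eq_le h1.
exists (limn c).
have hc' : {ae nu, forall w, forall n, prim a (h n) (F w) = c n} by exact: ae_foralln.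
move: hc' Hdef; apply: filterS2 => w e /(primitive_split mtau)[_ im _].
have [cv _] := prim_mono (fun n => simple_meas (h n)) mgm hg ch im.
rewrite -(cvg_lim _ cv)//.
by rewrite (_ : (fun n => prim a (h n) (F w)) = c)//; apply/funext.
Qed.

(** With simple functions [h n] tending from below to the positive part of
    [1 / tau], the primitives of [h n] at [F], shifted by the constant [c] of [prim_neg_cst],
    tend to [f0 (F)] with error at most [`|f0 (F) + c|], which is in [L^2]; the
    derivatives converge thanks to [inv_tau_sq]. *)
Lemma has_deriv_primitive : DomE (primitive_inv tau a \o F) ->
  has_deriv (primitive_inv tau a \o F) (gp \o F).
Proof.
move=> DX; have mX := DomE_meas HM DX; have X2 := DomE_sq HM DX.
have [c hc] := prim_neg_cst.
have [h [hg ch]] := simple_approx mgp (fun y => posinv_ge0 (tau y)).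
have mgF : measurable_fun setT (gp \o F) by exact: measurableT_comp mgp mF.
have mhF n : measurable_fun setT (h n \o F) by exact: measurableT_comp (simple_meas (h n)) mF.
have mpF n : measurable_fun setT (prim a (h n) \o F) by case: (simple_deriv (h n)).
have hX n : has_deriv (fun w => 1 * prim a (h n) (F w) - c) (fun w => 1 * h n (F w) + 0).
  exact: (has_deriv_lin HM HF 1 (simple_deriv (h n)) (has_deriv_chain HM HF (chain_cst HM (- c)))).
have main : {ae nu, forall w, primitive_inv tau a (F w) + c = prim a gp (F w) /\
   (prim a (h n) (F w) @[n --> \oo] --> prim a gp (F w) /\
    forall n, `|prim a gp (F w) - prim a (h n) (F w)| <= `|prim a gp (F w)|)}.
  move: hc Hdef; apply: filterS2 => w e /(primitive_split mtau)[ip _ ->].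
  by rewrite e subrK; split => //; apply: prim_mono.
have iD : intg (fun w => (primitive_inv tau a (F w) + c) ^+ 2).
  by apply: (intg_sqD mX) => //; exact: intg_cst.
have isq := inv_tau_sq mF Gi H2 Gpos iV.
have mD n : measurable_fun setT
    (fun w => (primitive_inv tau a (F w) - (1 * prim a (h n) (F w) - c)) ^+ 2).
  apply: measurable_funX; apply: measurable_funB => //; apply: measurable_funB => //.
  by apply: measurable_funM => //; exact: mpF.
have mG n : measurable_fun setT (fun w => (gp (F w) - (1 * h n (F w) + 0)) ^+ 2 * GF w).
  apply: measurable_funM; last exact: intg_meas Gi.
  apply: measurable_funX; apply: measurable_funB => //; apply: measurable_funD => //.
  by apply: measurable_funM => //; exact: mhF.
have bD : {ae nu, forall w n,
    `|(primitive_inv tau a (F w) - (1 * prim a (h n) (F w) - c)) ^+ 2|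
     <= (primitive_inv tau a (F w) + c) ^+ 2}.
  move: main; apply: filterS => w [e [_ b]] n.
  rewrite (_ : _ - (_ - c) = prim a gp (F w) - prim a (h n) (F w)); last first.
    by rewrite -e; ring.
  rewrite e ger0_norm ?sqr_ge0// -real_normK ?num_real// -[leRHS]real_normK ?num_real//.
  by rewrite lerXn2r ?nnegrE.
have bG : {ae nu, forall w n, `|(gp (F w) - (1 * h n (F w) + 0)) ^+ 2 * GF w|
     <= gp (F w) ^+ 2 * GF w}.
  apply: filterS Gpos => w g n; have /andP[h0 h1] := hg n (F w).
  rewrite ger0_norm; last by rewrite mulr_ge0 ?sqr_ge0// ltW.
  apply: ler_wpM2r; first exact: ltW.
  by rewrite mul1r addr0 lerXn2r ?nnegrE ?subr_ge0 ?posinv_ge0// gerBl.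
apply: (has_deriv_limit HM HF mX mgF hX).
- move=> n; apply: (intg_dom (mD n) _ iD).
  by move: bD; apply: filterS => w; exact.
- move=> n; apply: (intg_dom (mG n) _ isq).
  by move: bG; apply: filterS => w; exact.
- have [] := @dominated_Ex _ _ _ nu (fun n w =>
    (primitive_inv tau a (F w) - (1 * prim a (h n) (F w) - c)) ^+ 2)
    (fun=> 0) _ mD (measurable_cst _) _ iD bD.
    move: main; apply: filterS => w [e [cv _]].
    under eq_fun => n.
      rewrite (_ : _ - (_ - c) = prim a gp (F w) - prim a (h n) (F w)); last first.
        by rewrite -e; ring.
      over.
    exact: sqrB_cvg0.
  by move=> _ + _; rewrite Ex_cst.
- have [] := @dominated_Ex _ _ _ nu (fun n w =>
    (gp (F w) - (1 * h n (F w) + 0)) ^+ 2 * GF w)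
    (fun=> 0) _ mG (measurable_cst _) _ isq bG.
    apply: aeW => w.
    rewrite (_ : (fun n => _) = (fun n => (gp (F w) - h n (F w)) ^+ 2 * GF w)).
      rewrite -[0](mul0r (GF w)); apply: cvgM; last exact: cvg_cst.
      by apply: sqrB_cvg0; exact: ch.
    by apply/funext => n; rewrite mul1r addr0.
  by move=> _ + _; rewrite Ex_cst.
Qed.

End assembly.

(** * From primitives of indicators to a density *)

Section fubini_tail.
Context d (T : measurableType d) (R : realType) (nu : probability T R).
Local Notation intg f := (nu.-integrable setT (EFin \o f)).
Local Notation Ex f := (Rintegral nu setT f).
Local Notation mu := (@lebesgue_measure R).
Local Notation Ix f := (Rintegral mu setT f).
Context (F h : T -> R) (mF : measurable_fun setT F) (ih : intg h).
Local Notation R' := (measurableTypeR R).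
Implicit Types (B : set R) (a y : R).

Let mh : measurable_fun setT h. Proof. exact: intg_meas ih. Qed.

Let mtail : measurable_fun setT (fun z : T * R' => ((z.2 <= F z.1)%R : bool)%:R : R).
Proof.
rewrite (_ : (fun _ => _) =
  (fun z : T * R' => if (z.2 <= F z.1)%R then 1 else 0 : R)); last first.
  by apply/funext => z; case: ifP.
apply: measurable_fun_ifT => //.
apply: measurable_fun_ler; first exact: measurable_snd.
exact: measurableT_comp mF (@measurable_fst _ _ _ _).
Qed.

Let mtail1 a : measurable_fun setT (fun y : R' => ((y <= a)%R : bool)%:R : R).
Proof.
rewrite (_ : (fun _ => _) = (\1_(`]-oo, a]) : R -> R)).
  by apply: measurable_indic; exact: measurable_itv.
by apply/funext => y; rewrite indicE mem_setE in_itv.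
Qed.

Lemma tailE y w : \1_[set v | y <= F v] w = (y <= F w)%R%:R :> R.
Proof.
rewrite indicE; suff -> : (w \in [set v | (y <= F v)%R]) = (y <= F w)%R by [].
by apply/idP/idP; rewrite inE.
Qed.

Lemma orientedE a x y : oriented a x y = (y <= x)%R%:R - (y <= a)%R%:R.
Proof. by rewrite /oriented !indicE !mem_setE !in_itv. Qed.

Lemma oriented_norm_le1 a x y : `|oriented a x y| <= 1.
Proof.
rewrite orientedE; case: (y <= x)%R; case: (y <= a)%R;
  by rewrite ?subrr ?subr0 ?sub0r ?normrN ?normr0 ?normr1.
Qed.

Lemma tail_indic_meas y : measurable_fun setT (fun w => (y <= F w)%R%:R : R).
Proof.
rewrite (_ : (fun w => _) = (fun w => \1_(`[y, +oo[) (F w))).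
  by apply: measurableT_comp mF; apply: measurable_indic; exact: measurable_itv.
by apply/funext => w; rewrite indicE mem_setE in_itv/= andbT.
Qed.

Lemma tail_intg y k : intg k -> intg (fun w => (y <= F w)%R%:R * k w).
Proof.
move=> ik; apply: (@intg_bddM _ _ _ _ _ _ 1) => //; first exact: tail_indic_meas.
by apply: aeW => w; case: (y <= F w)%R; rewrite ?normr1 ?normr0.
Qed.

Lemma tail_meas : measurable_fun setT (fun y => Ex (fun w => (y <= F w)%R%:R * h w)).
Proof.
have nn (k : T -> R) : measurable_fun setT k -> (forall w, 0 <= k w) ->
    measurable_fun setT (fun y : R => fine (\int[nu]_w ((y <= F w)%R%:R * k w)%:E)).
  move=> mk k0; apply: (measurableT_comp (f := fine)) => //.
  apply: (@measurable_fun_fubini_tonelli_G _ _ T R' R nu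
    (fun z => ((z.2 <= F z.1)%R%:R * k z.1)%:E)).
    apply/measurable_EFinP; apply: measurable_funM => //.
    exact: measurableT_comp mk (@measurable_fst _ _ _ _).
  by move=> z; rewrite lee_fin mulr_ge0.
have mp : measurable_fun setT (fun w => Num.max (h w) 0).
  by apply: measurable_maxr => //; exact: measurable_cst.
have mn : measurable_fun setT (fun w => Num.max (- h w) 0).
  by apply: measurable_maxr; [exact: measurableT_comp|exact: measurable_cst].
have p0 x : 0 <= Num.max x 0 :> R by rewrite le_max lexx orbT.
have := measurable_funB (nn _ mp (fun w => p0 _)) (nn _ mn (fun w => p0 _)).
congr measurable_fun; apply/funext => y /=.
have ip : intg (fun w => Num.max (h w) 0).
  apply: intg_dom mp _ (intg_norm ih); apply: aeW => w.
  by rewrite ger0_norm// ge_max ler_norm normr_ge0.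
have im : intg (fun w => Num.max (- h w) 0).
  apply: intg_dom mn _ (intg_norm ih); apply: aeW => w.
  by rewrite ger0_norm// ge_max normr_ge0 andbT -normrN ler_norm.
rewrite -[RHS]/(Ex _) -(@ExB _ _ _ nu) //; [|exact: tail_intg|exact: tail_intg].
apply: eq_Rintegral => w _; rewrite -mulrBr; congr (_ * _).
have [h0|h0] := leP 0 (h w).
  have hn : - h w <= 0 by rewrite oppr_le0.
  by rewrite (max_r hn) subr0.
have hn : 0 <= - h w by rewrite oppr_ge0 ltW.
by rewrite (max_l hn) sub0r opprK.
Qed.

Lemma prim_fubini a B : measurable B -> (mu B < +oo)%E ->
  Ex (fun w => prim a \1_B (F w) * h w) =
  Ix (fun y => \1_B y * Ex (fun w => oriented a (F w) y * h w)).
Proof.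
move=> mB Bfin.
pose Phi (z : T * R') : R := \1_B z.2 * (oriented a (F z.1) z.2 * h z.1).
have mPhi : measurable_fun setT Phi.
  apply: measurable_funM.
    exact: measurableT_comp (measurable_indic mB) (@measurable_snd _ _ _ _).
  apply: measurable_funM; last exact: measurableT_comp mh (@measurable_fst _ _ _ _).
  rewrite (_ : (fun z => _) =
    (fun z : T * R' => ((z.2 <= F z.1)%R : bool)%:R - ((z.2 <= a)%R : bool)%:R : R)).
    apply: measurable_funB; first exact: mtail.
    exact: measurableT_comp (mtail1 a) (@measurable_snd _ _ _ _).
  by apply/funext => z; rewrite orientedE.
have iB : mu.-integrable setT (EFin \o \1_B).
  apply/integrableP; split; first by apply/measurable_EFinP; exact: measurable_indic.
  under eq_integral do rewrite gee0_abs ?lee_fin//.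
  by rewrite integral_indic// setIT.
have iPhi : (nu \x mu)%E.-integrable setT (EFin \o Phi).
  apply/integrable12ltyP; first exact/measurable_EFinP.
  apply: (@le_lt_trans _ _ (\int[nu]_w ((`|h w|)%:E * mu B))%E).
    apply: ge0_le_integral => //.
    - by move=> w _; exact: integral_ge0.
    - have mA : measurable_fun setT (abse \o (EFin \o Phi)).
        by apply: measurableT_comp => //; exact/measurable_EFinP.
      have A0 z : (0 <= (abse \o (EFin \o Phi)) z)%E by rewrite /= lee_fin.
      exact: (@measurable_fun_fubini_tonelli_F _ _ T R' R mu _ mA A0).
    - apply: emeasurable_funM; last exact: measurable_cst.
      by apply/measurable_EFinP; exact: measurableT_comp.
    - move=> w _; rewrite -[mu B]mule1.
      rewrite (_ : (mu B * 1 = \int[mu]_y (\1_B y)%:E)%E); last first.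
        by rewrite integral_indic// setIT mule1.
      rewrite -ge0_integralZl//; last first.
        by apply/measurable_EFinP; exact: measurable_indic.
      apply: ge0_le_integral => //.
      + apply: (@measurableT_comp _ _ _ _ _ _ (abse \o (EFin \o Phi)) _ (fun y : R' => (w, y))).
          by apply: measurableT_comp => //; exact/measurable_EFinP.
        exact: pair1_measurable.
      + apply: measurable_funeM; apply/measurable_EFinP; exact: measurable_indic.
      + move=> y _; rewrite -EFinM lee_fin /Phi /= !normrM (ger0_norm (_ : 0 <= \1_B y))//.
        rewrite [leRHS]mulrC ler_wpM2l// ler_piMl// oriented_norm_le1//.
  rewrite ge0_integralZr//; last by apply/measurable_EFinP; apply: measurableT_comp.
  have hl : (\int[nu]_w (`|h w|)%:E < +oo)%E by have /integrableP[_] := ih.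
  have h0 : (0 <= \int[nu]_w (`|h w|)%:E)%E by exact: integral_ge0.
  by apply: lte_mul_pinfty => //; rewrite ge0_fin_numE.
have iy w : mu.-integrable setT (EFin \o (fun y => \1_B y * oriented a (F w) y)).
  apply: (@intg_bddM _ _ _ mu _ _ 1); [exact: measurable_indic| |exact: oriented_intg].
  by apply: aeW => y; exact: indic_le1.
have inner w : (\int[mu]_y (Phi (w, y))%:E = (prim a \1_B (F w) * h w)%:E)%E.
  rewrite /prim EFinM fineK; last exact: integrable_fin_num (iy w).
  rewrite -integralZr//; last exact: iy.
  by apply: eq_integral => y _; rewrite -EFinM /Phi /= mulrA.
have iw y : intg (fun w => oriented a (F w) y * h w).
  apply: (@intg_bddM _ _ _ _ _ _ 1) => //; last first.
    by apply: aeW => w; exact: oriented_norm_le1.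
  rewrite (_ : (fun w => _) = (fun w => \1_(`[y, +oo[) (F w) - (y <= a)%R%:R)).
    apply: measurable_funB; last exact: measurable_cst.
    by apply: measurableT_comp mF; apply: measurable_indic; exact: measurable_itv.
  by apply/funext => w; rewrite orientedE indicE mem_setE in_itv/= andbT.
have inner2 y : (\int[nu]_w (Phi (w, y))%:E = (\1_B y * Ex (fun w => oriented a (F w) y * h w))%:E)%E.
  rewrite EFinM fineK; last exact: integrable_fin_num (iw y).
  by rewrite -integralZl//; exact: iw.
congr fine.
transitivity (\int[nu]_w \int[mu]_y (Phi (w, y))%:E)%E.
  by apply: eq_integral => w _; rewrite inner.
transitivity (\int[mu]_y \int[nu]_w (Phi (w, y))%:E)%E; first exact: (Fubini iPhi).
by apply: eq_integral => y _; rewrite inner2.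
Qed.

End fubini_tail.

Section tail_density.
Context d (T : measurableType d) (R : realType) (nu : probability T R).
Local Notation intg f := (nu.-integrable setT (EFin \o f)).
Local Notation Ex f := (Rintegral nu setT f).
Local Notation mu := (@lebesgue_measure R).
Local Notation Ix f := (Rintegral mu setT f).
Context (F h : T -> R) (a : R) (mF : measurable_fun setT F) (ih : intg h).
Context (h0 : Ex h = 0).
Context (Hprim : forall B : set R, measurable B ->
  Ex (fun w => prim a \1_B (F w) * h w) = - Ex (fun w => \1_B (F w))).
Local Notation p := (fun y : R => - Ex (fun w => (y <= F w)%R%:R * h w)).

Let mh : measurable_fun setT h. Proof. exact: intg_meas ih. Qed.

Let mle (y : R) : measurable_fun setT (fun w => (y <= F w)%R%:R : R).
Proof. exact: tail_indic_meas. Qed.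

Let b01 (b : bool) : `|b%:R : R| <= 1.
Proof. by case: b; rewrite ?normr1 ?normr0. Qed.

Let ile (y : R) : intg (fun w => (y <= F w)%R%:R * h w).
Proof. exact: tail_intg. Qed.

Let mp : measurable_fun setT p.
Proof. by apply: measurableT_comp => //; exact: tail_meas. Qed.

Let p_bdd (y : R) : `|p y| <= Ex (fun w => `|h w|).
Proof.
rewrite normrN; apply: (le_trans (Ex_norm (ile y))).
apply: Ex_le; [exact: intg_norm|exact: intg_norm|].
by apply: aeW => w; rewrite normrM ler_piMl.
Qed.

Let iB (B : set R) : measurable B -> (mu B < +oo)%E -> mu.-integrable setT (EFin \o \1_B).
Proof.
move=> mB Bfin; apply/integrableP; split.
  by apply/measurable_EFinP; exact: measurable_indic.
under eq_integral do rewrite gee0_abs ?lee_fin//.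
by rewrite integral_indic// setIT.
Qed.

Let iBp (B : set R) : measurable B -> (mu B < +oo)%E ->
  mu.-integrable setT (EFin \o (fun y => p y * \1_B y)).
Proof.
move=> mB Bfin; apply: (@intg_bddM _ _ _ mu _ _ (Ex (fun w => `|h w|)) mp).
  exact: aeW.
exact: iB.
Qed.

Let oriented_p (y : R) : Ex (fun w => oriented a (F w) y * h w) = - p y.
Proof.
transitivity (Ex (fun w => (y <= F w)%R%:R * h w - (y <= a)%R%:R * h w)).
  by apply: eq_Rintegral => w _; rewrite orientedE; ring.
rewrite ExB//; last exact: intgZ.
by rewrite ExZ// h0 mulr0 subr0 opprK.
Qed.

Let dens_fin (B : set R) : measurable B -> (mu B < +oo)%E ->
  Ix (fun y => p y * \1_B y) = Ex (fun w => \1_B (F w)).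
Proof.
move=> mB Bfin; have e := prim_fubini mF ih a mB Bfin.
rewrite Hprim// in e; rewrite -[RHS]opprK e -mulN1r -ExZ.
  by apply: eq_Rintegral => y _; rewrite oriented_p; ring.
have := intgZ (-1) (iBp mB Bfin); congr (_.-integrable _ (_ \o _)).
by apply/funext => y; rewrite oriented_p; ring.
Qed.

Let Ix_itv (x e : R) : 0 <= e -> Ix \1_(`]x - e, x]) = e.
Proof.
move=> e0; rewrite /Rintegral integral_indic// setIT.
rewrite [X in fine X]lebesgue_measure_itv/= lte_fin; case: ltP => //= h1; first by ring.
by apply/eqP; rewrite eq_le e0; lra.
Qed.

(** Nonnegativity at every [x], not just almost everywhere.  The primitive of the
    indicator of [`]x - e, x]] from the left, divided by [e], is a bounded
    function of [F] that tends to [1_(x <= F)] as [e] tends to 0, and its product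
    with [h] has expectation [- nu (x - e < F <= x) / e <= 0]. *)
Lemma tail_ge0 (x : R) : 0 <= p x.
Proof.
pose e (n : nat) : R := n.+1%:R^-1.
have e0 n : 0 < e n by rewrite invr_gt0.
have e1 n : e n <= 1 by rewrite invf_le1// ler1n.
pose B n : set R := `]x - e n, x]%classic.
have mB n : measurable (B n) by exact: measurable_itv.
(* a base point to the left of all the intervals [B n] *)
pose b := x - 1.
pose f n w := (e n)^-1 * prim b \1_(B n) (F w).
have mI n : measurable_fun setT (\1_(B n) : R -> R) by exact: measurable_indic.
have shift n z : prim b \1_(B n) z = prim a \1_(B n) z - prim a \1_(B n) b.
  by rewrite (prim_shift _ _ _ (mI n) (indic_le1 (B n))).
have mf n : measurable_fun setT (f n).
  apply: measurable_funM => //.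
  exact: measurableT_comp (prim_meas b (mI n) (indic_le1 (B n))) mF.
have fb n w : `|f n w| <= 1.
  rewrite /f normrM ger0_norm ?invr_ge0 ?(ltW (e0 n))// ler_pdivrMl// mulr1.
  have i := prim_intg b (F w) (mI n) (indic_le1 (B n)).
  apply: (le_trans (Ex_norm i)); rewrite -[leRHS](Ix_itv x (ltW (e0 n))).
  apply: Ex_le; [exact: intg_norm| |].
    by apply: iB => //; rewrite lebesgue_measure_itv/=; case: ifP; rewrite ltry.
  apply: aeW => y; rewrite normrM ger0_norm; last by rewrite indicE.
  rewrite -[leRHS]mulr1; apply: ler_pM => //; rewrite ?indicE//; exact: oriented_norm_le1.
have fcv w : f n w @[n --> \oo] --> ((x <= F w)%R%:R : R).
  have [xF|Fx] := leP x (F w).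
    rewrite (_ : (fun n => _) = (fun=> 1)); first exact: cvg_cst.
    apply/funext => n; rewrite /f.
    rewrite (_ : prim _ _ _ = e n) ?mulVf ?gt_eqF//.
    rewrite -[RHS](Ix_itv x (ltW (e0 n))); apply: eq_Rintegral => y _.
    rewrite orientedE -/(B n) indicE; have [|] := boolP (y \in B n); rewrite ?mul0r//.
    rewrite inE /B /= in_itv/= => /andP[y1 y2].
    rewrite (le_trans y2 xF) (_ : (y <= b) = false) ?mul1r ?subr0//.
    by apply/negbTE; rewrite -ltNge; apply: le_lt_trans y1; rewrite /b lerB.
  apply: cvg_near_cst.
  have d0 : 0 < x - F w by rewrite subr_gt0.
  have [N hN] := (cvg0P (@invn_ge0 R)).1 (@cvg_invn R) _ d0.
  exists N => // n /hN en /=; apply/eqP; rewrite /f.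
  rewrite (_ : prim _ _ _ = 0) ?mulr0//.
  rewrite /prim (_ : (fun y => _) = (fun=> 0)); first by rewrite Rintegral_cst// mul0r.
  apply/funext => y; rewrite orientedE indicE.
  have [|] := boolP (y \in B n); rewrite ?mul0r//.
  rewrite inE /B /= in_itv/= => /andP[y1 y2].
  rewrite (_ : (y <= b) = false); last first.
    by apply/negbTE; rewrite -ltNge; apply: le_lt_trans y1; rewrite /b lerB.
  rewrite (_ : (y <= F w) = false) ?subrr ?mulr0//.
  by apply/negbTE; rewrite -ltNge; apply: lt_trans y1; rewrite ltrBrDr addrC -ltrBrDr; exact: en.
have : Ex (fun w => f n w * h w) @[n --> \oo] --> Ex (fun w => (x <= F w)%R%:R * h w).
  have [] // := @dominated_Ex _ _ _ nu (fun n w => f n w * h w)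
    (fun w => (x <= F w)%R%:R * h w) (fun w => `|h w|).
  - by move=> n; exact: measurable_funM.
  - exact: measurable_funM.
  - by apply: aeW => w; apply: cvgM; [exact: fcv|exact: cvg_cst].
  - exact: intg_norm.
  - by apply: aeW => w n; rewrite normrM ler_piMl.
move=> cv; rewrite oppr_ge0 -(cvg_lim _ cv)//; apply: limr_le.
  by apply/cvg_ex; eexists; exact: cv.
apply: nearW => n.
have iprim : intg (fun w => prim a \1_(B n) (F w) * h w).
  rewrite (_ : (fun w => _) = (fun w => e n * (f n w * h w) + - prim b \1_(B n) a * h w)).
    apply: intgD; last exact: intgZ.
    apply: intgZ; apply: (@intg_bddM _ _ _ _ _ _ 1) => //; exact: aeW.
  apply/funext => w; rewrite /f !mulrA mulfV ?mul1r ?gt_eqF// -mulrDl; congr (_ * _).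
  by rewrite -(prim_shift b a (F w) (mI n) (indic_le1 (B n))).
rewrite (_ : Ex (fun w => f n w * h w) = (e n)^-1 *
   (Ex (fun w => prim a \1_(B n) (F w) * h w) - prim a \1_(B n) b * Ex h)).
  rewrite h0 mulr0 subr0 Hprim// mulrN oppr_le0; apply: mulr_ge0.
    by rewrite invr_ge0 ltW.
  by apply: Rintegral_ge0 => w _; rewrite indicE.
rewrite -(ExZ (prim a \1_(B n) b) ih) -ExB; [|exact: iprim|exact: intgZ].
rewrite -ExZ; last by apply: intgB; [exact: iprim|exact: intgZ].
by apply: eq_Rintegral => w _; rewrite /f shift; ring.
Qed.

(** On sets of finite Lebesgue measure this is Fubini and the hypothesis on
    primitives of indicators; the general case follows by monotone limits, now
    that the density is known to be nonnegative. *)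
Lemma tail_density : is_density nu F p.
Proof.
have law (B : set R) : measurable B -> (Ex (fun w => \1_B (F w)))%:E = nu (F @^-1` B).
  move=> mB.
  have mFB : measurable (F @^-1` B) by rewrite -[X in measurable X]setTI; exact: mF.
  rewrite (_ : (fun w => \1_B (F w)) = \1_(F @^-1` B)).
    by rewrite fineK ?integral_indic ?setIT//; exact: fin_num_measure.
  by apply/funext => w; rewrite !indicE; congr (_%:R); apply/idP/idP; rewrite !inE.
have fin (B : set R) : measurable B -> (mu B < +oo)%E ->
    (\int[mu]_(y in B) (p y)%:E = nu (F @^-1` B))%E.
  move=> mB Bfin; rewrite -law// -dens_fin// fineK; last exact: integrable_fin_num (iBp mB Bfin).
  rewrite [LHS]integral_mkcond; apply: eq_integral => y _.
  by rewrite patchE indicE; case: ifP; rewrite ?mulr1 ?mulr0.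
split; [exact: mp|exact: tail_ge0|move=> B mB].
pose K (n : nat) : set R := B `&` `]- n%:R, n%:R]%classic.
have mK n : measurable (K n) by apply: measurableI => //; exact: measurable_itv.
have KB : \bigcup_n K n = B.
  apply/seteqP; split=> [y [n _ []]//|y By].
  near \oo => n; exists n => //; split => //=; rewrite in_itv/=.
  have : `|y| < n%:R by near: n; exact: nbhs_infty_gtr.
  by rewrite ltr_norml => /andP[-> /ltW].
have ndK : nondecreasing_seq K.
  move=> m n mn; apply/subsetPset => y [By]; split => //; move: b.
  rewrite /= !in_itv/= => /andP[y1 y2]; rewrite (le_trans y2) ?ler_nat// andbT.
  by apply: le_lt_trans y1; rewrite lerN2 ler_nat.
have c1 : (\int[mu]_(y in K n) (p y)%:E)%E @[n --> \oo] -->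
    (\int[mu]_(y in \bigcup_n K n) (p y)%:E)%E.
  apply: ge0_nondecreasing_set_cvg_integral => //.
  - by move=> n; apply/measurable_EFinP; exact: measurable_funTS.
  - by move=> n y _; rewrite lee_fin; exact: tail_ge0.
rewrite KB in c1.
have c2 : nu (F @^-1` K n) @[n --> \oo] --> nu (F @^-1` B).
  rewrite -KB preimage_bigcup; apply: nondecreasing_cvg_mu.
  - by move=> n; rewrite -[X in measurable X]setTI; exact: mF.
  - apply: bigcupT_measurable => n; rewrite -[X in measurable X]setTI; exact: mF.
  - move=> m n mn; apply/subsetPset => w; have /subsetPset := ndK m n mn; exact.
have e n : (\int[mu]_(y in K n) (p y)%:E)%E = nu (F @^-1` K n).
  apply: fin => //; apply: (@le_lt_trans _ _ (mu `]- n%:R, n%:R]%classic)).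
    by apply: le_measure; rewrite ?inE; [exact: mK|exact: measurable_itv|exact: subIsetr].
  by rewrite lebesgue_measure_itv/=; case: ifP; rewrite ltry.
rewrite /pushforward; rewrite -(cvg_lim (@ereal_hausdorff R) c2)//.
by rewrite -(cvg_lim (@ereal_hausdorff R) c1)//; congr (limn _); apply/funext => n; rewrite e.
Unshelve. all: end_near. Qed.

End tail_density.

(** * The density formula *)

Theorem proposition3p1 (d : measure_display) (T : measurableType d)
    (R : realType) (nu : probability T R) (A A0 : set (T -> R))
    (Gam : (T -> R) -> (T -> R) -> (T -> R)) (L : (T -> R) -> (T -> R))
    (HM : full_markov_triple nu A A0 Gam L)
    (F : T -> R) (HF : DomE nu A0 Gam F)
    (H1 : exists p : R, [/\ 1 < p,
       (\int[nu]_w ((Gam F F w)%:E `^ p)^-1 < +oo)%E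
     & ('E_nu[(fun w => Gam F F w `^ (p / (p - 1)))%R] < +oo)%E])
    (tau : R -> R) (H2 : cond_exp_given nu (Gam F F) F tau)
    (a : R) (Hdef : {ae nu, forall w, primitive_defined tau a (F w)})
    (H3 : DomL nu A0 Gam (primitive_inv tau a \o F)) :
  exists pF : R -> R, is_density nu F pF /\
    forall x : R, (pF x)%:E =
      (- 'E_nu[(fun w => \1_[set v | x <= F v] w * L (primitive_inv tau a \o F) w)%R])%E.
Proof.
have mF := DomE_meas HM HF; have iG := DomE_Gam_intg HM HF HF.
have mtau : measurable_fun setT tau by case: H2.
have [p [p1 Hp _]] := H1.
have [Gpos iV] := inverse_moment p1 (intg_meas iG) (DomE_Gam_ge0 HM HF) Hp.
have DX : DomE nu A0 Gam (primitive_inv tau a \o F) by case: H3.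
have hX := has_deriv_primitive HM HF H2 Gpos iV Hdef DX.
set h := L (primitive_inv tau a \o F).
have [mh h2] := (Lfun2P _ _).1 (L_DomL HM H3).
have ih := intg_L1 mh h2.
(* integration by parts of [L (f0 (F))] against elements that have a derivative
   along [F] *)
have ibp Y eta : has_deriv nu A0 Gam F Y eta ->
    Rintegral nu setT (fun w => Y w * h w) =
    - Rintegral nu setT (fun w => posinv (tau (F w)) * eta w * Gam F F w).
  move=> hY; have [DY _] := has_deriv_q HM HF hY.
  have := L_DomL_ibp HM H3 DY; rewrite (dformE HM DX DY).
  rewrite exp_Ex; last exact: (intg_prod (DomE_meas HM DY) mh (DomE_sq HM DY) h2).
  by case=> ->; rewrite (has_deriv_dform HM HF hX hY).2.
have h0 : Rintegral nu setT h = 0.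
  (* the constant 1 has derivative 0 *)
  have := ibp _ _ (has_deriv_chain HM HF (chain_cst HM 1)).
  rewrite (_ : Rintegral nu setT (fun w => _ * h w) = Rintegral nu setT h).
    move=> ->; rewrite (_ : (fun w => _) = (fun=> 0)) ?Ex_cst ?oppr0//.
    by apply/funext => w /=; rewrite mulr0 mul0r.
  by apply: eq_Rintegral => w _ /=; rewrite mul1r.
have Hprim (B : set R) : measurable B ->
    Rintegral nu setT (fun w => prim a \1_B (F w) * h w) =
    - Rintegral nu setT (fun w => \1_B (F w)).
  move=> mB; rewrite -(inv_tau_indic mF iG H2 Gpos iV mB).
  exact: (ibp _ _ (prim_rule_indic HM HF (prim_rule_ray HM HF a) mB)).
exists (fun y => - Rintegral nu setT (fun w => (y <= F w)%R%:R * h w)).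
split; first exact: tail_density mF ih h0 Hprim.
move=> x; rewrite exp_Ex; last first.
  apply: (@intg_bddM _ _ _ _ _ _ 1) => //.
    rewrite (_ : \1__ = (fun w => \1_(`[x, +oo[) (F w)) :> (T -> R)).
      by apply: measurableT_comp mF; apply: measurable_indic; exact: measurable_itv.
    by apply/funext => w; rewrite tailE indicE mem_setE in_itv/= andbT.
  by apply: aeW => w; rewrite tailE; case: (x <= F w)%R; rewrite ?normr1 ?normr0.
rewrite -EFinN; congr (- _)%:E.
by apply: eq_Rintegral => w _; rewrite tailE.
Qed.
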